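(* Let $m>1$ be an integer and $N>0$ a real number. The non-homogeneous (affine) extended triangle map $\tilde T^A$ on $\tilde\triangle^A_m(N)$ is the natural extension of the non-homogeneous triangle map $T$ on the simplex $\triangle_m^A$, with factor map $\psi((t_1,\dots,t_m)\times[u_1,\dots,u_m])=(t_1,\dots,t_m)$.
   Context: Let $\triangle_m^A=\{(t_1,\dots,t_m)\in\mathbb R^m:1>t_1>\cdots>t_m>0\}$. The non-homogeneous triangle map $T$ on $\triangle^A_m$ is $$T(t_1,\dots,t_m)=\Big(\tfrac{t_2}{t_1},\dots,\tfrac{t_m}{t_1},\tfrac{1-t_1}{t_1}\Big)\ \text{if }1<t_1+t_m,\qquad T(t_1,\dots,t_m)=\Big(\tfrac{t_1}{1-t_m},\dots,\tfrac{t_m}{1-t_m}\Big)\ \text{if }1>t_1+t_m.$$ Let $$\tilde\triangle_m^A(N)=\Big\{(t_1,\dots,t_m)\times[u_1,\dots,u_m]\in\mathbb R^m\times\mathbb R^m:1>t_1>\cdots>t_m>0,\ u_i>0,\ N-\sum_{i=1}^mt_iu_i>0\Big\}.$$ The map $\tilde T^A$ sends $(t_1,\dots,t_m)\times[u_1,\dots,u_m]$ to $$\Big(\tfrac{t_2}{t_1},\dots,\tfrac{t_m}{t_1},\tfrac{1-t_1}{t_1}\Big)\times\Big[t_1u_2,\dots,t_1u_m,\,t_1\big(N-\sum_{i=1}^mt_iu_i\big)\Big]\quad\text{if }1<t_1+t_m,$$ $$\Big(\tfrac{t_1}{1-t_m},\dots,\tfrac{t_m}{1-t_m}\Big)\times\Big[(1-t_m)u_1,\dots,(1-t_m)u_{m-1},(1-t_m)\big(N+u_m-\sum_{i=1}^mt_iu_i\big)\Big]\quad\text{if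 }1>t_1+t_m.$$ As usual, points whose forward orbit meets $1=t_1+t_m$ (a null set) are removed from both spaces. Measures: $\tilde\triangle_m^A(N)$ carries Lebesgue measure $\mu=dt_1\cdots dt_m\,du_1\cdots du_m$ and $\triangle_m^A$ carries $\nu=\psi_*\mu$, a constant multiple of $dt_1\cdots dt_m/(t_1\cdots t_m)$. Natural extension: given a measure preserving map $S:Y\to Y$ on $(Y,\mathcal G,\nu)$, a measure preserving map $R:X\to X$ on $(X,\mathcal F,\mu)$ is the natural extension of $S$, with factor map $\psi:X\to Y$, if (up to null sets): (1) $R$ is one-to-one; (2) $\psi$ is onto (with $\psi_*\mu=\nu$), and $\mathcal F$ is the $\sigma$-algebra generated by all $R^k\psi^{-1}(\mathcal G)$, $k\ge0$; (3) $\psi\circ R=S\circ\psi$; (4) every other such covering factors through $X$: if $R':X'\to X'$ is one-to-one and measure preserving and $\psi':X'\to Y$ is an onto measure preserving map with $\psi'\circ R'=S\circ\psi'$, then there is a measure preserving $\varphi:X'\to X$ with $\varphi\circ R'=R\circ\varphi$ and $\psi\circ\varphi=\psi'$.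
   Formalization: In clause (4), the one-to-one map R' on X' is also required to send measurable sets to measurable sets (on a full-measure invariant set); this is automatic on standard spaces, and without it the universal property fails for X' = Y×{0,1}^ℕ with trivial σ-algebra on the second factor. *)

(* Defs.v *)
From HB Require Import structures.
From mathcomp Require Import all_boot all_order all_algebra.
From mathcomp Require Import all_classical all_reals all_analysis.
From mathcomp Require Import measurable_realfun.

Set Implicit Arguments.
Unset Strict Implicit.
Unset Printing Implicit Defensive.

Import Order.TTheory GRing.Theory Num.Theory.

Local Open Scope classical_set_scope.
Local Open Scope ring_scope.

(* Measure spaces and natural extensions.

   A measure space is given by an ambient measurable type X, a measurable
   carrier D : set X and a measure mu on X, of which only the restriction to
   the measurable subsets of D matters. A map between two such spaces is a
   function on the ambient types; its values outside the carrier are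
   irrelevant. *)

Section natural_extension.
Context {R : realType}.

(* The case A = ~` D2 of the equation says that almost every point of D1 is
   sent into D2. *)
Definition measure_preserving d1 d2 (X1 : measurableType d1)
    (X2 : measurableType d2) (D1 : set X1) (mu1 : {measure set X1 -> \bar R})
    (D2 : set X2) (mu2 : {measure set X2 -> \bar R}) (f : X1 -> X2) :=
  measurable_fun D1 f /\
  forall A, measurable A -> mu1 (D1 `&` f @^-1` A) = mu2 (D2 `&` A).

(* X0 witnesses that f : D -> D is one-to-one up to null sets. In this
   measure-theoretic sense the images of measurable sets have to be measurable,
   which is automatic over standard Borel spaces (Lusin-Souslin). On arbitrary
   measure spaces mere pointwise injectivity would say nothing: it can always be
   achieved by adjoining a coordinate that the sigma-algebra does not see.
   Requiring X0 to be forward invariant is no restriction for a measure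
   preserving f: one can intersect the preimages of X0 under the iterates. *)
Definition one_to_one_on d (X : measurableType d) (D : set X)
    (mu : {measure set X -> \bar R}) (f : X -> X) (X0 : set X) :=
  [/\ [/\ measurable X0, X0 `<=` D & mu (D `\` X0) = 0%E],
      f @` X0 `<=` X0,
      set_inj X0 f &
      forall A, measurable A -> A `<=` X0 -> measurable (f @` A)].

Definition one_to_one d (X : measurableType d) (D : set X)
    (mu : {measure set X -> \bar R}) (f : X -> X) :=
  exists X0, one_to_one_on D mu f X0.

Definition onto d1 d2 (X : measurableType d1) (Y : measurableType d2)
    (D : set X) (E : set Y) (nu : {measure set Y -> \bar R}) (psi : X -> Y) :=
  nu.-negligible (E `\` psi @` D).

Definition covers d1 d2 (X : measurableType d1) (Y : measurableType d2)
    (D : set X) (mu : {measure set X -> \bar R}) (f : X -> X)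
    (E : set Y) (nu : {measure set Y -> \bar R}) (S : Y -> Y) (psi : X -> Y) :=
  [/\ measure_preserving D mu D mu f,
      measure_preserving D mu E nu psi,
      onto D E nu psi &
      \forall x \ae mu, D x -> psi (f x) = S (psi x)].

(* The sigma-algebra on X0 generated by the sets f^k (psi^-1 B), where B is
   measurable and k >= 0. *)
Definition sigma_past d1 d2 (X : measurableType d1) (Y : measurableType d2)
    (X0 : set X) (f : X -> X) (psi : X -> Y) : set (set X) :=
  <<s X0, [set C | exists (k : nat) (B : set Y),
             measurable B /\ C = iter k f @` (X0 `&` psi @^-1` B)] >>.

Definition natural_extension d1 d2 (X : measurableType d1)
    (Y : measurableType d2)
    (D : set X) (mu : {measure set X -> \bar R}) (f : X -> X)
    (E : set Y) (nu : {measure set Y -> \bar R}) (S : Y -> Y) (psi : X -> Y) :=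
  [/\ [/\ measurable D, measurable E & measure_preserving E nu E nu S],
      covers D mu f E nu S psi,
      exists2 X0, one_to_one_on D mu f X0 &
        forall A, measurable A -> A `<=` D ->
          exists2 B, sigma_past X0 f psi B &
            mu.-negligible (A `+` B) &
      forall d' (X' : measurableType d') (D' : set X')
          (mu' : {measure set X' -> \bar R}) (f' : X' -> X') (psi' : X' -> Y),
        measurable D' -> one_to_one D' mu' f' ->
        covers D' mu' f' E nu S psi' ->
        exists phi : X' -> X,
          [/\ measure_preserving D' mu' D mu phi,
              \forall x \ae mu', D' x -> phi (f' x) = f (phi x) &
              \forall x \ae mu', D' x -> psi (phi x) = psi' x]].

End natural_extension.

(* Lebesgue measure on R^n, by recursion through the identification of
   R^(n+1) with R x R^n. The factor R is written measurableTypeR R because this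
   is the measurable type on which the library's lebesgue_measure lives; its
   sigma-algebra is the canonical one of R. *)

Section cons_measure.
Local Open Scope ereal_scope.
Context {R : realType} {n : nat}.
Variable mu : {sigma_finite_measure set (n.-tuple R) -> \bar R}.

Definition cons_pair (p : measurableTypeR R * n.-tuple R) : n.+1.-tuple R :=
  [the n.+1.-tuple R of (p.1 : R) :: p.2].

Lemma measurable_cons_pair : measurable_fun setT cons_pair.
Proof.
have mfst : measurable_fun [set: measurableTypeR R * n.-tuple R]
    (fun p => p.1 : R) by exact: measurable_fst.
exact: measurable_cons mfst measurable_snd.
Qed.

Definition cons_measure : set (n.+1.-tuple R) -> \bar R :=
  pushforward (@lebesgue_measure R \x mu) cons_pair.

Let cons_measure0 : cons_measure set0 = 0.
Proof. by rewrite /cons_measure /pushforward preimage_set0 measure0. Qed.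

Let cons_measure_ge0 A : 0 <= cons_measure A.
Proof. exact: integral_ge0. Qed.

Let cons_measure_sigma_additive : semi_sigma_additive cons_measure.
Proof.
move=> F mF tF mUF; rewrite /cons_measure /pushforward preimage_bigcup.
apply: measure_semi_sigma_additive.
- by move=> k; rewrite -[X in measurable X]setTI; exact: measurable_cons_pair.
- apply/trivIsetP => /= i j _ _ ij; rewrite -preimage_setI.
  by move/trivIsetP : tF => /(_ _ _ _ _ ij) ->//; rewrite preimage_set0.
- rewrite -preimage_bigcup -[X in measurable X]setTI.
  exact: measurable_cons_pair.
Qed.

HB.instance Definition _ := isMeasure.Build _ _ _ cons_measure
  cons_measure0 cons_measure_ge0 cons_measure_sigma_additive.

Let cons_measure_sigma_finite : sigma_finite setT cons_measure.
Proof.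
have /sigma_finiteP[F1 [F1T ndF1 F1oo]] := sigma_finiteT (@lebesgue_measure R).
have /sigma_finiteP[F2 [F2T ndF2 F2oo]] := sigma_finiteT mu.
have [F UF mF] : sigma_finite setT (@lebesgue_measure R \x mu).
  exists (fun k => F1 k `*` F2 k).
    rewrite -setXTT F1T F2T predeqE => -[x y]; split.
      move=> [/= [k _ Fx] [l _ Fy]]; exists (maxn k l) => //; split.
      - by move: x Fx; exact/subsetPset/ndF1/leq_maxl.
      - by move: y Fy; exact/subsetPset/ndF2/leq_maxr.
    by move=> [k _ []/= ? ?]; split; exists k.
  move=> k; have [? ?] := F1oo k; have [? ?] := F2oo k.
  split; first exact: measurableX.
  by rewrite product_measure1E// lte_mul_pinfty// ge0_fin_numE.
pose g (t : n.+1.-tuple R) : measurableTypeR R * n.-tuple R :=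
  (thead t, [tuple of behead t]).
have gK p : g (cons_pair p) = p.
  by case: p => x t; rewrite /g /cons_pair; congr pair; apply: val_inj.
have mg : measurable_fun setT g.
  apply/measurable_fun_pair; first exact: measurable_tnth.
  exact: measurable_behead.
exists (fun i => g @^-1` F i).
  by rewrite -preimage_bigcup -UF preimage_setT.
move=> i; split.
  by rewrite -[X in measurable X]setTI; apply: mg => //; exact: (mF i).1.
rewrite /cons_measure /pushforward -comp_preimage.
rewrite (_ : g \o cons_pair = id); first exact: (mF i).2.
by apply/funext => p /=; exact: gK.
Qed.

HB.instance Definition _ := Measure_isSigmaFinite.Build _ _ _ cons_measure
  cons_measure_sigma_finite.

End cons_measure.

Fixpoint lebesgue_tuple (R : realType) (n : nat) :
    {sigma_finite_measure set (n.-tuple R) -> \bar R} :=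
  match n with
  | 0 => \d_([tuple] : 0.-tuple R)
  | k.+1 => cons_measure (lebesgue_tuple R k)
  end.

(* The triangle maps. The coordinates t_1, ..., t_m of a tuple t are
   t`_0, ..., t`_m.-1. *)

Section triangle_maps.
Variables (R : realType) (m : nat).
Implicit Types (t u : m.-tuple R) (p : m.-tuple R * m.-tuple R) (N : R).

Definition simplex : set (m.-tuple R) :=
  [set t | [/\ t`_0 < 1, (forall i, (i.+1 < m)%N -> t`_i.+1 < t`_i)
             & 0 < t`_m.-1]].

(* On the wall 1 = t_1 + t_m, where the map is undefined, the second formula
   is used; such points never belong to the carriers below. *)
Definition wall : set (m.-tuple R) := [set t | 1 = t`_0 + t`_m.-1].

Definition triangle_map t : m.-tuple R :=
  if 1 < t`_0 + t`_m.-1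
  then [tuple (if (i.+1 < m)%N then t`_i.+1 else 1 - t`_0) / t`_0 | i < m]
  else [tuple t`_i / (1 - t`_m.-1) | i < m].

Definition slack N p : R := N - \sum_(i < m) p.1`_i * p.2`_i.

Definition ext_simplex N : set (m.-tuple R * m.-tuple R) :=
  [set p : m.-tuple R * m.-tuple R |
    [/\ simplex p.1, (forall i, (i < m)%N -> 0 < p.2`_i) & 0 < slack N p]].

Definition ext_triangle_map N p : m.-tuple R * m.-tuple R :=
  let t := p.1 in let u := p.2 in
  (triangle_map t,
   if 1 < t`_0 + t`_m.-1
   then [tuple t`_0 * (if (i.+1 < m)%N then u`_i.+1 else slack N p) | i < m]
   else [tuple (1 - t`_m.-1) *
           (if (i.+1 < m)%N then u`_i else slack N p + u`_i) | i < m]).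

Definition triangle_domain : set (m.-tuple R) :=
  simplex `&` [set t | forall k, ~ wall (iter k triangle_map t)].

Definition ext_triangle_domain N : set (m.-tuple R * m.-tuple R) :=
  ext_simplex N `&` [set p | forall k, ~ wall (iter k (ext_triangle_map N) p).1].

Let measurable_nth k : measurable_fun setT (fun t => t`_k).
Proof.
have [km|km] := ltnP k m.
  rewrite (_ : (fun t => t`_k) = @tnth _ _ ^~ (Ordinal km)).
    exact: measurable_tnth.
  by apply/funext => t; rewrite (tnth_nth 0).
rewrite (_ : (fun t => t`_k) = cst 0); first exact: measurable_cst.
by apply/funext => t; rewrite nth_default// size_tuple.
Qed.

Let measurable_nth1 k : measurable_fun setT (fun p => p.1`_k).
Proof. exact: (measurableT_comp (measurable_nth k)). Qed.

Let measurable_nth2 k : measurable_fun setT (fun p => p.2`_k).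
Proof. exact: (measurableT_comp (measurable_nth k)). Qed.

Let measurable_slack N : measurable_fun setT (slack N).
Proof.
apply: measurable_funB => //; apply: measurable_sum => i.
exact: measurable_funM.
Qed.

Let measurable_mktuple d (X : measurableType d) (F : 'I_m -> X -> R) :
  (forall i, measurable_fun setT (F i)) ->
  measurable_fun setT (fun x => [tuple F i x | i < m]).
Proof.
move=> mF; apply/measurable_fun_tnthP => i.
rewrite (_ : _ \o _ = F i); first exact: mF.
by apply/funext => x /=; rewrite tnth_mktuple.
Qed.

Let measurable_inv d (X : measurableType d) (f : X -> R) :
  measurable_fun setT f -> measurable_fun setT (fun x => (f x)^-1).
Proof.
move=> mf.
suff minv : measurable_fun [set: R] GRing.inv by exact: measurableT_comp minv mf.
rewrite (_ : GRing.inv = fun x : R => if x == 0 then 0 else x^-1); last first.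
  by apply/funext => x; case: eqP => // ->; rewrite invr0.
apply: measurable_fun_if => //.
- exact: measurable_fun_eqr.
- rewrite setTI; apply: open_continuous_measurable_fun.
    rewrite (_ : _ @^-1` _ = ~` [set 0 : R]).
      by apply: closed_openC; exact: closed_eq.
    by apply/seteqP; split => x /=; [move=> /eqP|move/eqP/negPf].
  by move=> x; rewrite inE/= => /negbT x0; exact: inv_continuous.
Qed.

Lemma measurable_triangle_map : measurable_fun setT triangle_map.
Proof.
apply: measurable_fun_ifT.
- by apply: measurable_fun_ltr => //; exact: measurable_funD.
- apply: measurable_mktuple => i; apply: measurable_funM.
    by case: (i.+1 < m)%N => //; exact: measurable_funB.
  exact: measurable_inv.
- apply: measurable_mktuple => i; apply: measurable_funM => //.
  by apply: measurable_inv; exact: measurable_funB.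
Qed.

Lemma measurable_ext_triangle_map N : measurable_fun setT (ext_triangle_map N).
Proof.
apply: measurable_fun_pair.
  exact: measurableT_comp measurable_triangle_map measurable_fst.
apply: measurable_fun_ifT.
- by apply: measurable_fun_ltr => //; exact: measurable_funD.
- apply: measurable_mktuple => i.
  by apply: measurable_funM => //; case: (i.+1 < m)%N.
- apply: measurable_mktuple => i.
  apply: measurable_funM; first exact: measurable_funB.
  by case: (i.+1 < m)%N => //; exact: measurable_funD.
Qed.

Let measurable_ltr_set d (X : measurableType d) (f g : X -> R) :
  measurable_fun setT f -> measurable_fun setT g ->
  measurable [set x | f x < g x].
Proof.
move=> mf mg; rewrite -[X in measurable X]setTI.
exact: (measurable_fun_ltr mf mg) measurableT [set true] _.
Qed.

Let measurable_iter d (X : measurableType d) (f : X -> X) k :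
  measurable_fun setT f -> measurable_fun setT (iter k f).
Proof.
move=> mf; elim: k => [|k IH]; first exact: measurable_id.
exact: measurableT_comp.
Qed.

Let measurable_imply d (X : measurableType d) (b : bool) (A : set X) :
  measurable A -> measurable [set x | b -> A x].
Proof.
case: b => mA.
  rewrite (_ : mkset _ = A) //.
  by apply/seteqP; split => [x /(_ isT)|x Ax _].
rewrite (_ : mkset _ = setT); first exact: measurableT.
by apply/seteqP; split => x.
Qed.

Lemma measurable_simplex : measurable simplex.
Proof.
rewrite (_ : simplex = [set t | t`_0 < 1] `&`
  \bigcap_i [set t | (i.+1 < m)%N -> t`_i.+1 < t`_i] `&`
  [set t | 0 < t`_m.-1]).
  apply: measurableI; last exact: measurable_ltr_set.
  apply: measurableI; first exact: measurable_ltr_set.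
  apply: bigcapT_measurable => i; apply: measurable_imply.
  exact: measurable_ltr_set.
apply/seteqP; split => t /=.
  by case=> t0 td tm; split=> //; split=> // i _; exact: td.
by case=> -[t0 td tm]; split=> // i; exact: td.
Qed.

Let measurable_wall : measurable wall.
Proof.
rewrite /wall (_ : mkset _ = [set t | 1 == t`_0 + t`_m.-1]); last first.
  by apply/seteqP; split => t /eqP.
rewrite -[X in measurable X]setTI.
have : measurable_fun setT (fun t => 1 == t`_0 + t`_m.-1).
  by apply: measurable_fun_eqr => //; exact: measurable_funD.
by move/(_ measurableT [set true]); exact.
Qed.

Lemma measurable_triangle_domain : measurable triangle_domain.
Proof.
apply: measurableI; first exact: measurable_simplex.
rewrite (_ : mkset _ = \bigcap_k iter k triangle_map @^-1` ~` wall).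
  apply: bigcapT_measurable => k; rewrite -[X in measurable X]setTI.
  apply: measurable_iter => //; first exact: measurable_triangle_map.
  exact: measurableC.
by apply/seteqP; split => [t tw k _|t tw k]; exact: tw.
Qed.

Lemma measurable_ext_triangle_domain N : measurable (ext_triangle_domain N).
Proof.
apply: measurableI.
  rewrite (_ : ext_simplex N = fst @^-1` simplex `&`
    \bigcap_i [set p : m.-tuple R * m.-tuple R | (i < m)%N -> 0 < p.2`_i] `&`
    [set p | 0 < slack N p]).
    apply: measurableI; last exact: measurable_ltr_set.
    apply: measurableI.
      rewrite -[X in measurable X]setTI.
      by apply: measurable_fst => //; exact: measurable_simplex.
    apply: bigcapT_measurable => i; apply: measurable_imply.
    exact: measurable_ltr_set.
  apply/seteqP; split => p /=.
    by case=> pt pu pw; split=> //; split=> // i _; exact: pu.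
  by case=> -[pt pu pw]; split=> // i; exact: pu.
rewrite (_ : mkset _ =
  \bigcap_k (fst \o iter k (ext_triangle_map N)) @^-1` ~` wall).
  apply: bigcapT_measurable => k; rewrite -[X in measurable X]setTI.
  apply: measurableT_comp => //; last exact: measurableC.
  exact: measurable_iter (measurable_ext_triangle_map N).
by apply/seteqP; split => [p pw k _|p pw k]; exact: pw.
Qed.

End triangle_maps.

Arguments triangle_map {R m} t.
Arguments ext_triangle_map {R m} N p.
Arguments triangle_domain R m : clear implicits.
Arguments ext_triangle_domain {R} m N.

Section triangle_measures.
Variables (R : realType) (m : nat) (N : R).

Definition ext_triangle_measure :
    {measure set (m.-tuple R * m.-tuple R) -> \bar R} :=
  (lebesgue_tuple R m \x lebesgue_tuple R m)%E.

Definition ext_triangle_measure_restr :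
    {measure set (m.-tuple R * m.-tuple R) -> \bar R} :=
  mrestr ext_triangle_measure (@measurable_ext_triangle_domain R m N).

Definition triangle_measure : set (m.-tuple R) -> \bar R :=
  pushforward ext_triangle_measure_restr fst.

Let measurable_preimage_fst (A : set (m.-tuple R)) :
  measurable A -> measurable (fst @^-1` A : set (m.-tuple R * m.-tuple R)).
Proof.
by move=> mA; rewrite -[X in measurable X]setTI; exact: measurable_fst.
Qed.

Let triangle_measure0 : triangle_measure set0 = 0%E.
Proof. by rewrite /triangle_measure /pushforward preimage_set0 measure0. Qed.

Let triangle_measure_ge0 A : (0 <= triangle_measure A)%E.
Proof. exact: measure_ge0. Qed.

Let triangle_measure_sigma_additive : semi_sigma_additive triangle_measure.
Proof.
move=> F mF tF mUF; rewrite /triangle_measure /pushforward preimage_bigcup.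
apply: measure_semi_sigma_additive.
- by move=> k; exact: measurable_preimage_fst.
- apply/trivIsetP => /= i j _ _ ij; rewrite -preimage_setI.
  by move/trivIsetP : tF => /(_ _ _ _ _ ij) ->//; rewrite preimage_set0.
- by rewrite -preimage_bigcup; exact: measurable_preimage_fst.
Qed.

HB.instance Definition _ := isMeasure.Build _ _ _ triangle_measure
  triangle_measure0 triangle_measure_ge0 triangle_measure_sigma_additive.

End triangle_measures.

Arguments triangle_measure {R} m N _.

(* Main.v *)
Require Import Defs.
From HB Require Import structures.
From mathcomp Require Import all_boot all_order all_algebra.
From mathcomp Require Import all_classical all_reals all_analysis.
From mathcomp Require Import measurable_realfun ring lra.

Set Implicit Arguments.
Unset Strict Implicit.
Unset Printing Implicit Defensive.

Import Order.TTheory GRing.Theory Num.Theory.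
Import numFieldNormedType.Exports.

Local Open Scope classical_set_scope.
Local Open Scope ring_scope.

(** Three facts are combined.

    A criterion. A one-to-one measure preserving map f restricts to a bijection of
    a set K of full measure, with measurable inverse h; the past of a point x is
    the sequence of the psi (h^k x). Its first k terms are determined by the k-th
    one through S, and each term has the law nu, so the law of the past only
    depends on the factor and is the same for all one-to-one coverings of it. If
    moreover almost every x can be recovered from its past as Phi (past x) with Phi
    measurable, then the measurable sets are generated by the past, and for every
    other covering X' the composition of Phi with the past in X' is the required
    map to X (natural_extension_criterion).

    Invariance. Each branch of the extended map sends (t, u) to (base t, fib_t u)
    with fib_t affine. With a = t_1 or a = 1 - t_m, the Jacobian of fib_t is
    a^(m+1) and that of the base is a^-(m+1); the images of the two branches are
    the parts slack > u_m and slack < u_m of the domain, which exhaust it up to a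
    null set (ext_triangle_measure_preserving). The Jacobians are computed by
    Tonelli's theorem, one coordinate at a time: apart from scalings and
    translations, only a' = 1/a - 1 has to be substituted.

    Recovery of (t, u) from its past. The vector Y = (slack, u_1, ..., u_m)
    satisfies Y_0 + t_1 Y_1 + ... + t_m Y_m = N, and up to a positive factor the
    extended map acts on it by one of two nonnegative matrices, according to the
    branch that t is in. So the past of t confines the line of Y to a decreasing
    sequence of cones, and the normalization fixes Y on that line. The 2m-th power
    of the matrix of the first branch has positive entries, so each run of 2m digits
    of the first kind contracts the cones by a constant factor
    (recurrent_contraction). Almost every past contains such runs, arbitrarily far
    back: the volume V(t) of the points over t whose past has none, relative to
    that of the whole fibre, is at most (V(t_B) + t_m V(t_A)) / (1 + t_m), where
    t_A and t_B are the preimages of t. Read as a Markov chain, which reaches a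
    run from everywhere with a probability bounded below, this forces V = 0 (decay,
    no_run_null). *)

Definition image_measure d d' (T1 : measurableType d) (T2 : measurableType d')
    (R : realFieldType) (m : {measure set T1 -> \bar R}) (f : T1 -> T2)
    (mf : measurable_fun setT f) : {measure set T2 -> \bar R} :=
  measure_function_pushforward__canonical__measure_function_Measure m mf.

(** * Affine and projective changes of variable on the line *)

Section line.
Context {R : realType}.
Local Notation leb := (@lebesgue_measure R).

Lemma measurable_affine (r b : R) :
  measurable_fun setT ((fun x : R => r * x + b) : measurableTypeR R -> measurableTypeR R).
Proof.
have : measurable_fun [set: R] (fun x => r * x + b).
  by apply: measurable_funD => //; exact: measurable_funM.
exact.
Qed.

Lemma lebesgue_affine_preimage (r b : R) (A : set R) : r != 0 -> measurable A ->
  leb ((fun x : R => r * x + b) @^-1` A) = ((`|r|^-1)%:E * leb A)%E.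
Proof.
move=> r0 mA.
have r0' : 0 < `|r| by rewrite normr_gt0.
pose rn : {nonneg R} := NngNum (normr_ge0 r).
pose f : measurableTypeR R -> measurableTypeR R := fun x : R => r * x + b.
have mf : measurable_fun setT f := measurable_affine r b.
pose pf := image_measure leb mf.
pose pm : {measure set (measurableTypeR R) -> \bar R} := mscale rn pf.
have H : forall A : set R, measurable A -> leb A = pm A.
  move=> B mB; apply: (@lebesgue_measure_unique R pm _ B mB) => _ [[x y]] _ <-.
  rewrite /pm/= /mscale/= /pushforward.
  have [r1|r1] := ltP 0 r.
    rewrite (_ : f @^-1` _ = `]((x - b) / r), ((y - b) / r)]%classic); last first.
      apply/seteqP; split=> z /=; rewrite !in_itv/= ltr_pdivrMr// ler_pdivlMr// /f;
      rewrite ltrBlDr lerBrDr (mulrC z r)//.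
    rewrite !lebesgue_measure_itv/= !lte_fin ltr_pM2r ?invr_gt0// ltrD2r.
    case: ifPn => xy; last by rewrite mule0.
    by rewrite -!EFinB -EFinM gtr0_norm//; congr EFin; field.
  have rlt : r < 0 by rewrite lt_neqAle r0.
  rewrite (_ : f @^-1` _ = `[((y - b) / r), ((x - b) / r)[%classic); last first.
    apply/seteqP; split=> z /=; rewrite !in_itv/= ltr_ndivlMr// ler_ndivrMr// /f;
    rewrite ltrBlDr lerBrDr (mulrC z r) andbC//.
  rewrite !lebesgue_measure_itv/= !lte_fin ltr_nM2r ?invr_lt0// ltrD2r.
  case: ifPn => xy; last by rewrite mule0.
  by rewrite -!EFinB -EFinM ltr0_norm//; congr EFin; field.
rewrite [in RHS]H// /pm/= /mscale/= muleA -EFinM mulVf ?normr_eq0// mul1e.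
by [].
Qed.

Lemma integral_affine (r b : R) (F : R -> \bar R) : r != 0 ->
  measurable_fun [set: R] F -> (forall x, 0 <= F x)%E ->
  (\int[leb]_x F (r * x + b)%R = (`|r|^-1)%:E * \int[leb]_x F x)%E.
Proof.
move=> r0 mF F0.
pose rn : {nonneg R} := NngNum (normr_ge0 r^-1).
pose f : measurableTypeR R -> measurableTypeR R := fun x : R => r * x + b.
have := @ge0_integral_pushforward _ _ _ _ R f (measurable_affine r b) leb setT F
  measurableT mF (fun _ _ => F0 _).
rewrite preimage_setT => <-.
rewrite -normfV -(@ge0_integral_mscale _ _ _ leb setT measurableT rn F)//.
apply: (@eq_measure_integral _ _ _ setT (mscale rn leb) (image_measure leb (measurable_affine r b))).
move=> A mA _; rewrite /= /pushforward.
have -> := lebesgue_affine_preimage b r0 (mA : measurable (A : set R)).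
by rewrite /mscale/= normfV.
Qed.
End line.

Section haar.
Local Open Scope ereal_scope.
Context {R : realType}.
Local Notation leb := (@lebesgue_measure R).

Lemma measurable_invr : measurable_fun [set: R] (@GRing.inv R).
Proof.
rewrite (_ : GRing.inv = fun x : R => if x == 0%R then 0%R else x^-1%R); last first.
  by apply/funext => x; case: eqP => // ->; rewrite invr0.
apply: measurable_fun_if => //; first exact: measurable_fun_eqr.
rewrite setTI; apply: open_continuous_measurable_fun.
  rewrite (_ : _ @^-1` _ = ~` [set 0%R : R]).
    by apply: closed_openC; exact: closed_eq.
  by apply/seteqP; split => x /=; [move=> /eqP|move/eqP/negPf].
by move=> x; rewrite inE/= => /negbT x0; exact: inv_continuous.
Qed.

Let w (a : R) : R := if (0 < a)%R then a^-1%R else 0%R.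

Let w_ge0 a : (0 <= w a)%R.
Proof. by rewrite /w; case: ifPn => // /ltW; rewrite invr_ge0. Qed.

Let mw : measurable_fun [set: R] w.
Proof.
apply: measurable_fun_ifT; [exact: measurable_fun_ltr|exact: measurable_invr|].
exact: measurable_cst.
Qed.

(* Integration against da / a on the positive half-line. *)
Let haar (F : R -> \bar R) := \int[leb]_a (F a * (w a)%:E).

Let haar_scale (r : R) (F : R -> \bar R) : (0 < r)%R ->
  measurable_fun [set: R] F -> (forall x, 0 <= F x) ->
  haar (fun a => F (r * a)%R) = haar F.
Proof.
move=> r0 mF F0; rewrite /haar.
pose G x := F x * (w x)%:E.
have mG : measurable_fun [set: R] G.
  by apply: emeasurable_funM => //; exact/measurable_EFinP.
have G0 x : 0 <= G x by rewrite mule_ge0// lee_fin.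
transitivity (r%:E * \int[leb]_x G (r * x + 0)%R).
  rewrite -ge0_integralZl//; last 2 first.
    - by apply: (measurableT_comp mG); exact: measurable_affine.
    - by rewrite lee_fin ltW.
  apply: eq_integral => x _; rewrite /G addr0 muleCA -EFinM; congr (_ * _%:E).
  rewrite /w pmulr_rgt0//; case: ifPn => x0; last by rewrite mulr0.
  by rewrite invfM mulrA divff ?mul1r// gt_eqF.
rewrite integral_affine ?gt_eqF// gtr0_norm// muleA -EFinM divff ?mul1e//.
by rewrite gt_eqF.
Qed.

(* The uniqueness argument for Haar measures on the group of positive reals: in
   the double integral of F(1/a) h(b), substitute successively a by a/b, b by a b
   and a by a/b. Only scalings and Tonelli's theorem are needed, and the weight h
   is there to be cancelled. *)
Let haar_inv_mul (F h : R -> \bar R) :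
  measurable_fun [set: R] F -> (forall x, 0 <= F x) ->
  measurable_fun [set: R] h -> (forall x, 0 <= h x) ->
  haar (F \o GRing.inv) * haar h = haar F * haar h.
Proof.
move=> mF F0 mh h0.
have mwE : measurable_fun [set: R] (EFin \o w) by exact/measurable_EFinP.
have mFi : measurable_fun [set: R] (F \o GRing.inv).
  by apply: measurableT_comp => //; exact: measurable_invr.
have Fw0 x : 0 <= F x * (w x)%:E by rewrite mule_ge0// lee_fin.
have hw0 x : 0 <= h x * (w x)%:E by rewrite mule_ge0// lee_fin.
have wE0 x : 0 <= (w x)%:E by rewrite lee_fin.
have mM (f1 f2 : R -> \bar R) : measurable_fun [set: R] f1 ->
  measurable_fun [set: R] f2 -> measurable_fun [set: R] (fun x => f1 x * f2 x).
  exact: emeasurable_funM.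
have mf1 : measurable_fun [set: R * R] (fst : _ -> R) by exact: measurable_fst.
have mf2 : measurable_fun [set: R * R] (snd : _ -> R) by exact: measurable_snd.
pose K (p : R * R) := F (p.2 / p.1)%R * (h p.2 * (w p.2)%:E) * (w p.1)%:E.
pose K' (p : R * R) := F p.2 * (h (p.1 * p.2)%R * (w p.2)%:E) * (w p.1)%:E.
have mK : measurable_fun [set: R * R] K.
  apply: emeasurable_funM; last exact: measurableT_comp mwE mf1.
  apply: emeasurable_funM.
    apply: measurableT_comp => //; apply: measurable_funM => //.
    by apply: measurableT_comp => //; exact: measurable_invr.
  by apply: emeasurable_funM; [exact: measurableT_comp mh mf2|exact: measurableT_comp mwE mf2].
have mK' : measurable_fun [set: R * R] K'.
  apply: emeasurable_funM; last exact: measurableT_comp mwE mf1.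
  apply: emeasurable_funM; first exact: measurableT_comp mF mf2.
  apply: emeasurable_funM; last exact: measurableT_comp mwE mf2.
  by apply: measurableT_comp => //; exact: measurable_funM.
have K0 p : 0 <= K p by rewrite /K !mule_ge0 ?lee_fin//.
have K'0 p : 0 <= K' p by rewrite /K' !mule_ge0 ?lee_fin//.
transitivity (\int[leb]_b \int[leb]_a K (a, b)).
  rewrite /haar -ge0_integralZl//; last 2 first.
  - exact: mM.
  - by apply: integral_ge0 => x _ /=; apply: mule_ge0.
  apply: eq_integral => b _; rewrite /K/=.
  have [b0|b0] := ltP 0%R b; last first.
    have wb : w b = 0%R by rewrite /w ltNge b0.
    by rewrite wb !mule0 integral0_eq// => a _; rewrite !mule0 mul0e.
  rewrite -[X in X * _](@haar_scale b^-1) ?invr_gt0//.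
  rewrite /haar muleC -ge0_integralZl//; last 2 first.
  - apply: (@mM) => //; apply: (measurableT_comp mFi).
    exact: measurable_funM.
  - by move=> x _; apply: mule_ge0.
  apply: eq_integral => a _ /=.
  by rewrite invfM invrK muleCA muleA.
rewrite -(@fubini_tonelli _ _ _ _ _ leb leb K mK K0).
transitivity (\int[leb]_a \int[leb]_b K' (a, b)).
  apply: eq_integral => a _.
  have [a0|a0] := ltP 0%R a; last first.
    have wa : w a = 0%R by rewrite /w ltNge a0.
    by rewrite !integral0_eq// => b _; rewrite /K' /K /= wa mule0.
  have mG : measurable_fun [set: R] (fun b => F b * h (a * b)%R).
    apply: (@mM) => //; apply: measurableT_comp => //; exact: measurable_funM.
  have -> : \int[leb]_b K' (a, b) = (w a)%:E * haar (fun b => F b * h (a * b)%R).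
    rewrite /haar -ge0_integralZl//.
    - by apply: eq_integral => b _; rewrite /K'/= muleC !muleA.
    - exact: mM.
    - by move=> b _; rewrite !mule_ge0.
  rewrite -(@haar_scale a^-1) ?invr_gt0//; last by move=> x; rewrite mule_ge0.
  rewrite /haar -ge0_integralZl//.
  - apply: eq_integral => b _; rewrite /K/= mulrA divff ?gt_eqF// mul1r.
    by rewrite [in RHS]muleC (mulrC b) !muleA.
  - apply: (@mM) => //; apply: (@mM).
      by apply: (measurableT_comp mF); exact: measurable_funM.
    apply: (measurableT_comp mh).
    by apply: measurable_funM => //; exact: measurable_funM.
  - by move=> b _; rewrite !mule_ge0.
rewrite (@fubini_tonelli _ _ _ _ _ leb leb K' mK' K'0).
rewrite muleC /haar -ge0_integralZl//; last 2 first.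
- exact: mM.
- by apply: integral_ge0 => x _ /=; apply: mule_ge0.
apply: eq_integral => b _.
have [b0|b0] := ltP 0%R b; last first.
  have wb : w b = 0%R by rewrite /w ltNge b0.
  by rewrite wb !mule0; apply: integral0_eq => a _; rewrite /K'/= wb !mule0 mul0e.
rewrite -[X in X * _](@haar_scale b)// /haar muleC -ge0_integralZl//; last 2 first.
- apply: (@mM) => //; apply: (measurableT_comp mh); exact: measurable_funM.
- by move=> x _; apply: mule_ge0.
apply: eq_integral => a _; rewrite /K'/= (mulrC a).
by rewrite !muleA; congr (_ * _); rewrite -!muleA; congr (_ * _); rewrite muleC.
Qed.

Let haar_inv (F : R -> \bar R) :
  measurable_fun [set: R] F -> (forall x, 0 <= F x) ->
  haar (F \o GRing.inv) = haar F.
Proof.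
move=> mF F0.
pose h (x : R) : \bar R := (\1_(`[1, 2]%classic : set R) x)%:E.
have mh : measurable_fun [set: R] h.
  apply/measurable_EFinP; exact: measurable_indic.
have h0 x : 0 <= h x by rewrite lee_fin.
have hE : \int[leb]_x h x = 1.
  by rewrite /h integral_indic// setIT /= lebesgue_measure_itv/= lte_fin ltr1n -EFinB; congr EFin; ring.
have mwE : measurable_fun [set: R] (EFin \o w) by exact/measurable_EFinP.
have hlt : haar h <= 1.
  rewrite -hE.
  apply: ge0_le_integral => //.
  - by move=> x _; rewrite mule_ge0// lee_fin.
  - exact: emeasurable_funM.
  - move=> x _; rewrite /h -EFinM lee_fin indicE.
    case: (boolP (x \in _)); rewrite ?mul0r// inE/= in_itv/= mul1r => /andP[x1 x2].
    by rewrite /w (lt_le_trans _ x1)// invf_le1// (lt_le_trans _ x1).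
have hgt : (2^-1)%:E <= haar h.
  rewrite -[X in X <= _]mule1 -hE -ge0_integralZl//.
  apply: ge0_le_integral => //.
  - by move=> x _; rewrite mule_ge0// lee_fin.
  - exact: measurable_funeM.
  - exact: emeasurable_funM.
  - move=> x _; rewrite /h muleC -EFinM lee_fin indicE.
    case: (boolP (x \in _)); rewrite ?mulr0 ?mul0r// inE/= in_itv/= ?mul1r ?mulr1 => /andP[x1 x2].
    rewrite /w (lt_le_trans _ x1)// lef_pV2// posrE//.
    exact: lt_le_trans x1.
have hf : haar h \is a fin_num.
  by rewrite ge0_fin_numE ?(le_lt_trans hlt) ?ltry// (le_trans _ hgt)// lee_fin.
have hn0 : haar h != 0 by rewrite gt_eqF// (lt_le_trans _ hgt)// lte_fin.
have := haar_inv_mul mF F0 mh h0.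
move/(congr1 (fun x => x * ((fine (haar h))^-1)%:E)).
have hc : haar h * ((fine (haar h))^-1)%:E = 1.
  by rewrite -{1}(fineK hf) -EFinM mulfV// fine_eq0.
by rewrite -!muleA hc !mule1.
Qed.

(** After a translation, G(x - 1) dx is x G(x - 1) dx/x, so that this is the
    invariance of dx/x under inversion; no derivative has to be computed. *)
Lemma integral_inv_sub1 (G : R -> \bar R) :
  measurable_fun [set: R] G -> (forall x, 0 <= G x) ->
  \int[leb]_a (if (0 < a)%R then (a ^- 2)%:E * G (a^-1 - 1)%R else 0) =
  \int[leb]_x (if (- 1 < x)%R then G x else 0).
Proof.
move=> mG G0.
pose F (x : R) := (if (0 < x)%R then x%:E else 0) * G (x - 1)%R.
have mF : measurable_fun [set: R] F.
  apply: emeasurable_funM.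
    by apply: measurable_fun_ifT => //; exact: measurable_fun_ltr.
  by apply: measurableT_comp => //; exact: measurable_funB.
have F0 x : 0 <= F x.
  by rewrite /F mule_ge0//; case: ifPn => // /ltW; rewrite lee_fin.
transitivity (haar (F \o GRing.inv)).
  apply: eq_integral => a _; rewrite /F/= invr_gt0 /w; case: ifPn => a0.
    by rewrite -[in RHS]muleAC -EFinM -expr2 exprVn.
  by rewrite mule0.
rewrite haar_inv//.
have -> : haar F = \int[leb]_x (if (0 < x)%R then G (x - 1)%R else 0).
  apply: eq_integral => x _; rewrite /F /w; case: ifPn => x0; last by rewrite mule0.
  by rewrite muleAC -EFinM divff ?mul1e// gt_eqF.
have := @integral_affine R 1%R 1%R (fun x => if (0 < x)%R then G (x - 1)%R else 0).
rewrite normr1 invr1 mul1e => <-.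
- by apply: eq_integral => x _; rewrite mul1r -ltrBlDr sub0r addrK.
- by rewrite oner_eq0.
- apply: measurable_fun_ifT => //; first exact: measurable_fun_ltr.
  by apply: (measurableT_comp mG); exact: measurable_funB.
- by move=> x; case: ifPn.
Qed.

End haar.

(** * Iterated integrals over tuples *)

Section measurable_tuples.
Context {R : realType} d (X : measurableType d).

Lemma measurable_rcons n (f : X -> R) (g : X -> n.-tuple R) :
  measurable_fun setT f -> measurable_fun setT g ->
  measurable_fun setT (fun x => [tuple of rcons (g x) (f x)]).
Proof.
move=> mf mg; apply/measurable_fun_tnthP => i.
have [ni|ni] := ltnP i n.
  rewrite (_ : _ \o _ = (fun t => tnth t (Ordinal ni)) \o g).
    by apply: measurableT_comp => //; exact: measurable_tnth.
  by apply/funext => x /=; rewrite !(tnth_nth 0)/= nth_rcons size_tuple ni.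
rewrite (_ : _ \o _ = f)//.
have {ni} -> : i = ord_max by apply/val_inj/eqP; rewrite eqn_leq ni -ltnS ltn_ord.
by apply/funext => x /=; rewrite (tnth_nth 0)/= nth_rcons size_tuple ltnn eqxx.
Qed.

Lemma measurable_map_tuple n (f : X -> R) (g : X -> n.-tuple R) :
  measurable_fun setT f -> measurable_fun setT g ->
  measurable_fun setT (fun x => [tuple of map ( *%R (f x)) (g x)]).
Proof.
move=> mf mg; apply/measurable_fun_tnthP => i.
rewrite (_ : _ \o _ = fun x => f x * tnth (g x) i).
  apply: measurable_funM => //.
  by apply: (measurableT_comp (measurable_tnth i)).
by apply/funext => x /=; rewrite tnth_map.
Qed.

End measurable_tuples.

Section tuples.
Local Open Scope ereal_scope.
Context {R : realType}.
Local Notation leb := (@lebesgue_measure R).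
Local Notation lam := (lebesgue_tuple R).

Let mcons n : measurable_fun [set: measurableTypeR R * n.-tuple R]
  (fun p => [tuple of (p.1 : R) :: p.2]).
Proof.
have mfst : measurable_fun [set: measurableTypeR R * n.-tuple R]
    (fun p => p.1 : R) by exact: measurable_fst.
exact: measurable_cons mfst measurable_snd.
Qed.

Section cons.
Variables (n : nat) (F : n.+1.-tuple R -> \bar R).
Hypotheses (mF : measurable_fun setT F) (F0 : forall t, 0 <= F t).

Let integral_prod :
  \int[lam n.+1]_t F t = \int[leb \x lam n]_p F [tuple of (p.1 : R) :: p.2].
Proof.
rewrite [LHS](ge0_integral_pushforward (@mcons n) (leb \x lam n))//.
Qed.

Let mF' : measurable_fun [set: measurableTypeR R * n.-tuple R]
  (fun p => F [tuple of (p.1 : R) :: p.2]).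
Proof. exact: measurableT_comp mF (@mcons n). Qed.

Lemma integral_tuple_cons :
  \int[lam n.+1]_t F t = \int[leb]_x \int[lam n]_s F [tuple of x :: s].
Proof. by rewrite integral_prod fubini_tonelli1. Qed.

Lemma integral_tuple_cons' :
  \int[lam n.+1]_t F t = \int[lam n]_s \int[leb]_x F [tuple of x :: s].
Proof. by rewrite integral_prod fubini_tonelli2. Qed.

End cons.

(** The measure is built by adding coordinates in front; that they may as well
    be added at the back is an induction, exchanging the two ends. *)
Lemma integral_tuple_rcons n (F : n.+1.-tuple R -> \bar R) :
  measurable_fun setT F -> (forall t, 0 <= F t) ->
  \int[lam n.+1]_t F t = \int[lam n]_s \int[leb]_x F [tuple of rcons s x].
Proof.
elim: n F => [|n IH] F mF F0.
  rewrite (integral_tuple_cons' mF F0); apply: eq_integral => s _.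
  by apply: eq_integral => x _; congr F; apply: val_inj; rewrite /= tuple0.
rewrite integral_tuple_cons//.
rewrite [RHS]integral_tuple_cons//; last 2 first.
- have mG : measurable_fun [set: n.+1.-tuple R * measurableTypeR R]
      (fun p => F [tuple of rcons p.1 (p.2 : R)]).
    apply: measurableT_comp => //.
    have ms : measurable_fun [set: n.+1.-tuple R * measurableTypeR R]
      (fun p => p.2 : R) by exact: measurable_snd.
    exact: measurable_rcons ms measurable_fst.
  by apply: (@measurable_fun_fubini_tonelli_F _ _ _ _ _ leb _ mG) => p.
- by move=> t; exact: integral_ge0.
apply: eq_integral => x _.
have mFx : measurable_fun setT (fun s : n.+1.-tuple R => F [tuple of x :: s]).
  by apply: measurableT_comp => //; exact: measurable_cons.
rewrite (IH _ mFx (fun=> F0 _)).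
apply: eq_integral => s _; apply: eq_integral => y _; congr F.
exact: val_inj.
Qed.

Lemma integral_tuple_scale n (r : R) (F : n.-tuple R -> \bar R) : (0 < r)%R ->
  measurable_fun setT F -> (forall t, 0 <= F t) ->
  \int[lam n]_t F [tuple of map ( *%R r) t] = (r ^- n)%:E * \int[lam n]_t F t.
Proof.
move=> r0; elim: n F => [|n IH] F mF F0.
  rewrite expr0 invr1 mul1e; apply: eq_integral => t _; congr F.
  by apply: val_inj; rewrite /= !tuple0.
have mrs : measurable_fun setT (fun t : n.+1.-tuple R => [tuple of map ( *%R r) t]).
  exact: measurable_map_tuple.
have mrs' : measurable_fun setT (fun t : n.-tuple R => [tuple of map ( *%R r) t]).
  exact: measurable_map_tuple.
rewrite integral_tuple_cons//; last exact: measurableT_comp.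
rewrite [in RHS]integral_tuple_cons//.
have mFc : measurable_fun [set: measurableTypeR R * n.-tuple R]
  (fun p => F [tuple of (p.1 : R) :: p.2]) by exact: measurableT_comp mF (@mcons n).
pose G x := \int[lam n]_s F [tuple of x :: s].
have mG : measurable_fun [set: R] G.
  by apply: (@measurable_fun_fubini_tonelli_F _ _ _ _ _ (lam n) _ mFc) => p.
have G0 x : 0 <= G x by exact: integral_ge0.
transitivity (\int[leb]_x ((r ^- n)%:E * G (r * x + 0)%R)).
  apply: eq_integral => x _; rewrite /G addr0 -IH//.
    by apply: eq_integral => s _; congr F; exact: val_inj.
  apply: measurableT_comp => //; exact: measurable_cons.
have mGr : measurable_fun [set: measurableTypeR R] (fun x : R => G (r * x + 0)%R).
  by apply: (measurableT_comp mG); exact: measurable_affine.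
have rn0 : 0 <= (r ^- n)%:E by rewrite lee_fin invr_ge0 exprn_ge0// ltW.
rewrite (ge0_integralZl leb measurableT mGr (fun _ _ => G0 _) rn0).
rewrite (@integral_affine R r 0%R G (lt0r_neq0 r0) mG G0) muleA -EFinM gtr0_norm//.
by rewrite exprS invfM mulrC.
Qed.

End tuples.

(** * The triangle map on the simplex *)

Section inverse_branches.
Context {R : realType} {n : nat}.
Local Notation m := n.+1.
Implicit Types (t u : m.-tuple R) (p q : m.-tuple R * m.-tuple R) (N : R).

(** In homogeneous coordinates (1, t_1, ..., t_m) the inverse branches are
    (x_0 + x_m, x_0, ..., x_(m-1)) and (x_0 + x_m, x_1, ..., x_m). *)
Definition lambdaA t : m.-tuple R :=
  [tuple (if i == 0%N :> nat then 1 else t`_i.-1) / (1 + t`_n) | i < m].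

Definition lambdaB t : m.-tuple R := [tuple t`_i / (1 + t`_n) | i < m].

(** The two branches of the triangle map, each on the whole of its natural
    domain of definition, as needed to change variables. *)
Definition triA t : m.-tuple R :=
  [tuple (if (i < n)%N then t`_i.+1 else 1 - t`_0) / t`_0 | i < m].

Definition triB t : m.-tuple R := [tuple t`_i / (1 - t`_n) | i < m].

Lemma nth_tuple (F : 'I_m -> R) (i : nat) (im : (i < m)%N) :
  [tuple F j | j < m]`_i = F (Ordinal im).
Proof. by rewrite -(tnth_mktuple F) (tnth_nth 0). Qed.

Lemma eq_tuple t u : (forall i, (i < m)%N -> t`_i = u`_i) -> t = u.
Proof.
move=> tu; apply: eq_from_tnth => i.
by rewrite !(tnth_nth 0); apply: tu.
Qed.

Lemma lambdaAE t i : (i < m)%N ->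
  (lambdaA t)`_i = (if i == 0%N then 1 else t`_i.-1) / (1 + t`_n).
Proof. by move=> im; rewrite (nth_tuple _ im). Qed.

Lemma lambdaA0 t : (lambdaA t)`_0 = (1 + t`_n)^-1.
Proof. by rewrite nth_tuple/= mul1r. Qed.

Lemma lambdaAS t i : (i < n)%N -> (lambdaA t)`_i.+1 = t`_i / (1 + t`_n).
Proof. by move=> im; rewrite (nth_tuple _ (im : (i.+1 < m)%N)). Qed.

Lemma lambdaBE t i : (i < m)%N -> (lambdaB t)`_i = t`_i / (1 + t`_n).
Proof. by move=> im; rewrite (nth_tuple _ im). Qed.

Lemma simplex_decr t i j : simplex t -> (i < j < m)%N -> t`_j < t`_i.
Proof.
move=> [_ td _] /andP[]; elim: j => // j IH; rewrite ltnS leq_eqVlt.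
case/orP => [/eqP -> jm|ij jm]; first exact: td.
by apply: lt_trans (td _ jm) (IH ij _); exact: ltnW.
Qed.

Lemma simplex_ge_last t i : simplex t -> (i < m)%N -> t`_n <= t`_i.
Proof.
move=> st; rewrite ltnS leq_eqVlt => /orP[/eqP -> //|im].
by apply/ltW/simplex_decr => //; rewrite im/=.
Qed.

Lemma simplex_gt0 t i : simplex t -> (i < m)%N -> 0 < t`_i.
Proof. by move=> st im; have [_ _ tn] := st; exact: lt_le_trans tn (simplex_ge_last st im). Qed.

Lemma simplex_lt1 t i : simplex t -> (i < m)%N -> t`_i < 1.
Proof.
move=> st; case: i => [_|i im]; first by case: st.
by rewrite (lt_trans (@simplex_decr t 0 i.+1 st _))//; case: st.
Qed.

Lemma simplex_lambdaA t : simplex t -> simplex (lambdaA t).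
Proof.
move=> st; have tn : 0 < t`_n by exact: simplex_gt0.
have dn : 0 < 1 + t`_n by rewrite addr_gt0.
split=> [|i im|].
- by rewrite lambdaA0 invf_lt1 ?ltrDl.
- rewrite lambdaAS//; case: i im => [|i] im.
    rewrite lambdaA0 ltr_pdivrMr// mulVf ?gt_eqF//; exact: simplex_lt1.
  rewrite lambdaAS; last exact: ltnW.
  by rewrite ltr_pM2r ?invr_gt0//; apply: simplex_decr => //; rewrite ltnSn/= ltnW.
- rewrite /= lambdaAE// divr_gt0//; case: ifPn => // n0; apply: simplex_gt0 => //.
  by rewrite ltnS leq_pred.
Qed.

Lemma simplex_lambdaB t : simplex t -> simplex (lambdaB t).
Proof.
move=> st; have tn : 0 < t`_n by exact: simplex_gt0.
have dn : 0 < 1 + t`_n by rewrite addr_gt0.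
split=> [|i im|].
- rewrite lambdaBE// ltr_pdivrMr// mul1r (lt_trans (simplex_lt1 st _))//.
  by rewrite ltrDl.
- rewrite !lambdaBE//; last exact: ltnW.
  by rewrite ltr_pM2r ?invr_gt0//; case: st => _ + _; exact.
- by rewrite lambdaBE// divr_gt0.
Qed.

Lemma digit_lambdaA t : simplex t -> 1 < (lambdaA t)`_0 + (lambdaA t)`_n.
Proof.
move=> st; have tn : 0 < t`_n by exact: simplex_gt0.
have dn : 0 < 1 + t`_n by rewrite addr_gt0.
rewrite lambdaA0 lambdaAE// -[X in X + _]mul1r -mulrDl ltr_pdivlMr// mul1r ltrD2l.
case: ifPn => n0; first exact: simplex_lt1.
by apply: simplex_decr => //; rewrite ltn_predL lt0n n0/=.
Qed.

Lemma digit_lambdaB t : simplex t -> (lambdaB t)`_0 + (lambdaB t)`_n < 1.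
Proof.
move=> st; have tn : 0 < t`_n by exact: simplex_gt0.
have dn : 0 < 1 + t`_n by rewrite addr_gt0.
rewrite !lambdaBE// -mulrDl ltr_pdivrMr// mul1r ltrD2r.
exact: simplex_lt1.
Qed.

Lemma triAE t i : (i < m)%N ->
  (triA t)`_i = (if (i < n)%N then t`_i.+1 else 1 - t`_0) / t`_0.
Proof. by move=> im; rewrite (nth_tuple _ im). Qed.

Lemma triBE t i : (i < m)%N -> (triB t)`_i = t`_i / (1 - t`_n).
Proof. by move=> im; rewrite (nth_tuple _ im). Qed.

Lemma triangle_mapA t : 1 < t`_0 + t`_n -> triangle_map t = triA t.
Proof. by rewrite /triangle_map /= => ->. Qed.

Lemma triangle_mapB t : t`_0 + t`_n <= 1 -> triangle_map t = triB t.
Proof. by rewrite /triangle_map /= leNgt => /negbTE ->. Qed.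

Lemma triangle_map_A t i : 1 < t`_0 + t`_n -> (i < m)%N ->
  (triangle_map t)`_i = (if (i < n)%N then t`_i.+1 else 1 - t`_0) / t`_0.
Proof. by move=> dt im; rewrite triangle_mapA// triAE. Qed.

Lemma triangle_map_B t i : t`_0 + t`_n <= 1 -> (i < m)%N ->
  (triangle_map t)`_i = t`_i / (1 - t`_n).
Proof. by move=> dt im; rewrite triangle_mapB// triBE. Qed.

Lemma triangle_map_lambdaA t : simplex t -> triangle_map (lambdaA t) = t.
Proof.
move=> st; have tn : 0 < t`_n by exact: simplex_gt0.
have dn : 0 < 1 + t`_n by rewrite addr_gt0.
have dn0 : 1 + t`_n != 0 by rewrite gt_eqF.
apply: eq_tuple => i im; rewrite triangle_map_A ?digit_lambdaA// lambdaA0 invrK.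
case: ifPn => [ilt|]; first by rewrite lambdaAS// mulfVK.
rewrite -leqNgt => ni; have {ni im} -> : i = n by apply/eqP; rewrite eqn_leq ni -ltnS im.
by field.
Qed.

Lemma triangle_map_lambdaB t : simplex t -> triangle_map (lambdaB t) = t.
Proof.
move=> st; have tn : 0 < t`_n by exact: simplex_gt0.
have dn : 0 < 1 + t`_n by rewrite addr_gt0.
have dn0 : 1 + t`_n != 0 by rewrite gt_eqF.
apply: eq_tuple => i im; rewrite triangle_map_B ?(ltW (digit_lambdaB _))//.
rewrite !lambdaBE//; field.
by rewrite dn0/= addrK oner_eq0.
Qed.

Lemma triA_last t : t`_0 != 0 -> 1 + (triA t)`_n = (t`_0)^-1.
Proof. by move=> t0; rewrite triAE// ltnn; field. Qed.

Lemma triB_last t : 1 - t`_n != 0 -> 1 + (triB t)`_n = (1 - t`_n)^-1.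
Proof. by move=> tn1; rewrite triBE//; field. Qed.

Lemma lambdaA_triA t : t`_0 != 0 -> lambdaA (triA t) = t.
Proof.
move=> t0; apply: eq_tuple => -[|i] im; first by rewrite lambdaA0 triA_last// invrK.
rewrite lambdaAS// triA_last// invrK triAE; last exact: ltnW.
by rewrite (im : (i < n)%N) mulfVK.
Qed.

Lemma lambdaB_triB t : 1 - t`_n != 0 -> lambdaB (triB t) = t.
Proof.
move=> tn1; apply: eq_tuple => i im.
by rewrite lambdaBE// triB_last// invrK triBE// mulfVK.
Qed.

Lemma simplex_triangle_map t : simplex t -> 1 != t`_0 + t`_n ->
  simplex (triangle_map t).
Proof.
move=> st; rewrite neq_lt => /orP[dt|dt].
- have t0 : 0 < t`_0 by exact: simplex_gt0.
  have t1 : t`_0 < 1 by exact: simplex_lt1.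
  split=> [|i im|]; rewrite !triangle_map_A//.
  + rewrite ltr_pdivrMr// mul1r; case: ifPn => n0; first exact: simplex_decr.
    have tn : t`_n = t`_0 by congr nth; move: n0; rewrite lt0n negbK => /eqP.
    by move: dt; rewrite tn; lra.
  + rewrite ltr_pM2r ?invr_gt0// (im : (i < n)%N); case: ltnP => [iln|nle].
      by apply: simplex_decr => //; rewrite ltnSn.
    have -> : i.+1 = n by apply/eqP; rewrite eqn_leq nle andbT.
    by rewrite ltrBlDl.
  + exact: ltnW.
  + by rewrite ltnn divr_gt0// subr_gt0.
- have tn : 0 < t`_n by exact: simplex_gt0.
  have tn1 : 0 < 1 - t`_n by rewrite subr_gt0; exact: simplex_lt1.
  split=> [|i im|]; rewrite !triangle_map_B ?(ltW dt)//.
  + by rewrite ltr_pdivrMr// mul1r ltrBrDr.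
  + by rewrite ltr_pM2r ?invr_gt0//; case: st => _ + _; exact.
  + exact: ltnW.
  + by rewrite divr_gt0.
Qed.

End inverse_branches.

(** * The extended map and its inverse *)

Section extended_map.
Context {R : realType} {n : nat}.
Local Notation m := n.+1.
Implicit Types (t u : m.-tuple R) (p q : m.-tuple R * m.-tuple R).
Variable N : R.
Local Notation f := (@ext_triangle_map R m N).
Local Notation digitA t := (1 < t`_0 + t`_n).

Definition fibA t u : m.-tuple R :=
  [tuple t`_0 * (if (i < n)%N then u`_i.+1 else slack N (t, u)) | i < m].

Definition fibB t u : m.-tuple R :=
  [tuple (1 - t`_n) * (if (i < n)%N then u`_i else slack N (t, u) + u`_i) | i < m].

Definition extA p := (triA p.1, fibA p.1 p.2).

Definition extB p := (triB p.1, fibB p.1 p.2).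

(** The branch used to reach p: the images of the two branches are the two
    sides of the hyperplane slack = u_m. *)
Definition back_digit p : bool := p.2`_n < slack N p.

Definition invA p : m.-tuple R * m.-tuple R :=
  (lambdaA p.1, [tuple (1 + p.1`_n) *
     (if i == 0%N :> nat then slack N p - p.2`_n else p.2`_i.-1) | i < m]).

Definition invB p : m.-tuple R * m.-tuple R :=
  (lambdaB p.1, [tuple (1 + p.1`_n) *
     (if (i < n)%N then p.2`_i else p.2`_i - slack N p) | i < m]).

Definition ext_inverse p := if back_digit p then invA p else invB p.
Local Notation g := ext_inverse.

(** The dual homogeneous coordinates (slack, u_1, ..., u_m), on which both
    branches act, up to a positive factor, by nonnegative integer matrices that
    depend on the branch only. *)
Definition hcoord p (i : nat) : R := if i is j.+1 then p.2`_j else slack N p.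

Lemma extAE p i : (i < m)%N ->
  (extA p).2`_i = p.1`_0 * (if (i < n)%N then p.2`_i.+1 else slack N p).
Proof. by move=> im; rewrite (nth_tuple _ im)/= -surjective_pairing. Qed.

Lemma extBE p i : (i < m)%N ->
  (extB p).2`_i = (1 - p.1`_n) * (if (i < n)%N then p.2`_i else slack N p + p.2`_i).
Proof. by move=> im; rewrite (nth_tuple _ im)/= -surjective_pairing. Qed.

Lemma invAE p i : (i < m)%N ->
  (invA p).2`_i = (1 + p.1`_n) * (if i == 0%N then slack N p - p.2`_n else p.2`_i.-1).
Proof. by move=> im; rewrite (nth_tuple _ im). Qed.

Lemma invBE p i : (i < m)%N ->
  (invB p).2`_i = (1 + p.1`_n) * (if (i < n)%N then p.2`_i else p.2`_i - slack N p).
Proof. by move=> im; rewrite (nth_tuple _ im). Qed.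

Lemma ext_triangle_mapA p : digitA p.1 -> f p = extA p.
Proof.
move=> d; rewrite /ext_triangle_map /= d triangle_mapA//; congr pair.
Qed.

Lemma ext_triangle_mapB p : p.1`_0 + p.1`_n <= 1 -> f p = extB p.
Proof.
move=> d; rewrite /ext_triangle_map /= ltNge d triangle_mapB//; congr pair.
Qed.

Lemma slack_extA p : p.1`_0 != 0 ->
  slack N (extA p) = p.1`_0 * (p.2`_0 + slack N p).
Proof.
move=> t0; rewrite {1}/slack big_ord_recr.
rewrite (eq_bigr (fun i : 'I_n => p.1`_i.+1 * p.2`_i.+1)); last first.
  move=> i _; have im : (i < m)%N by rewrite ltnW// ltnS.
  by rewrite extAE//= triAE// ltn_ord; field.
rewrite extAE//= triAE// ltnn.
rewrite /slack (big_ord_recl n) /= (eq_bigr (fun i : 'I_n => p.1`_i.+1 * p.2`_i.+1))//.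
by field.
Qed.

Lemma slack_extB p : 1 - p.1`_n != 0 ->
  slack N (extB p) = (1 - p.1`_n) * slack N p.
Proof.
move=> t0; rewrite {1}/slack big_ord_recr.
rewrite (eq_bigr (fun i : 'I_n => p.1`_i * p.2`_i)); last first.
  move=> i _; have im : (i < m)%N by rewrite ltnW// ltnS.
  by rewrite extBE//= triBE// ltn_ord; field.
rewrite extBE//= triBE// ltnn.
by rewrite /slack (big_ord_recr n) /=; field.
Qed.

Lemma slack_invA p : 1 + p.1`_n != 0 -> slack N (invA p) = (1 + p.1`_n) * p.2`_n.
Proof.
move=> t0; rewrite {1}/slack big_ord_recl.
rewrite (eq_bigr (fun i : 'I_n => p.1`_i * p.2`_i)); last first.
  move=> i _; rewrite lift0 invAE//=; last exact: ltn_ord.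
  by rewrite lambdaAS//; field.
rewrite invAE//= lambdaA0.
by rewrite /slack (big_ord_recr n) /=; field.
Qed.

Lemma slack_invB p : 1 + p.1`_n != 0 ->
  slack N (invB p) = (1 + p.1`_n) * slack N p.
Proof.
move=> t0; rewrite {1}/slack big_ord_recr.
rewrite (eq_bigr (fun i : 'I_n => p.1`_i * p.2`_i)); last first.
  move=> i _; have im : (i < m)%N by rewrite ltnW// ltnS.
  by rewrite invBE//= lambdaBE// ltn_ord; field.
rewrite invBE//= lambdaBE// ltnn.
by rewrite /slack (big_ord_recr n) /=; field.
Qed.

Lemma extAK p : p.1`_0 != 0 -> invA (extA p) = p.
Proof.
move=> t0; rewrite [RHS]surjective_pairing; congr pair; first exact: lambdaA_triA.
apply: eq_tuple => i im; rewrite (invAE (extA p) im) triA_last//.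
case: i im => [|i] im /=.
  by rewrite slack_extA// extAE// ltnn; field.
rewrite extAE//; last exact: ltnW.
by rewrite (im : (i < n)%N); field.
Qed.

Lemma extBK p : 1 - p.1`_n != 0 -> invB (extB p) = p.
Proof.
move=> tn1; rewrite [RHS]surjective_pairing; congr pair; first exact: lambdaB_triB.
apply: eq_tuple => i im; rewrite (invBE (extB p) im) triB_last// slack_extB// extBE//.
by case: ltnP => _; field.
Qed.

Lemma ext_simplexP p : ext_simplex N p <->
  simplex p.1 /\ (forall i, (i <= m)%N -> 0 < hcoord p i).
Proof.
split=> [[st u0 s0]|[st h0]]; first by split=> // -[|i] im //=; exact: u0.
by split=> // [i im|]; [exact: (h0 i.+1)|exact: (h0 0%N)].
Qed.

Lemma hcoord_ext_triangle_map_A p i : simplex p.1 -> digitA p.1 -> (i <= m)%N ->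
  hcoord (f p) i = p.1`_0 *
    (if i == 0%N then hcoord p 0 + hcoord p 1 else if (i < m)%N then hcoord p i.+1 else hcoord p 0).
Proof.
move=> st d; have t0 : p.1`_0 != 0 by rewrite gt_eqF//; exact: simplex_gt0.
rewrite ext_triangle_mapA//.
case: i => [|i] im; first by rewrite {1}/hcoord slack_extA// addrC.
by rewrite [LHS]/hcoord extAE.
Qed.

Lemma hcoord_ext_triangle_map_B p i : simplex p.1 -> p.1`_0 + p.1`_n <= 1 -> (i <= m)%N ->
  hcoord (f p) i = (1 - p.1`_n) *
    (if (i < m)%N then hcoord p i else hcoord p 0 + hcoord p i).
Proof.
move=> st d; have t0 : 1 - p.1`_n != 0.
  by rewrite gt_eqF// subr_gt0; exact: simplex_lt1.
rewrite ext_triangle_mapB//.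
case: i => [|i] im; first by rewrite {1}/hcoord slack_extB.
by rewrite [LHS]/hcoord extBE.
Qed.

Lemma ext_simplex_triangle_map p : ext_simplex N p -> 1 != p.1`_0 + p.1`_n ->
  ext_simplex N (f p).
Proof.
move=> /ext_simplexP[st h0] d; apply/ext_simplexP; split.
  exact: simplex_triangle_map.
move=> i im; have [dA|dB] := ltP 1 (p.1`_0 + p.1`_n).
  rewrite hcoord_ext_triangle_map_A// mulr_gt0//; first exact: simplex_gt0.
  case: ifPn => [_|i0]; first by rewrite addr_gt0 ?h0.
  by case: ifPn => im'; rewrite h0.
rewrite hcoord_ext_triangle_map_B// mulr_gt0//.
  by rewrite subr_gt0; exact: simplex_lt1.
by case: ifPn => _; [exact: h0|apply: addr_gt0; exact: h0].
Qed.

Lemma ext_simplex_inverse p : ext_simplex N p -> slack N p != p.2`_n ->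
  ext_simplex N (g p).
Proof.
move=> [st u0 s0] d.
have tn : 0 < p.1`_n by exact: simplex_gt0.
have dn : 0 < 1 + p.1`_n by rewrite addr_gt0.
have dn0 : 1 + p.1`_n != 0 by rewrite gt_eqF.
rewrite /g; case: ifPn => dA; split=> [|i im|].
- exact: simplex_lambdaA.
- rewrite invAE// mulr_gt0//; case: ifPn => i0; first by rewrite subr_gt0.
  by apply: u0; rewrite (leq_ltn_trans (leq_pred _)).
- by rewrite slack_invA// mulr_gt0// u0.
- exact: simplex_lambdaB.
- rewrite invBE// mulr_gt0//; case: ifPn => i0; first exact: u0.
  have -> : i = n by apply/eqP; rewrite eqn_leq -ltnS im leqNgt.
  by rewrite subr_gt0 lt_neqAle d leNgt.
- by rewrite slack_invB// mulr_gt0.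
Qed.

Lemma back_digit_triangle_map p : ext_simplex N p ->
  back_digit (f p) = digitA p.1 /\ slack N (f p) != (f p).2`_n.
Proof.
move=> [st u0 s0].
have t0 : 0 < p.1`_0 by exact: simplex_gt0.
have tn1 : 0 < 1 - p.1`_n by rewrite subr_gt0; exact: simplex_lt1.
rewrite /back_digit; have [dA|dB] := ltP 1 (p.1`_0 + p.1`_n).
  have lt : (f p).2`_n < slack N (f p).
    rewrite ext_triangle_mapA// slack_extA ?gt_eqF// extAE// ltnn.
    by rewrite ltr_pM2l// ltrDr u0.
  by split; [exact: lt|rewrite gt_eqF].
have lt : slack N (f p) < (f p).2`_n.
  rewrite ext_triangle_mapB// slack_extB ?gt_eqF// extBE// ltnn.
  by rewrite ltr_pM2l// ltrDl u0.
by split; [apply/negbTE; rewrite -leNgt ltW|rewrite lt_eqF].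
Qed.

Lemma ext_triangle_mapK p : ext_simplex N p -> g (f p) = p.
Proof.
move=> xp; have [e _] := back_digit_triangle_map xp.
case: xp => st u0 s0.
have t0 : p.1`_0 != 0 by rewrite gt_eqF//; exact: simplex_gt0.
have tn1 : 1 - p.1`_n != 0 by rewrite gt_eqF// subr_gt0; exact: simplex_lt1.
rewrite /g e; case: ltP => d; first by rewrite ext_triangle_mapA// extAK.
by rewrite ext_triangle_mapB// extBK.
Qed.

Lemma ext_inverse_digit p : simplex p.1 ->
  1 != (g p).1`_0 + (g p).1`_n /\ digitA (g p).1 = back_digit p.
Proof.
move=> st; rewrite /g; case: ifPn => _ /=.
  by have h := digit_lambdaA st; rewrite lt_eqF.
have h := digit_lambdaB st; rewrite gt_eqF//; split=> //.
by apply/negbTE; rewrite -leNgt ltW.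
Qed.

Lemma ext_inverseK p : simplex p.1 -> f (g p) = p.
Proof.
move=> st; have [_ e] := ext_inverse_digit st.
have tn : 0 < p.1`_n by exact: simplex_gt0.
have dn0 : 1 + p.1`_n != 0 by rewrite gt_eqF// addr_gt0.
have [dA|dA] := boolP (back_digit p).
  rewrite ext_triangle_mapA ?e// /g dA [RHS]surjective_pairing; congr pair.
    by rewrite /= -triangle_mapA ?digit_lambdaA// triangle_map_lambdaA.
  apply: eq_tuple => i im; rewrite (extAE (invA p) im) /= lambdaA0.
  case: ltnP => [iln|ni]; first by rewrite invAE//=; field.
  rewrite slack_invA// (_ : i = n); first by field.
  by apply/eqP; rewrite eqn_leq ni -ltnS im.
rewrite ext_triangle_mapB; last by rewrite leNgt e.
rewrite /g (negbTE dA) [RHS]surjective_pairing; congr pair.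
  by rewrite /= -triangle_mapB ?(ltW (digit_lambdaB _))// triangle_map_lambdaB.
apply: eq_tuple => i im; rewrite (extBE (invB p) im) /= lambdaBE// slack_invB// invBE//.
by case: ltnP => iln; field.
Qed.

End extended_map.

(** * Jacobians of the branches *)

Section jacobian.
Local Open Scope ereal_scope.
Context {R : realType}.
Local Notation leb := (@lebesgue_measure R).
Local Notation lam := (lebesgue_tuple R).

Lemma measure_tupleE k (A : set (k.-tuple R)) : measurable A ->
  lam k A = \int[lam k]_t (\1_A t)%:E.
Proof. by move=> mA; rewrite integral_indic// setIT. Qed.

Lemma measurable_indicE d (T : measurableType d) (A : set T) : measurable A ->
  measurable_fun setT (fun t => (\1_A t : R)%:E).
Proof. by move=> mA; apply/measurable_EFinP; exact: measurable_indic. Qed.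

Lemma indic_preimageE (S T : Type) (h : S -> T) (X : set T) x :
  \1_(h @^-1` X) x = \1_X (h x) :> R.
Proof. by rewrite !indicE; congr (nat_of_bool _)%:R; apply/idP/idP; rewrite !inE. Qed.

Lemma nth_rcons_last k (s : k.-tuple R) (x : R) : ((rcons s x)`_k = x)%R.
Proof. by rewrite nth_rcons size_tuple ltnn eqxx. Qed.

Lemma measurable_nth k i : measurable_fun setT (fun t : k.-tuple R => (t`_i)%R).
Proof.
have [km|km] := ltnP i k.
  rewrite (_ : (fun t => _) = @tnth _ _ ^~ (Ordinal km)).
    exact: measurable_tnth.
  by apply/funext => t; rewrite (tnth_nth 0%R).
rewrite (_ : (fun t => _) = cst 0%R); first exact: measurable_cst.
by apply/funext => t; rewrite nth_default// size_tuple.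
Qed.

Lemma integral_tuple_rcons' k (F : k.+1.-tuple R -> \bar R) :
  measurable_fun setT F -> (forall t, 0 <= F t) ->
  \int[lam k.+1]_t F t = \int[leb]_x \int[lam k]_s F [tuple of rcons s x].
Proof.
move=> mF F0; rewrite integral_tuple_rcons//.
have mG : measurable_fun [set: k.-tuple R * measurableTypeR R]
      (fun p => F [tuple of rcons p.1 (p.2 : R)]).
  apply: measurableT_comp => //.
  have ms : measurable_fun [set: k.-tuple R * measurableTypeR R]
    (fun p => p.2 : R) by exact: measurable_snd.
  exact: measurable_rcons ms measurable_fst.
exact: (@fubini_tonelli _ _ _ _ _ (lam k) leb _ mG).
Qed.

Variable n : nat.
Local Notation m := n.+1.
Variable N : R.

Let msum (t : m.-tuple R) (j : nat) :
  measurable_fun setT (fun s : n.-tuple R => \sum_(i < n) t`_(j + i) * s`_i)%R.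
Proof. by apply: measurable_sum => i; apply: measurable_funM => //; exact: measurable_nth. Qed.

(* Both branches act on a fibre by scaling all coordinates of v by a, and the
   remaining coordinate by the square of a, up to sign, and a translation. *)
Let fiber_integral (a r : R) (c : n.-tuple R -> R) (F : m.-tuple R -> \bar R) :
  (0 < a)%R -> `|r|%R = (a ^+ 2)%R -> measurable_fun setT c ->
  measurable_fun setT F -> (forall t, 0 <= F t) ->
  \int[lam n]_v \int[leb]_b F [tuple of rcons (map ( *%R a) v) (r * b + c v)%R] =
  (a ^- n.+2)%:E * \int[lam m]_t F t.
Proof.
move=> a0 ra mc mF F0.
have r0 : r != 0%R by rewrite -normr_eq0 ra expf_neq0// gt_eqF.
pose G (v : n.-tuple R) := \int[leb]_b F [tuple of rcons v b].
have mG : measurable_fun setT G.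
  have mG' : measurable_fun [set: n.-tuple R * measurableTypeR R]
      (fun p => F [tuple of rcons p.1 (p.2 : R)]).
    apply: measurableT_comp => //.
    have ms : measurable_fun [set: n.-tuple R * measurableTypeR R]
      (fun p => p.2 : R) by exact: measurable_snd.
    exact: measurable_rcons ms measurable_fst.
  exact: (@measurable_fun_fubini_tonelli_F _ _ _ _ _ leb _ mG').
have G0 v : 0 <= G v by exact: integral_ge0.
transitivity (\int[lam n]_v ((a ^- 2)%:E * G [tuple of map ( *%R a) v])).
  apply: eq_integral => v _.
  rewrite (@integral_affine R r (c v) (fun b => F [tuple of rcons (map ( *%R a) v) b]))//.
    by rewrite ra.
  apply: measurableT_comp => //.
  exact: (@measurable_rcons R _ R n id (cst [tuple of map ( *%R a) v])).
rewrite ge0_integralZl//; last 2 first.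
- by apply: measurableT_comp => //; exact: measurable_map_tuple.
- by rewrite lee_fin invr_ge0 exprn_ge0// ltW.
rewrite integral_tuple_scale// muleA -EFinM [in RHS]integral_tuple_rcons//.
by rewrite -invfM -exprD.
Qed.

Lemma measurable_fibA (t : m.-tuple R) : measurable_fun setT (fibA N t).
Proof.
apply/measurable_fun_tnthP => i.
rewrite (_ : _ \o _ = fun u : m.-tuple R => t`_0 *
  (if (i < n)%N then u`_i.+1 else N - \sum_(j < m) t`_j * u`_j))%R; last first.
  by apply/funext => u; rewrite /= tnth_mktuple.
apply: measurable_funM => //; case: (i < n)%N; first exact: measurable_nth.
apply: measurable_funB => //; apply: measurable_sum => j.
by apply: measurable_funM => //; exact: measurable_nth.
Qed.

Lemma measurable_fibB (t : m.-tuple R) : measurable_fun setT (fibB N t).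
Proof.
apply/measurable_fun_tnthP => i.
rewrite (_ : _ \o _ = fun u : m.-tuple R => (1 - t`_n) *
  (if (i < n)%N then u`_i else (N - \sum_(j < m) t`_j * u`_j) + u`_i))%R; last first.
  by apply/funext => u; rewrite /= tnth_mktuple.
apply: measurable_funM => //; case: (i < n)%N; first exact: measurable_nth.
apply: measurable_funD => //; last exact: measurable_nth.
apply: measurable_funB => //; apply: measurable_sum => j.
by apply: measurable_funM => //; exact: measurable_nth.
Qed.

Lemma fibA_measure (t : m.-tuple R) (X : set (m.-tuple R)) : (0 < t`_0)%R -> measurable X ->
  lam m (fibA N t @^-1` X) = (t`_0 ^- n.+2)%:E * lam m X.
Proof.
move=> t0 mX.
have mpre : measurable (fibA N t @^-1` X).
  by rewrite -[X in measurable X]setTI; exact: measurable_fibA.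
rewrite !measure_tupleE// integral_tuple_cons'//; last exact: measurable_indicE.
pose c (v : n.-tuple R) := (t`_0 * (N - \sum_(i < n) t`_(1 + i) * v`_i))%R.
have mc : measurable_fun setT c.
  by apply: measurable_funM => //; apply: measurable_funB.
have ra : `|- t`_0 ^+ 2|%R = (t`_0 ^+ 2)%R by rewrite normrN ger0_norm// sqr_ge0.
rewrite -(fiber_integral t0 ra mc (measurable_indicE mX)); last by move=> v; rewrite lee_fin.
apply: eq_integral => v _; apply: eq_integral => b _.
rewrite indic_preimageE; congr ((\1_X _)%:E).
apply: eq_tuple => i im; rewrite (nth_tuple _ im) [in RHS]nth_rcons size_map [in RHS]size_tuple.
case: ltnP => [iln|ni]; first by rewrite (nth_map 0%R) ?size_tuple.
have -> : i = n by apply/eqP; rewrite eqn_leq ni -ltnS im.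
rewrite eqxx /slack big_ord_recl/= /c.
by rewrite /bump/=; under eq_bigr do rewrite add1n; ring.
Qed.

Lemma fibB_measure (t : m.-tuple R) (X : set (m.-tuple R)) : (0 < 1 - t`_n)%R -> measurable X ->
  lam m (fibB N t @^-1` X) = ((1 - t`_n) ^- n.+2)%:E * lam m X.
Proof.
move=> t0 mX.
have mpre : measurable (fibB N t @^-1` X).
  by rewrite -[X in measurable X]setTI; exact: measurable_fibB.
rewrite !measure_tupleE// integral_tuple_rcons//; last exact: measurable_indicE.
pose c (v : n.-tuple R) := ((1 - t`_n) * (N - \sum_(i < n) t`_(0 + i) * v`_i))%R.
have mc : measurable_fun setT c.
  by apply: measurable_funM => //; apply: measurable_funB.
have ra : `|(1 - t`_n) ^+ 2|%R = ((1 - t`_n) ^+ 2)%R by rewrite ger0_norm// sqr_ge0.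
rewrite -(fiber_integral t0 ra mc (measurable_indicE mX)); last by move=> v; rewrite lee_fin.
apply: eq_integral => v _; apply: eq_integral => b _.
rewrite indic_preimageE; congr ((\1_X _)%:E).
apply: eq_tuple => i im; rewrite (nth_tuple _ im) [in RHS]nth_rcons size_map [in RHS]size_tuple.
case: ltnP => [iln|ni].
  by rewrite (nth_map 0%R) ?size_tuple//= nth_rcons size_tuple iln.
have e : i = n by apply/eqP; rewrite eqn_leq ni -ltnS im.
subst i; rewrite eqxx /slack big_ord_recr/= /c nth_rcons size_tuple ltnn eqxx.
rewrite (eq_bigr (fun i : 'I_n => t`_(0 + i) * v`_i))%R; first by ring.
by move=> j _; rewrite nth_rcons size_tuple ltn_ord.
Qed.

Lemma measurable_inv_fun d (X : measurableType d) (h : X -> R) :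
  measurable_fun setT h -> measurable_fun setT (fun x => (h x)^-1)%R.
Proof. by move=> mh; apply: measurableT_comp => //; exact: measurable_invr. Qed.

Lemma measurable_triA : measurable_fun setT (@triA R n).
Proof.
apply/measurable_fun_tnthP => i.
rewrite (_ : _ \o _ = fun t : m.-tuple R =>
  ((if (i < n)%N then t`_i.+1 else 1 - t`_0) / t`_0)%R); last first.
  by apply/funext => u; rewrite /= tnth_mktuple.
apply: measurable_funM; last by apply: measurable_inv_fun; exact: measurable_nth.
case: (i < n)%N; first exact: measurable_nth.
by apply: measurable_funB => //; exact: measurable_nth.
Qed.

Lemma measurable_triB : measurable_fun setT (@triB R n).
Proof.
apply/measurable_fun_tnthP => i.
rewrite (_ : _ \o _ = fun t : m.-tuple R => (t`_i / (1 - t`_n))%R); last first.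
  by apply/funext => u; rewrite /= tnth_mktuple.
apply: measurable_funM; first exact: measurable_nth.
by apply: measurable_inv_fun; apply: measurable_funB => //; exact: measurable_nth.
Qed.

(* Scaling the n coordinates of s yields the power n of a, which leaves
   da / a^2 for the last coordinate. *)
Let base_integral (H : m.-tuple R -> \bar R) :
  measurable_fun setT H -> (forall t, 0 <= H t) ->
  \int[leb]_a (if (0 < a)%R then (a ^- n.+2)%:E *
     \int[lam n]_s H [tuple of rcons (map ( *%R a^-1) s) (a^-1 - 1)%R] else 0) =
  \int[lam m]_t (if (- 1 < t`_n)%R then H t else 0).
Proof.
move=> mH H0.
have mH' : measurable_fun setT (fun t : m.-tuple R => if (- 1 < t`_n)%R then H t else 0).
  apply: measurable_fun_ifT => //.
  by apply: measurable_fun_ltr => //; exact: measurable_nth.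
pose G (x : R) := \int[lam n]_s H [tuple of rcons s x].
have mG : measurable_fun [set: R] G.
  have mG' : measurable_fun [set: measurableTypeR R * n.-tuple R]
      (fun p => H [tuple of rcons p.2 (p.1 : R)]).
    apply: measurableT_comp => //.
    have ms : measurable_fun [set: measurableTypeR R * n.-tuple R]
      (fun p => p.1 : R) by exact: measurable_fst.
    exact: measurable_rcons ms measurable_snd.
  exact: (@measurable_fun_fubini_tonelli_F _ _ _ _ _ (lam n) _ mG').
have G0 v : 0 <= G v by exact: integral_ge0.
transitivity (\int[leb]_a (if (0 < a)%R then (a ^- 2)%:E * G (a^-1 - 1)%R else 0)).
  apply: eq_integral => a _; case: ifPn => // a0.
  rewrite (@integral_tuple_scale R n a^-1 (fun s => H [tuple of rcons s (a^-1 - 1)%R])).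
  - rewrite muleA -EFinM exprVn invrK; congr (_%:E * _).
    by rewrite -addn2 exprD invfM mulrAC mulVf ?mul1r// expf_neq0// gt_eqF.
  - by rewrite invr_gt0.
  - apply: measurableT_comp => //.
    exact: (@measurable_rcons R _ _ n (cst (a^-1 - 1)%R) id).
  - by move=> t.
rewrite integral_inv_sub1// integral_tuple_rcons'//; last by move=> t; case: ifP.
apply: eq_integral => x _; case: ifPn => x1; last first.
  apply/esym; apply: integral0_eq => s _.
  by rewrite nth_rcons_last (negbTE x1).
by apply: eq_integral => s _; rewrite nth_rcons_last x1.
Qed.

Lemma triA_integral (H : m.-tuple R -> \bar R) :
  measurable_fun setT H -> (forall t, 0 <= H t) ->
  \int[lam m]_t (if (0 < t`_0)%R then (t`_0 ^- n.+2)%:E * H (triA t) else 0) =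
  \int[lam m]_t (if (- 1 < t`_n)%R then H t else 0).
Proof.
move=> mH H0; rewrite -base_integral// integral_tuple_cons; last 2 first.
- apply: measurable_fun_ifT => //.
    by apply: measurable_fun_ltr => //; exact: measurable_nth.
  apply: emeasurable_funM; last by apply: measurableT_comp => //; exact: measurable_triA.
  apply/measurable_EFinP; apply: measurable_inv_fun; apply: measurable_funX.
  exact: measurable_nth.
- by move=> t; case: ifPn => // t0; rewrite mule_ge0// lee_fin invr_ge0 exprn_ge0// ltW.
apply: eq_integral => a _ /=; case: ifPn => a0; last exact: integral0.
rewrite -ge0_integralZl//; last 2 first.
- apply: measurableT_comp => //.
  apply: (@measurable_rcons R _ _ n (cst (a^-1 - 1)%R)) => //.
  exact: measurable_map_tuple.
- by rewrite lee_fin invr_ge0 exprn_ge0// ltW.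
apply: eq_integral => s _; congr (_ * H _).
apply: eq_tuple => i im; rewrite (nth_tuple _ im) [in RHS]nth_rcons size_map [in RHS]size_tuple.
case: ltnP => [iln|ni]; first by rewrite (nth_map 0%R) ?size_tuple//= mulrC.
have -> : i = n by apply/eqP; rewrite eqn_leq ni -ltnS im.
by rewrite eqxx/= mulrBl mul1r divff// gt_eqF.
Qed.

Lemma triB_integral (H : m.-tuple R -> \bar R) :
  measurable_fun setT H -> (forall t, 0 <= H t) ->
  \int[lam m]_t (if (0 < 1 - t`_n)%R then ((1 - t`_n) ^- n.+2)%:E * H (triB t) else 0) =
  \int[lam m]_t (if (- 1 < t`_n)%R then H t else 0).
Proof.
move=> mH H0; rewrite -base_integral// integral_tuple_rcons'; last 2 first.
- apply: measurable_fun_ifT => //.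
    apply: measurable_fun_ltr => //; apply: measurable_funB => //.
    exact: measurable_nth.
  apply: emeasurable_funM; last by apply: measurableT_comp => //; exact: measurable_triB.
  apply/measurable_EFinP; apply: measurable_inv_fun; apply: measurable_funX.
  by apply: measurable_funB => //; exact: measurable_nth.
- by move=> t; case: ifPn => // t0; rewrite mule_ge0// lee_fin invr_ge0 exprn_ge0// ltW.
pose Q (a : R) := if (0 < a)%R then (a ^- n.+2)%:E *
     \int[lam n]_s H [tuple of rcons (map ( *%R a^-1) s) (a^-1 - 1)%R] else 0.
have mQ : measurable_fun [set: R] Q.
  apply: measurable_fun_ifT => //; first exact: measurable_fun_ltr.
  apply: emeasurable_funM.
    by apply/measurable_EFinP; apply: measurable_inv_fun; exact: measurable_funX.
  have mG' : measurable_fun [set: measurableTypeR R * n.-tuple R]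
      (fun p => H [tuple of rcons (map ( *%R (p.1 : R)^-1) p.2) ((p.1 : R)^-1 - 1)%R]).
    apply: measurableT_comp => //.
    have ms : measurable_fun [set: measurableTypeR R * n.-tuple R]
      (fun p => (p.1 : R)^-1%R).
      by apply: measurable_inv_fun; exact: measurable_fst.
    apply: measurable_rcons; first exact: measurable_funB.
    by apply: measurable_map_tuple => //; exact: measurable_snd.
  exact: (@measurable_fun_fubini_tonelli_F _ _ _ _ _ (lam n) _ mG').
have Q0 a : 0 <= Q a.
  rewrite /Q; case: ifPn => // a0.
  by rewrite mule_ge0// ?lee_fin ?invr_ge0 ?exprn_ge0 ?integral_ge0// ltW.
have N10 : (- 1)%R != 0%R :> R by rewrite oppr_eq0 oner_eq0.
have := @integral_affine R (- 1)%R 1%R Q N10 mQ Q0.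
rewrite normrN normr1 invr1 mul1e => <-.
apply: eq_integral => x _; rewrite /Q mulN1r addrC.
case: ifPn => a0; last first.
  apply: integral0_eq => s _.
  by rewrite nth_rcons_last (negbTE a0).
rewrite -ge0_integralZl//; last 2 first.
- apply: measurableT_comp => //.
  apply: (@measurable_rcons R _ _ n (cst ((1 - x)^-1 - 1)%R)) => //.
  exact: measurable_map_tuple.
- by rewrite lee_fin invr_ge0 exprn_ge0// ltW.
apply: eq_integral => s _; rewrite nth_rcons_last a0; congr (_ * H _).
apply: eq_tuple => i im; rewrite (nth_tuple _ im) [in RHS]nth_rcons size_map [in RHS]size_tuple /= nth_rcons_last.
case: ltnP => [iln|ni].
  by rewrite (nth_map 0%R) ?size_tuple//= nth_rcons size_tuple iln mulrC.
have e : i = n by apply/eqP; rewrite eqn_leq ni -ltnS im.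
by subst i; rewrite nth_rcons_last eqxx/=; field; exact: lt0r_neq0.
Qed.

(** The Jacobian of the base is the inverse of that of the fibres, so that the
    branch preserves the product measure. The condition on G says that it lies
    over the image of the base map. *)
Lemma skew_product_measure (a : m.-tuple R -> R) (base : m.-tuple R -> m.-tuple R)
    (fib : m.-tuple R -> m.-tuple R -> m.-tuple R) (G : set (m.-tuple R * m.-tuple R)) :
  (forall t X, (0 < a t)%R -> measurable X ->
     lam m (fib t @^-1` X) = (a t ^- n.+2)%:E * lam m X) ->
  (forall H : m.-tuple R -> \bar R, measurable_fun setT H -> (forall t, 0 <= H t) ->
    \int[lam m]_t (if (0 < a t)%R then (a t ^- n.+2)%:E * H (base t) else 0) =
    \int[lam m]_t (if (- 1 < t`_n)%R then H t else 0)) ->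
  measurable G -> (forall p, G p -> - 1 < p.1`_n)%R ->
  (lam m \x lam m) [set p | (0 < a p.1)%R /\ G (base p.1, fib p.1 p.2)] =
  (lam m \x lam m) G.
Proof.
move=> hf hb mG Gn.
rewrite /product_measure1.
have mH : measurable_fun setT (fun t => lam m (xsection G t)).
  exact: measurable_fun_xsection.
transitivity (\int[lam m]_t (if (0 < a t)%R then
   (a t ^- n.+2)%:E * lam m (xsection G (base t)) else 0)).
  apply: eq_integral => t _ /=; case: ifPn => t0.
    rewrite -hf//; last exact: measurable_xsection.
    congr (lam m _); apply/seteqP; split => u; rewrite /xsection/= !inE/=.
      by case.
    by move=> Gu; split.
  rewrite (_ : xsection _ _ = set0) ?measure0//.
  by apply/seteqP; split => u //; rewrite /xsection/= inE/= (negbTE t0) => -[].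
rewrite (hb (fun t => lam m (xsection G t)))//.
apply: eq_integral => t _ /=; case: ifPn => // tn.
rewrite (_ : xsection _ _ = set0) ?measure0//.
apply/seteqP; split => u //; rewrite /xsection/= inE/= => /Gn/=.
by rewrite (negbTE tn).
Qed.

End jacobian.

(** * Invariance of the Lebesgue measure *)

(** Two pieces of A, one for each branch of a map, are carried onto two pieces
    that exhaust B up to the null set T. *)
Lemma eq_measure_split d (X : measurableType d) (R : realType)
    (mu : {measure set X -> \bar R}) (A1 A2 B1 B2 T A B : set X) :
  measurable A1 -> measurable A2 -> measurable B1 -> measurable B2 ->
  measurable T -> measurable B ->
  A1 `&` A2 = set0 -> B1 `&` B2 = set0 -> mu T = 0%E ->
  mu A1 = mu B1 -> mu A2 = mu B2 ->
  A = A1 `|` A2 -> B1 `|` B2 `<=` B -> B `<=` B1 `|` B2 `|` T ->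
  mu A = mu B.
Proof.
move=> mA1 mA2 mB1 mB2 mT mB A12 B12 T0 AB1 AB2 -> BB BT.
have -> : mu (A1 `|` A2) = (mu A1 + mu A2)%E by exact: measureU.
have e : mu (B1 `|` B2) = (mu B1 + mu B2)%E by exact: measureU.
rewrite AB1 AB2 -e.
have mB12 : measurable (B1 `|` B2) by exact: measurableU.
apply/eqP; rewrite eq_le le_measure ?inE//=.
rewrite -[leRHS]adde0 -T0; apply: le_trans (measureU2 _ mB12 mT).
by apply: le_measure; rewrite ?inE//; exact: measurableU.
Qed.

Section preservation.
Context {R : realType} {n : nat}.
Local Notation m := n.+1.
Variable N : R.
Local Notation f := (@ext_triangle_map R m N).
Local Notation g := (ext_inverse N).
Local Notation D := (@ext_triangle_domain R m N).
Local Notation lam := (lebesgue_tuple R).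
Local Notation mu := (ext_triangle_measure R m).
Implicit Types p q : m.-tuple R * m.-tuple R.

Lemma domain_simplex p : D p -> ext_simplex N p.
Proof. by case. Qed.

Lemma domain_nwall p : D p -> 1 != p.1`_0 + p.1`_n.
Proof. by case=> _ /(_ 0%N) h; apply/eqP. Qed.

Lemma domain_map p : D p -> D (f p).
Proof.
move=> Dp; split; first by apply: ext_simplex_triangle_map; [exact: domain_simplex|exact: domain_nwall].
by move=> k; rewrite -iterSr; case: Dp => _; exact.
Qed.

Lemma domain_inverse p : D p -> slack N p != p.2`_n -> D (g p).
Proof.
move=> Dp d; have [sp up s0] := domain_simplex Dp.
split; first exact: ext_simplex_inverse.
move=> [|k]; first by have [/eqP h _] := ext_inverse_digit N sp.
by rewrite iterSr ext_inverseK//; case: Dp => _; exact.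
Qed.

Lemma domain_mapK p : D p -> g (f p) = p.
Proof. by move=> /domain_simplex; exact: ext_triangle_mapK. Qed.

Lemma domain_inverseK p : D p -> f (g p) = p.
Proof. by move=> /domain_simplex[sp _ _]; exact: ext_inverseK. Qed.

Lemma measurable_slack : measurable_fun [set: m.-tuple R * m.-tuple R] (slack N).
Proof.
apply: measurable_funB => //; apply: measurable_sum => i; apply: measurable_funM.
  exact: (measurableT_comp (@measurable_nth R m i)).
exact: (measurableT_comp (@measurable_nth R m i)).
Qed.

Lemma measurable_snd_nth i :
  measurable_fun [set: m.-tuple R * m.-tuple R] (fun p => p.2`_i).
Proof. exact: (measurableT_comp (@measurable_nth R m i)). Qed.

Lemma measurable_fst_nth i :
  measurable_fun [set: m.-tuple R * m.-tuple R] (fun p => p.1`_i).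
Proof. exact: (measurableT_comp (@measurable_nth R m i)). Qed.

Lemma measurable_back_digit : measurable_fun [set: m.-tuple R * m.-tuple R] (back_digit N).
Proof. apply: measurable_fun_ltr; [exact: measurable_snd_nth|exact: measurable_slack]. Qed.

Lemma measurable_tie : measurable [set p : m.-tuple R * m.-tuple R | slack N p = p.2`_n].
Proof.
rewrite (_ : mkset _ = [set p : m.-tuple R * m.-tuple R | slack N p == p.2`_n]); last first.
  by apply/seteqP; split => p /eqP.
rewrite -[X in measurable X]setTI.
have : measurable_fun setT (fun p : m.-tuple R * m.-tuple R => slack N p == p.2`_n).
  apply: measurable_fun_eqr; [exact: measurable_slack|exact: measurable_snd_nth].
by move/(_ measurableT [set true]); exact.
Qed.

(** On a fibre, slack = u_m is an affine equation in which u_m has the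
    coefficient 1 + t_m, so it prescribes u_m once the other coordinates are
    given. *)
Lemma tie_fiber0 (t : m.-tuple R) : simplex t ->
  lam m [set u : m.-tuple R | slack N (t, u) = u`_n] = 0%E.
Proof.
move=> st; have tn : 0 < t`_n by exact: simplex_gt0.
have mX : measurable [set u : m.-tuple R | slack N (t, u) = u`_n].
  rewrite (_ : mkset _ = xsection [set p : m.-tuple R * m.-tuple R | slack N p = p.2`_n] t).
    by apply: measurable_xsection; exact: measurable_tie.
  by apply/seteqP; split => u; rewrite /xsection/= inE.
rewrite measure_tupleE// integral_tuple_rcons//; last exact: measurable_indicE.
apply: integral0_eq => s _.
pose x0 : R := (N - \sum_(i < n) t`_i * s`_i) / (1 + t`_n).
transitivity (\int[@lebesgue_measure R]_x (\1_[set x0] x)%:E)%E; last first.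
  by rewrite integral_indic// setIT; exact: lebesgue_measure_set1.
apply: eq_integral => x _; rewrite !indicE; congr (_%:R%:E); congr nat_of_bool.
have dn0 : 1 + t`_n != 0 by rewrite gt_eqF// addr_gt0.
have e : slack N (t, [tuple of rcons s x]) = N - \sum_(i < n) t`_i * s`_i - t`_n * x.
  rewrite /slack big_ord_recr/= nth_rcons_last opprD addrA; congr (_ - _ - _).
  by apply: eq_bigr => i _; rewrite nth_rcons size_tuple ltn_ord.
apply/idP/idP; rewrite !inE/= e nth_rcons_last /x0 => h.
  by rewrite -[X in X / _](subrK (t`_n * x)) h; field.
by rewrite h; field.
Qed.

Lemma tie_measure0 : mu (D `&` [set p : m.-tuple R * m.-tuple R | slack N p = p.2`_n]) = 0%E.
Proof.
rewrite /ext_triangle_measure /= /product_measure1.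
apply: integral0_eq => t _.
have mT : measurable (D `&` [set p : m.-tuple R * m.-tuple R | slack N p = p.2`_n]).
  by apply: measurableI; [exact: measurable_ext_triangle_domain|exact: measurable_tie].
have [st|nst] := pselect (simplex t).
  apply/eqP; rewrite -measure_le0 /= -(tie_fiber0 st) le_measure// ?inE.
  - exact: measurable_xsection.
  - rewrite (_ : mkset _ = xsection [set p : m.-tuple R * m.-tuple R | slack N p = p.2`_n] t).
      by apply: measurable_xsection; exact: measurable_tie.
    by apply/seteqP; split => u; rewrite /xsection/= inE.
  - by move=> u; rewrite /xsection/= inE => -[].
rewrite /= (_ : xsection _ _ = set0) ?measure0//.
by apply/seteqP; split => u //; rewrite /xsection/= inE => -[/domain_simplex[]].
Qed.

Lemma measurable_ext_preimage (A : set (m.-tuple R * m.-tuple R)) :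
  measurable A -> measurable (f @^-1` A).
Proof.
by move=> mA; rewrite -[X in measurable X]setTI; apply: measurable_ext_triangle_map.
Qed.

Lemma measurable_boolset d (X : measurableType d) (b : X -> bool) :
  measurable_fun setT b -> measurable [set x | b x].
Proof. by move=> mb; rewrite -[X in measurable X]setTI; exact: (mb measurableT [set true]). Qed.

(** The first branch maps its part of the domain bijectively onto the part of
    the domain where slack > u_m. *)
Lemma branchA_measure (A : set (m.-tuple R * m.-tuple R)) : measurable A ->
  mu (D `&` [set p : m.-tuple R * m.-tuple R | 1 < p.1`_0 + p.1`_n] `&` f @^-1` A) =
  mu (D `&` A `&` [set p : m.-tuple R * m.-tuple R | back_digit N p]).
Proof.
move=> mA; rewrite -[RHS]/((lam m \x lam m)%E _) -(@skew_product_measure _ _ (fun t => t`_0) (@triA R n) (fibA N)).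
- congr (mu _); apply/seteqP; split => p /=.
    move=> [[Dp d] Afp].
    have [sp _ _] := domain_simplex Dp.
    split; first exact: simplex_gt0.
    have -> : (triA p.1, fibA N p.1 p.2) = f p by rewrite ext_triangle_mapA.
    have [-> _] := back_digit_triangle_map (domain_simplex Dp).
    by split=> //; split => //; exact: domain_map.
  move=> [t0]; rewrite -/(extA N p) => -[[De Ae] be].
  have pE : p = g (extA N p) by rewrite /ext_inverse be extAK// gt_eqF.
  have Dp : D p.
    rewrite pE; apply: domain_inverse => //; by rewrite gt_eqF.
  have [sp _ _] := domain_simplex De.
  have d : 1 < p.1`_0 + p.1`_n.
    by have [_] := ext_inverse_digit N sp; rewrite be -pE.
  by split=> //; rewrite /preimage/= ext_triangle_mapA.
- by move=> t X t0 mX; exact: fibA_measure.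
- by move=> H mH H0; exact: triA_integral.
- apply: measurableI; first by apply: measurableI => //; exact: measurable_ext_triangle_domain.
  by apply: measurable_boolset; exact: measurable_back_digit.
- move=> p [[/domain_simplex[sp _ _] _] _].
  by apply: lt_trans (simplex_gt0 sp _) => //; rewrite oppr_lt0.
Qed.

Lemma branchB_measure (A : set (m.-tuple R * m.-tuple R)) : measurable A ->
  mu (D `&` [set p : m.-tuple R * m.-tuple R | p.1`_0 + p.1`_n <= 1] `&` f @^-1` A) =
  mu (D `&` A `&` [set p : m.-tuple R * m.-tuple R | slack N p < p.2`_n]).
Proof.
move=> mA; rewrite -[RHS]/((lam m \x lam m)%E _) -(@skew_product_measure _ _ (fun t => 1 - t`_n) (@triB R n) (fibB N)).
- congr (mu _); apply/seteqP; split => p /=.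
    move=> [[Dp d] Afp].
    have [sp _ _] := domain_simplex Dp.
    split; first by rewrite subr_gt0; exact: simplex_lt1.
    have -> : (triB p.1, fibB N p.1 p.2) = f p by rewrite ext_triangle_mapB.
    have [b e] := back_digit_triangle_map (domain_simplex Dp).
    split; first by split => //; exact: domain_map.
    have lt : slack N (f p) < (f p).2`_n.
      by rewrite lt_neqAle e leNgt -/(back_digit N (f p)) b -leNgt.
    by move: lt; rewrite [in _.2]ext_triangle_mapB.
  move=> [t0]; rewrite -/(extB N p) => -[[De Ae] be].
  have be' : back_digit N (extB N p) = false by apply/negbTE; rewrite -leNgt ltW.
  have pE : p = g (extB N p) by rewrite /ext_inverse be' extBK// gt_eqF.
  have Dp : D p.
    by rewrite pE; apply: domain_inverse => //; rewrite lt_eqF.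
  have [sp _ _] := domain_simplex De.
  have d : p.1`_0 + p.1`_n <= 1.
    by have [_] := ext_inverse_digit N sp; rewrite be' -pE leNgt => ->.
  by split=> //; rewrite /preimage/= ext_triangle_mapB.
- by move=> t X t0 mX; exact: fibB_measure.
- by move=> H mH H0; exact: triB_integral.
- apply: measurableI; first by apply: measurableI => //; exact: measurable_ext_triangle_domain.
  apply: measurable_boolset; apply: measurable_fun_ltr; [exact: measurable_slack|exact: measurable_snd_nth].
- move=> p [[/domain_simplex[sp _ _] _] _].
  by apply: lt_trans (simplex_gt0 sp _) => //; rewrite oppr_lt0.
Qed.

Lemma ext_triangle_measure_preserving : measure_preserving D mu D mu f.
Proof.
split; first by apply: measurable_funTS; exact: measurable_ext_triangle_map.
move=> A mA.
have mD : measurable D by exact: measurable_ext_triangle_domain.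
have mdA : measurable [set p : m.-tuple R * m.-tuple R | 1 < p.1`_0 + p.1`_n].
  apply: measurable_boolset; apply: measurable_fun_ltr => //.
  by apply: measurable_funD; exact: measurable_fst_nth.
have mdB : measurable [set p : m.-tuple R * m.-tuple R | p.1`_0 + p.1`_n <= 1].
  apply: measurable_boolset; apply: measurable_fun_ler => //.
  by apply: measurable_funD; exact: measurable_fst_nth.
pose SA := [set p : m.-tuple R * m.-tuple R | back_digit N p].
pose SB := [set p : m.-tuple R * m.-tuple R | slack N p < p.2`_n].
pose ST := [set p : m.-tuple R * m.-tuple R | slack N p = p.2`_n].
have mbA : measurable SA.
  by apply: measurable_boolset; exact: measurable_back_digit.
have mbB : measurable SB.
  apply: measurable_boolset; apply: measurable_fun_ltr; [exact: measurable_slack|exact: measurable_snd_nth].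
have mfA : measurable (f @^-1` A) by exact: measurable_ext_preimage.
have mT : measurable ST := measurable_tie.
apply: (@eq_measure_split _ _ _ mu
  (D `&` [set p : m.-tuple R * m.-tuple R | 1 < p.1`_0 + p.1`_n] `&` f @^-1` A)
  (D `&` [set p : m.-tuple R * m.-tuple R | p.1`_0 + p.1`_n <= 1] `&` f @^-1` A)
  (D `&` A `&` SA) (D `&` A `&` SB) (D `&` ST)).
- by apply: measurableI => //; exact: measurableI.
- by apply: measurableI => //; exact: measurableI.
- by apply: measurableI => //; exact: measurableI.
- by apply: measurableI => //; exact: measurableI.
- exact: measurableI.
- exact: measurableI.
- apply/seteqP; split => p //= -[[[_ dA] _] [[_ dB] _]].
  by move: dB; rewrite leNgt dA.
- apply/seteqP; split => p //= -[[_ dA] [_ dB]].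
  by have := lt_trans dA dB; rewrite ltxx.
- exact: tie_measure0.
- exact: branchA_measure.
- exact: branchB_measure.
- apply/seteqP; split => p /=; last by case=> -[[]].
  by move=> [Dp Ap]; have [d|d] := ltP 1 (p.1`_0 + p.1`_n); [left|right].
- by move=> p [[]|[]].
- move=> p [Dp Ap].
  by have [h|h|h] := ltgtP (slack N p) (p.2`_n); [left; right|left; left|right].
Qed.

End preservation.

(** * Almost sure occurrence of long runs *)

(** Up to the inequality sign, the recursion for V is that of the probability
    that a Markov chain avoids runs of L consecutive moves to lambdaA: from t the
    chain moves to lambdaA t with probability t_m / (1 + t_m) and to lambdaB t
    otherwise, and j counts the moves of the current run. When all the
    coordinates of t are bounded below, a run of L moves follows with a
    probability that is bounded below. From an arbitrary t, this situation is reached by making the coordinates large one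
    after the other: before the coordinates have shrunk by more than the factor
    3, a move to lambdaA occurs with probability at least 1/2, and it shifts the
    coordinates by one place, the new first one being large. Hence an upper bound
    of V can be multiplied by a constant less than 1, and V vanishes. *)
Section decay.
Context {R : realType} {n : nat}.
Local Notation m := n.+1.
Implicit Types (t : m.-tuple R) (s : R).
Variables (L : nat) (C : R) (V : nat -> m.-tuple R -> R).
Hypothesis V0 : forall j t, simplex t -> 0 <= V j t.
Hypothesis VC : forall t, simplex t -> V 0 t <= C.
Hypothesis VL : forall t, simplex t -> V L t = 0.
Hypothesis Vrec : forall j t, simplex t -> (j < L)%N ->
  V j t <= (V 0 (lambdaB t) + t`_n * V j.+1 (lambdaA t)) / (1 + t`_n).
Hypothesis Vle : forall j t, simplex t -> V j t <= V 0 t.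
Hypothesis L_gt0 : (0 < L)%N.

(* For i = 0 the coordinate in question is the homogeneous x_0 = 1. *)
Let large (i : nat) (rho : R) t := if i is j.+1 then 1 <= rho * t`_j else True.

(* The factor 1 - d may depend on the condition P but not on the bound s. *)
Let contracts (P : m.-tuple R -> Prop) j := exists2 d, 0 < d < 1 & forall s, 
  (forall t, simplex t -> V 0 t <= s) ->
  forall t, simplex t -> P t -> V j t <= (1 - d) * s.

Let bound_ge0 s : (forall t, simplex t -> V 0 t <= s) -> forall t, simplex t -> 0 <= s.
Proof. by move=> h t st; exact: le_trans (V0 0%N st) (h t st). Qed.

(* One move to lambdaA at most doubles rho, and has probability at least
   1 / (1 + rho). *)
Let contract_digits k rho : (k <= L)%N -> 0 < rho ->
  contracts (fun t => 1 <= rho * t`_n) (L - k).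
Proof.
elim: k rho => [|k IH] rho kL rho0.
  exists 2^-1; first by lra.
  by move=> s hs t st _; rewrite subn0 VL// mulr_ge0 ?(bound_ge0 hs st)//; lra.
have [d /andP[d0 d1] hd] := IH (2 * rho) (ltnW kL) ltac:(lra).
exists (d / (1 + rho)).
  rewrite divr_gt0//=; last by lra.
  by rewrite ltr_pdivrMr; lra.
move=> s hs t st tr.
have s0 := bound_ge0 hs st.
have tn : 0 < t`_n by exact: simplex_gt0.
have e : (L - k.+1).+1 = (L - k)%N by rewrite subnSK.
have LkL : (L - k.+1 < L)%N by rewrite ltn_subrL//= (leq_trans _ kL).
apply: le_trans (Vrec st LkL) _; rewrite e.
have hA : V (L - k) (lambdaA t) <= (1 - d) * s.
  apply: hd => //; first exact: simplex_lambdaA.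
  rewrite lambdaAE// mulrA ler_pdivlMr; last by lra.
  have : t`_n <= (if n == 0%N then 1 else t`_n.-1).
    case: ifPn => n0; first exact: ltW (simplex_lt1 st _).
    by apply/ltW/simplex_decr => //; rewrite ltn_predL lt0n n0/=.
  move: (if _ then _ else _) => x tx.
  have := simplex_lt1 st (ltnSn n).
  have : rho * t`_n <= rho * x by rewrite ler_pM2l.
  by lra.
have hB : V 0 (lambdaB t) <= s by apply: hs; exact: simplex_lambdaB.
have : V 0 (lambdaB t) + t`_n * V (L - k) (lambdaA t) <= s + t`_n * ((1 - d) * s).
  by apply: lerD => //; rewrite ler_pM2l.
move=> h; rewrite ler_pdivrMr; last by lra.
apply: (le_trans h).
have rhoD : 0 < 1 + rho by lra.
rewrite -subr_ge0.
have -> : (1 - d / (1 + rho)) * s * (1 + t`_n) - (s + t`_n * ((1 - d) * s)) =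
   d * s * ((rho * t`_n - 1) / (1 + rho)) by field; rewrite gt_eqF.
by rewrite !mulr_ge0// ?subr_ge0// ?invr_ge0; exact: ltW.
Qed.

(* The point t' is the k-th iterate of lambdaB, which is reached with probability
   1 / (1 + k t_m); the chain branches off to lambdaA before with the
   complementary probability, whence q. *)
Let steps (t : m.-tuple R) q k : simplex t -> 0 <= q ->
  (forall i t', (i < k)%N -> simplex t' ->
    (forall j, (j < m)%N -> t'`_j = t`_j / (1 + i%:R * t`_n)) -> V 0 (lambdaA t') <= q) ->
  exists t', [/\ simplex t', (forall j, (j < m)%N -> t'`_j = t`_j / (1 + k%:R * t`_n)) &
    V 0 t <= (V 0 t' + k%:R * t`_n * q) / (1 + k%:R * t`_n)].
Proof.
move=> st q0; have tn : 0 < t`_n by exact: simplex_gt0.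
elim: k => [|k IH] hq.
  by exists t; split => // [j _|]; rewrite mul0r ?mul0r addr0 ?addr0 divr1.
have [i t' ik|t' [st' et' Vt]] := IH _; first by apply: hq; exact: ltnW.
have D0 : 0 < 1 + k%:R * t`_n by rewrite ltr_pwDl// mulr_ge0// ltW.
have D1 : 0 < 1 + k.+1%:R * t`_n by rewrite ltr_pwDl// mulr_ge0// ltW.
have Dk : 1 + k%:R * t`_n + t`_n = 1 + k.+1%:R * t`_n by rewrite -natr1; ring.
exists (lambdaB t'); split; first exact: simplex_lambdaB.
  move=> j jm; rewrite lambdaBE// !et'// -Dk; field.
  by rewrite Dk !gt_eqF.
apply: le_trans Vt _; rewrite ler_pdivrMr//.
have h := Vrec st' L_gt0.
have hA : V 0 (lambdaA t') <= q by apply: (hq k).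
have t'n : 0 < t'`_n by exact: simplex_gt0.
have {}h : V 0 t' <= (V 0 (lambdaB t') + t'`_n * q) / (1 + t'`_n).
  apply: le_trans h _; rewrite ler_pM2r ?invr_gt0; last by lra.
  rewrite lerD2l ler_pM2l//; apply: le_trans (Vle _ _) hA; exact: simplex_lambdaA.
rewrite -subr_ge0 in h; rewrite -subr_ge0 -Dk.
move: h; rewrite et'// => h.
have -> : (V 0 (lambdaB t') + k.+1%:R * t`_n * q) / (1 + k%:R * t`_n + t`_n) *
    (1 + k%:R * t`_n) - (V 0 t' + k%:R * t`_n * q) =
  (V 0 (lambdaB t') + t`_n / (1 + k%:R * t`_n) * q) /
  (1 + t`_n / (1 + k%:R * t`_n)) - V 0 t'.
  by rewrite -natr1; field; rewrite Dk !gt_eqF.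
exact: h.
Qed.

(* With K about 1 / t_m moves, so that K t_m lies between 1 and 2, the chain
   branches off with probability at least 1/2. *)
Let contract_large d rho : (d <= m)%N -> 1 <= rho -> contracts (large (m - d) rho) 0.
Proof.
elim: d rho => [|d IH] rho dm rho1.
  rewrite subn0 -(subnn L); apply: contract_digits => //; lra.
have [e /andP[e0 e1] he] := IH (3 * rho) (ltnW dm) ltac:(lra).
exists (e / 2); first by lra.
move=> s hs t st tl; have s0 := bound_ge0 hs st.
have tn : 0 < t`_n by exact: simplex_gt0.
have tn1 : t`_n < 1 by exact: simplex_lt1.
pose K := (Num.truncn (t`_n)^-1).+1.
have tni : 0 <= (t`_n)^-1 by rewrite invr_ge0 ltW.
have K1 : 1 <= K%:R * t`_n.
  rewrite -ler_pdivrMr// mul1r ltW//; exact: truncnS_gt.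
have K2 : K%:R * t`_n <= 2.
  have : (Num.truncn (t`_n)^-1)%:R * t`_n <= 1.
    by rewrite -ler_pdivlMr// mul1r truncn_le.
  rewrite /K -natr1; lra.
have [||t' [st' et' Vt]] := @steps t ((1 - e) * s) K st.
- by rewrite mulr_ge0//; lra.
- move=> i t' iK st' et'; apply: he => //; first exact: simplex_lambdaA.
  have iK2 : i.+1%:R * t`_n <= 2.
    by apply: le_trans K2; rewrite ler_pM2r// ler_nat.
  have D0 : 0 < 1 + i%:R * t`_n by rewrite ltr_pwDl// mulr_ge0// ltW.
  have t'n1 := simplex_lt1 st' (ltnSn n).
  have t'n0 := simplex_gt0 st' (ltnSn n).
  rewrite -subnSK//=; case: (m - d.+1)%N (leq_subr d m) (subnSK dm) tl => [|j] _ ej tl.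
    rewrite lambdaA0 ler_pdivlMr; lra.
  have jm : (j < m)%N.
    by apply: (@leq_trans (m - d)); [rewrite -ej|exact: leq_subr].
  have jn : (j < n)%N by have : (j.+2 <= m)%N by rewrite ej leq_subr.
  rewrite lambdaAS// et'//.
  have -> : t`_j / (1 + i%:R * t`_n) / (1 + t'`_n) = t`_j / (1 + i.+1%:R * t`_n).
    rewrite et'// -natr1; field.
    by rewrite !gt_eqF//; move: D0; lra.
  rewrite mulrA ler_pdivlMr; last by rewrite -natr1; lra.
  by rewrite /large in tl; lra.
apply: le_trans Vt _.
have hV : V 0 t' <= s by exact: hs.
rewrite ler_pdivrMr; last by lra.
move: (K%:R * t`_n) K1 K2 => x x1 x2.
have : 0 <= e * s by rewrite mulr_ge0// ltW.
have : 0 <= (x - 1) * (e * s) by rewrite !mulr_ge0// ?subr_ge0// ltW.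
lra.
Qed.

Lemma decay t : simplex t -> V 0 t = 0.
Proof.
move=> st; have [d /andP[d0 d1] hd] := contract_large (leqnn m) (lexx 1).
pose S := [set V 0%N t | t in [set t | simplex t]].
have hub : has_ubound S by exists C => _ [u su <-]; exact: VC.
have hS u : simplex u -> V 0 u <= sup S.
  by move=> su; apply: ub_le_sup => //; exists u.
have h : sup S <= (1 - d) * sup S.
  apply: ge_sup; first by exists (V 0%N t), t.
  by move=> _ [u su <-]; apply: hd => //; rewrite subnn.
have := hS _ st; have := V0 0%N st; have : d * sup S <= 0 by lra.
rewrite pmulr_rle0// => *; lra.
Qed.

End decay.

Section box.
Local Open Scope ereal_scope.
Context {R : realType}.
Local Notation lam := (lebesgue_tuple R).

Definition box n (b : nat -> R) : set (n.-tuple R) :=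
  [set u | forall i, (i < n)%N -> (0 <= u`_i <= b i)%R].

Arguments box n b _ : clear implicits.

Lemma measurable_box n b : measurable (box n b).
Proof.
rewrite (_ : box n b = \bigcap_i [set u | (i < n)%N ==> (0 <= u`_i <= b i)%R]).
  apply: bigcapT_measurable => i; apply: measurable_boolset.
  case: (i < n)%N => /=; last exact: measurable_cst.
  by apply: measurable_and; apply: measurable_fun_ler => //; exact: measurable_nth.
by apply/seteqP; split => u h i; [move=> _; apply/implyP; exact: h|exact/implyP/h].
Qed.

Lemma lebesgue_box_le n b : (forall i, 0 <= b i)%R ->
  lam n (box n b) <= (\prod_(i < n) b i)%:E.
Proof.
elim: n b => [|n IH] b b0.
  by rewrite big_ord0 /= diracE lee_fin; case: (_ \in _).
have -> : (\prod_(i < n.+1) b i)%:E =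
  \int[@lebesgue_measure R]_x
   ((\1_(`[0%R, b 0%N]%classic : set R) x)%:E * (\prod_(i < n) b i.+1)%:E).
  rewrite ge0_integralZr//.
  - rewrite integral_indic// setIT /= lebesgue_measure_itv/= lte_fin big_ord_recl EFinM.
    rewrite oppr0 adde0; case: ifPn => // b00.
    have -> : b 0%N = 0%R by apply/eqP; rewrite eq_le b0 leNgt b00.
    by [].
  - by apply: measurable_indicE; exact: measurable_itv.
  - by rewrite lee_fin prodr_ge0.
rewrite measure_tupleE; last exact: measurable_box.
rewrite integral_tuple_cons//; last by apply: measurable_indicE; exact: measurable_box.
apply: ge0_le_integral => //.
- by move=> x _; exact: integral_ge0.
- have mG' : measurable_fun [set: measurableTypeR R * n.-tuple R]
      (fun p => (\1_(box n.+1 b) [tuple of (p.1 : R) :: p.2] : R)%:E).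
    apply: (@measurableT_comp _ _ _ _ _ _ (fun t : n.+1.-tuple R => (\1_(box n.+1 b) t : R)%:E) _
      (@cons_pair R n)); last exact: measurable_cons_pair.
    by apply: measurable_indicE; exact: measurable_box.
  exact: (@measurable_fun_fubini_tonelli_F _ _ _ _ _ (lam n) _ mG').
- by apply: emeasurable_funM => //; apply: measurable_indicE; exact: measurable_itv.
move=> x _; rewrite [in leRHS]indicE.
have E : forall s : n.-tuple R, box n.+1 b [tuple of x :: s] <->
    (0 <= x <= b 0%N)%R /\ box n (fun i => b i.+1) s.
  move=> s; split=> [h|[x0 h] [|i] //= im]; last exact: h.
  by split=> [|i im]; [exact: (h 0%N)|exact: (h i.+1)].
rewrite (_ : (x \in _) = (0 <= x <= b 0%N)%R); last first.
  by apply/idP/idP; rewrite inE/= in_itv.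
have [x0|x0] := boolP (0 <= x <= b 0%N)%R.
  rewrite mul1e; apply: le_trans (IH _ (fun i => b0 i.+1)).
  rewrite measure_tupleE; last exact: measurable_box.
  rewrite le_eqVlt; apply/orP; left; apply/eqP.
  apply: eq_integral => s _; rewrite !indicE; congr (_%:R%:E); congr nat_of_bool.
  by apply/idP/idP; rewrite !inE => h; [case/E: h|apply/E].
rewrite mul0e integral0_eq// => s _; rewrite indicE memNset// => /E[xx _].
by rewrite xx in x0.
Qed.
End box.

Section recurrence.
Context {R : realType} {n : nat}.
Local Notation m := n.+1.
Variables (N : R) (L : nat).
Hypothesis N_gt0 : 0 < N.
Hypothesis L_gt0 : (0 < L)%N.
Local Notation g := (@ext_inverse R n N).
Local Notation lam := (lebesgue_tuple R).
Local Notation mu := (ext_triangle_measure R m).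
Implicit Types (t u : m.-tuple R) (p : m.-tuple R * m.-tuple R).

Definition run k p : bool := all (fun i => back_digit N (iter i g p)) (iota 0 k).

(** The extra condition for j > 0 amounts to saying that p remains without a
    run if j more digits, all of the first kind, are put in front. *)
Definition no_run j : set (m.-tuple R * m.-tuple R) :=
  [set p | [/\ ext_simplex N p, forall k, ~~ run L (iter k g p) & ~~ run (L - j) p]].

Lemma measurable_lambdaA : measurable_fun setT (@lambdaA R n).
Proof.
apply/measurable_fun_tnthP => i.
rewrite (_ : _ \o _ = fun t : m.-tuple R =>
  (if i == 0%N :> nat then 1 else t`_i.-1) / (1 + t`_n)); last first.
  by apply/funext => u; rewrite /= tnth_mktuple.
apply: measurable_funM.
  by case: (i == 0%N :> nat); [exact: measurable_cst|exact: measurable_nth].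
by apply: measurable_inv_fun; apply: measurable_funD => //; exact: measurable_nth.
Qed.

Lemma measurable_lambdaB : measurable_fun setT (@lambdaB R n).
Proof.
apply/measurable_fun_tnthP => i.
rewrite (_ : _ \o _ = fun t : m.-tuple R => t`_i / (1 + t`_n)); last first.
  by apply/funext => u; rewrite /= tnth_mktuple.
apply: measurable_funM; first exact: measurable_nth.
by apply: measurable_inv_fun; apply: measurable_funD => //; exact: measurable_nth.
Qed.

Lemma measurable_ext_inverse : measurable_fun setT g.
Proof.
have md : measurable_fun setT (fun p : m.-tuple R * m.-tuple R => 1 + p.1`_n).
  by apply: measurable_funD => //; exact: measurable_fst_nth.
apply: measurable_fun_ifT; first exact: measurable_back_digit.
- apply: measurable_fun_pair; first exact: measurableT_comp measurable_lambdaA measurable_fst.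
  apply/measurable_fun_tnthP => i.
  rewrite (_ : _ \o _ = fun p : m.-tuple R * m.-tuple R => (1 + p.1`_n) *
    (if i == 0%N :> nat then slack N p - p.2`_n else p.2`_i.-1)); last first.
    by apply/funext => u; rewrite /= tnth_mktuple.
  apply: measurable_funM => //; case: (i == 0%N :> nat); last exact: measurable_snd_nth.
  by apply: measurable_funB; [exact: measurable_slack|exact: measurable_snd_nth].
- apply: measurable_fun_pair; first exact: measurableT_comp measurable_lambdaB measurable_fst.
  apply/measurable_fun_tnthP => i.
  rewrite (_ : _ \o _ = fun p : m.-tuple R * m.-tuple R => (1 + p.1`_n) *
    (if (i < n)%N then p.2`_i else p.2`_i - slack N p)); last first.
    by apply/funext => u; rewrite /= tnth_mktuple.
  apply: measurable_funM => //; case: (i < n)%N; first exact: measurable_snd_nth.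
  by apply: measurable_funB; [exact: measurable_snd_nth|exact: measurable_slack].
Qed.

Lemma measurable_iterT d (X : measurableType d) (h : X -> X) k :
  measurable_fun setT h -> measurable_fun setT (iter k h).
Proof.
move=> mh; elim: k => [|k IH]; first exact: measurable_id.
exact: measurableT_comp.
Qed.

Lemma measurable_run k : measurable_fun setT (run k).
Proof.
rewrite /run; elim: k 0%N => [|k IH] i /=; first exact: measurable_cst.
apply: measurable_and => //.
apply: measurableT_comp; first exact: measurable_back_digit.
by apply: measurable_iterT; exact: measurable_ext_inverse.
Qed.

Lemma measurable_ext_simplex : measurable (@ext_simplex R m N).
Proof.
rewrite (_ : ext_simplex N = (fst @^-1` @simplex R m) `&`
   \bigcap_i [set p : m.-tuple R * m.-tuple R | (i < m)%N ==> (0 < p.2`_i)] `&`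
   [set p : m.-tuple R * m.-tuple R | 0 < slack N p]).
  apply: measurableI; last first.
    by apply: measurable_boolset; apply: measurable_fun_ltr => //; exact: measurable_slack.
  apply: measurableI.
    rewrite -[X in measurable X]setTI; apply: measurable_fst => //.
    exact: measurable_simplex.
  apply: bigcapT_measurable => i; apply: measurable_boolset.
  case: (i < m)%N => /=; last exact: measurable_cst.
  by apply: measurable_fun_ltr => //; exact: measurable_snd_nth.
apply/seteqP; split => p.
  by case=> sp up s0; split => //; split => // i _ /=; apply/implyP; exact: up.
by case=> -[sp up] s0; split => // i; apply/implyP; exact: up.
Qed.

Lemma measurable_no_run j : measurable (no_run j).
Proof.
have mN k : measurable_fun setT (fun p => ~~ run k p).
  by apply: measurable_neg; exact: measurable_run.
rewrite (_ : no_run j = ext_simplex N `&` \bigcap_k [set p | ~~ run L (iter k g p)] `&`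
   [set p | ~~ run (L - j) p]).
  apply: measurableI; last exact: measurable_boolset.
  apply: measurableI; first exact: measurable_ext_simplex.
  apply: bigcapT_measurable => k; apply: measurable_boolset.
  apply: (measurableT_comp (mN L)).
  by apply: measurable_iterT; exact: measurable_ext_inverse.
apply/seteqP; split => p.
  by case=> sp rp r0; split => //; split => // i _ /=; exact: rp.
by case=> -[sp rp] r0; split => // i; exact: rp.
Qed.

Lemma runS k p : run k.+1 p = back_digit N p && run k (g p).
Proof.
rewrite /run /=; congr (_ && _); rewrite (iotaDl 1 0 k) all_map.
by apply: eq_all => i; rewrite /= -iterS iterSr.
Qed.

Lemma no_run_stepA j p : (j < L)%N -> no_run j p -> back_digit N p -> no_run j.+1 (g p).
Proof.
move=> jL [sp rp r0] b; split.
- by apply: ext_simplex_inverse => //; rewrite gt_eqF.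
- by move=> k; rewrite -iterSr; exact: rp.
- by move: r0; rewrite -subnSK// runS b.
Qed.

Lemma no_run_stepB j p : no_run j p -> slack N p < p.2`_n -> no_run 0 (g p).
Proof.
move=> [sp rp r0] b; split.
- by apply: ext_simplex_inverse => //; rewrite lt_eqF.
- by move=> k; rewrite -iterSr; exact: rp.
- by rewrite subn0; exact: (rp 1%N).
Qed.

Let w j t := lam m (xsection (no_run j) t).

Let vol t : R := \prod_(i < m) t`_i.

Let mw j t : measurable (xsection (no_run j) t).
Proof. by apply: measurable_xsection; exact: measurable_no_run. Qed.

Let vol_gt0 t : simplex t -> 0 < vol t.
Proof. by move=> st; apply: prodr_gt0 => i _; exact: simplex_gt0. Qed.

Let w_le j t : simplex t -> (w j t <= (N ^+ m / vol t)%:E)%E.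
Proof.
move=> st.
pose b i := if (i < m)%N then N / t`_i else 0.
have b0 i : 0 <= b i.
  by rewrite /b; case: ifPn => // im; rewrite divr_ge0 ?ltW//; exact: simplex_gt0.
have -> : N ^+ m / vol t = \prod_(i < m) b i.
  rewrite (eq_bigr (fun i : 'I_m => N / t`_i)); last by move=> i _; rewrite /b ltn_ord.
  by rewrite prodf_div prodr_const card_ord.
apply: le_trans (lebesgue_box_le m b0).
apply: le_measure; rewrite ?inE//; first exact: measurable_box.
move=> u; rewrite /xsection/= inE => -[[_ up s0] _ _] i im /=.
have ui : 0 < u`_i by exact: up.
rewrite (ltW ui)/= /b im ler_pdivlMr; last exact: simplex_gt0.
move: s0; rewrite /slack subr_gt0 => /ltW; apply: le_trans.
rewrite (bigD1 (Ordinal im))//= mulrC lerDl sumr_ge0// => k _.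
by rewrite mulr_ge0// ltW//; [exact: simplex_gt0|exact: up].
Qed.

Let w_fin j t : simplex t -> w j t \is a fin_num.
Proof. by move=> st; rewrite ge0_fin_numE ?measure_ge0// (le_lt_trans (w_le j st))// ltry. Qed.

(* The fibre over t is a simplex of volume proportional to the inverse of the
   product of the t_i, by which one has to normalize to get probabilities. *)
Let V j t := vol t * fine (w j t).

(* The fibre over t is cut by the hyperplane slack = u_m into the images of the
   fibres over lambdaA t and lambdaB t. *)
Let w_rec j t : simplex t -> (j < L)%N ->
  (w j t <= ((1 + t`_n) ^- n.+2)%:E * w j.+1 (lambdaA t) +
            ((1 + t`_n) ^- n.+2)%:E * w 0%N (lambdaB t))%E.
Proof.
move=> st jL.
have tn : 0 < t`_n by exact: simplex_gt0.
have dn : 0 < 1 + t`_n by rewrite addr_gt0.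
pose SA := [set u : m.-tuple R | back_digit N (t, u)].
pose SB := [set u : m.-tuple R | slack N (t, u) < (t, u).2`_n].
pose ST := [set u : m.-tuple R | slack N (t, u) = u`_n].
have msl : measurable_fun setT (fun u : m.-tuple R => slack N (t, u)).
  apply: (measurableT_comp (measurable_slack N)).
  by apply: measurable_fun_pair; [exact: measurable_cst|exact: measurable_id].
have mSA : measurable SA.
  by apply: measurable_boolset; apply: measurable_fun_ltr => //; exact: measurable_nth.
have mSB : measurable SB.
  by apply: measurable_boolset; apply: measurable_fun_ltr => //; exact: measurable_nth.
have mST : measurable ST.
  rewrite (_ : ST = [set u : m.-tuple R | slack N (t, u) == u`_n]); last first.
    by apply/seteqP; split => u /eqP.
  by apply: measurable_boolset; apply: measurable_fun_eqr => //; exact: measurable_nth.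
have mXA : measurable (xsection (no_run j) t `&` SA) by exact: measurableI.
have mXB : measurable (xsection (no_run j) t `&` SB) by exact: measurableI.
have hA : (lam m (xsection (no_run j) t `&` SA) <=
    ((1 + t`_n) ^- n.+2)%:E * w j.+1 (lambdaA t))%E.
  have a0 : 0 < (lambdaA t)`_0 by rewrite lambdaA0 invr_gt0.
  have := fibA_measure N a0 mXA; rewrite lambdaA0 exprVn invrK => e.
  have -> : lam m (xsection (no_run j) t `&` SA) = (((1 + t`_n) ^- n.+2)%:E *
      lam m (fibA N (lambdaA t) @^-1` (xsection (no_run j) t `&` SA)))%E.
    by rewrite e muleA -EFinM mulVf ?mul1e// expf_neq0// gt_eqF.
  rewrite lee_pmul2l//; last by rewrite lte_fin invr_gt0 exprn_gt0.
  apply: le_measure; rewrite ?inE//.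
    by rewrite -[X in measurable X]setTI; exact: measurable_fibA.
  move=> u [+ bu]; rewrite /xsection/= !inE => zu.
  have tE : t = triA (lambdaA t) by rewrite -triangle_mapA ?triangle_map_lambdaA ?digit_lambdaA.
  have pE : (t, fibA N (lambdaA t) u) = extA N (lambdaA t, u) by rewrite /extA/= -tE.
  have := no_run_stepA jL zu bu.
  by rewrite /ext_inverse [in X in if X then _ else _]bu pE extAK//= gt_eqF.
have hB : (lam m (xsection (no_run j) t `&` SB) <=
    ((1 + t`_n) ^- n.+2)%:E * w 0 (lambdaB t))%E.
  have a0 : 0 < 1 - (lambdaB t)`_n by rewrite subr_gt0; apply: simplex_lt1 => //; exact: simplex_lambdaB.
  have aE : 1 - (lambdaB t)`_n = (1 + t`_n)^-1.
    by rewrite lambdaBE//; field; rewrite gt_eqF.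
  have := fibB_measure N a0 mXB; rewrite aE exprVn invrK => e.
  have -> : lam m (xsection (no_run j) t `&` SB) = (((1 + t`_n) ^- n.+2)%:E *
      lam m (fibB N (lambdaB t) @^-1` (xsection (no_run j) t `&` SB)))%E.
    by rewrite e muleA -EFinM mulVf ?mul1e// expf_neq0// gt_eqF.
  rewrite lee_pmul2l//; last by rewrite lte_fin invr_gt0 exprn_gt0.
  apply: le_measure; rewrite ?inE//.
    by rewrite -[X in measurable X]setTI; exact: measurable_fibB.
  move=> u [+ bu]; rewrite /xsection/= !inE => zu.
  have tE : t = triB (lambdaB t).
    by rewrite -triangle_mapB ?triangle_map_lambdaB// ltW// digit_lambdaB.
  have pE : (t, fibB N (lambdaB t) u) = extB N (lambdaB t, u) by rewrite /extB/= -tE.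
  have bu' : back_digit N (t, fibB N (lambdaB t) u) = false.
    by apply/negbTE; rewrite -leNgt ltW.
  have := no_run_stepB zu bu.
  by rewrite /ext_inverse bu' pE extBK//= gt_eqF.
suff hw : (w j t <= lam m (xsection (no_run j) t `&` SA) +
                    lam m (xsection (no_run j) t `&` SB))%E.
  exact: le_trans hw (leeD hA hB).
rewrite -[leRHS]adde0 -(tie_fiber0 N st).
have hU : (w j t <= lam m ((xsection (no_run j) t `&` SA) `|`
                       (xsection (no_run j) t `&` SB) `|` ST))%E.
  apply: le_measure; rewrite ?inE//; first by apply: measurableU => //; exact: measurableU.
  move=> u zu.
  by have [h|h|h] := ltgtP (slack N (t, u)) (u`_n); [left; right|left; left|right].
apply: le_trans hU _.
apply: le_trans (measureU2 _ _ mST) _; first exact: measurableU.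
by rewrite leeD2r//; exact: measureU2.
Qed.

Let V_rec j t : simplex t -> (j < L)%N ->
  V j t <= (V 0 (lambdaB t) + t`_n * V j.+1 (lambdaA t)) / (1 + t`_n).
Proof.
move=> st jL.
have sA := simplex_lambdaA st; have sB := simplex_lambdaB st.
have tn : 0 < t`_n by exact: simplex_gt0.
have dn : 0 < 1 + t`_n by rewrite addr_gt0.
have := w_rec st jL; have := w_fin j st; have := w_fin j.+1 sA; have := w_fin 0 sB.
rewrite /V.
move: (w j t) (w j.+1 (lambdaA t)) (w 0 (lambdaB t)) => x' y' z' fz fy fx h'.
have {h'} : fine x' <= (1 + t`_n) ^- n.+2 * fine y' + (1 + t`_n) ^- n.+2 * fine z'.
  by rewrite -lee_fin EFinD !EFinM !fineK.
move: (fine x') (fine y') (fine z') => x y z h.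
have vA : t`_n * vol (lambdaA t) = vol t / (1 + t`_n) ^+ m.
  rewrite /vol [in LHS]big_ord_recl lambdaA0.
  rewrite (eq_bigr (fun i : 'I_n => t`_i / (1 + t`_n))); last first.
    by move=> i _; rewrite lambdaAS.
  rewrite prodf_div prodr_const card_ord [in RHS]big_ord_recr/= exprS; field.
  by rewrite !gt_eqF// exprn_gt0.
have vB : vol (lambdaB t) = vol t / (1 + t`_n) ^+ m.
  rewrite /vol (eq_bigr (fun i : 'I_m => t`_i / (1 + t`_n))); last first.
    by move=> i _; rewrite lambdaBE.
  by rewrite prodf_div prodr_const card_ord.
rewrite mulrA vA vB.
have v0 := vol_gt0 st.
apply: (@le_trans _ _ (vol t * ((1 + t`_n) ^- n.+2 * y + (1 + t`_n) ^- n.+2 * z))).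
  by rewrite ler_pM2l.
move: (vol t) (1 + t`_n) dn => v d d0.
rewrite le_eqVlt; apply/orP; left; apply/eqP.
have -> : d ^+ n.+2 = d ^+ m * d by rewrite exprSr.
by field; rewrite !gt_eqF// exprn_gt0.
Qed.

Let w0 t : simplex t -> w 0 t = 0%E.
Proof.
move=> st; have V0 j t' : simplex t' -> 0 <= V j t'.
  by move=> st'; rewrite mulr_ge0 ?fine_ge0 ?measure_ge0//; exact/ltW/vol_gt0.
have := @decay R n L (N ^+ m) V V0 _ _ V_rec _ L_gt0 t st.
rewrite /V => /(_ _ _ _)/eqP; rewrite mulf_eq0 gt_eqF ?vol_gt0//=.
move=> h; have {}h : fine (w 0 t) = 0.
  apply/eqP/h.
  - move=> t' st'; rewrite -ler_pdivlMl ?vol_gt0// -lee_fin fineK ?w_fin//.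
    by rewrite mulrC; exact: w_le.
  - move=> t' st'; rewrite /w (_ : xsection _ _ = set0) ?measure0 ?mulr0//.
    by apply/seteqP; split => u //; rewrite /xsection/= inE => -[_ _]; rewrite subnn.
  - move=> j t' st'; rewrite ler_pM2l ?vol_gt0// fine_le ?w_fin//.
    apply: le_measure; rewrite ?inE//.
    move=> u; rewrite /xsection/= !inE => -[sp rp _]; split => //.
    by rewrite subn0; exact: (rp 0%N).
by rewrite -(fineK (w_fin 0 st)) h.
Qed.

Lemma no_run_null : mu (no_run 0) = 0%E.
Proof.
rewrite /ext_triangle_measure /= /product_measure1.
apply: integral0_eq => t _ /=.
have [st|nst] := pselect (simplex t); first exact: w0.
rewrite (_ : xsection _ _ = set0) ?measure0//.
by apply/seteqP; split => u //; rewrite /xsection/= inE => -[[]].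
Qed.

End recurrence.

(** * Invertible cores of one-to-one maps *)

Section negligible_facts.
Context {R : realType} d (X : measurableType d).
Variable mu : {measure set X -> \bar R}.

Lemma eq_measure_negligible (A B : set X) : measurable A -> measurable B ->
  mu.-negligible (A `\` B) -> mu.-negligible (B `\` A) -> mu A = mu B.
Proof.
have H (C E : set X) : measurable C -> measurable E ->
    mu.-negligible (C `\` E) -> (mu C <= mu E)%E.
  move=> mC mE [T [mT T0 CET]]; rewrite -[leRHS]adde0 -T0.
  apply: le_trans (measureU2 _ mE mT).
  apply: le_measure; rewrite ?inE//; first exact: measurableU.
  by move=> x Cx; have [Ex|nEx] := pselect (E x); [left|right; exact: CET].
by move=> mA mB AB BA; apply/eqP; rewrite eq_le !H.
Qed.

Lemma negligible_preimage (D : set X) (f : X -> X) (T : set X) :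
  measurable D -> measure_preserving D mu D mu f -> mu.-negligible T ->
  mu.-negligible (D `&` f @^-1` T).
Proof.
move=> mD [mf ff] [T' [mT' T'0 TT']].
exists (D `&` f @^-1` T'); split; first exact: mf.
  rewrite ff//; apply/eqP; rewrite -measure_le0 -T'0 le_measure ?inE//.
  exact: measurableI.
by move=> x [Dx /TT'].
Qed.

End negligible_facts.

Definition two_sided d (R : realType) (X : measurableType d) (D : set X)
    (mu : {measure set X -> \bar R}) (f : X -> X) (K : set X) (h : X -> X) :=
  [/\ one_to_one_on D mu f K, measurable_fun setT h,
      (forall x, K x -> K (h x)), (forall x, K x -> f (h x) = x) &
      (forall x, K x -> h (f x) = x)].

Section two_sided_core.
Context {R : realType} d (X : measurableType d).
Variables (D : set X) (mu : {measure set X -> \bar R}) (f : X -> X).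
Hypothesis mD : measurable D.
Hypothesis ff : measure_preserving D mu D mu f.

(** The preimages of a null set under the iterates are null, so its points and
    all those that ever enter it can be removed. *)
Lemma one_to_one_on_avoid (X0 T : set X) : one_to_one_on D mu f X0 ->
  mu.-negligible T -> exists2 X1, one_to_one_on D mu f X1 & X1 `<=` X0 `\` T.
Proof.
move=> [[mX0 X0D D0] fX0 fI fM] [T' [mT' T'0 TT']].
have fst x : X0 x -> X0 (f x) by move=> ?; apply: fX0; exists x.
pose E k := X0 `&` iter k f @^-1` T'.
have mf := ff.1.
have mE k : measurable (E k).
  elim: k => [|k IH]; first exact: measurableI.
  rewrite (_ : E k.+1 = X0 `&` (D `&` f @^-1` E k)).
    by apply: measurableI => //; exact: mf.
  apply/seteqP; split => x; rewrite /E /preimage/= -iterSr.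
    by move=> [x0 h]; split=> //; split; [exact: X0D|split => //; exact: fst].
  by move=> [x0 [_ [_ h]]].
have E0 k : mu.-negligible (E k).
  elim: k => [|k IH]; first by exists T'; split => // x [].
  apply: negligibleS (negligible_preimage mD ff IH) => x [x0].
  rewrite /preimage/= -iterS iterSr => h.
  by split; [exact: X0D|split => //; exact: fst].
exists (X0 `\` \bigcup_k E k); last first.
  by move=> x [x0 h]; split => // /TT' Tx; apply: h; exists 0%N.
have mU : measurable (\bigcup_k E k) by exact: bigcup_measurable.
have mX1 : measurable (X0 `\` \bigcup_k E k) by exact: measurableD.
split; [split=> // | | |].
- by move=> x [/X0D].
- apply: measure_negligible; first exact: measurableD.
  apply: negligibleS (negligibleU (_ : mu.-negligible (D `\` X0)) (negligible_bigcup E0)).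
    move=> x [Dx h]; have [x0|nx0] := pselect (X0 x); last by left.
    by right; apply: contrapT => nE; apply: h.
  by apply/negligibleP => //; exact: measurableD.
- move=> _ [x [x0 h] <-]; split; first exact: fst.
  by move=> [k _ [_ e]]; apply: h; exists k.+1 => //; split=> //; rewrite /preimage/= -iterS iterSr.
- by move=> x y; rewrite !inE => -[x0 _] [y0 _]; apply: fI; rewrite inE.
- by move=> A mA AX; apply: fM => // x /AX[].
Qed.

(** The intersection of the images of X0 under the iterates. Each image has full
    measure because the preimage of its complement avoids the previous one, and
    the inverse is measurable because f maps measurable sets to measurable
    sets. *)
Lemma one_to_one_two_sided (X0 : set X) : one_to_one_on D mu f X0 ->
  exists K h, two_sided D mu f K h /\ K `<=` X0.
Proof.
move=> [[mX0 X0D D0] fX0 fI fM].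
have fst x : X0 x -> X0 (f x) by move=> ?; apply: fX0; exists x.
have mf := ff.1.
pose im k := iter k (fun A => f @` A) X0.
have imX k : im k `<=` X0.
  by elim: k => [//|k IH] _ [x /IH/fst] + <-.
have mim k : measurable (im k).
  by elim: k => [//|k IH]; apply: fM => //; exact: imX.
have imS k : im k.+1 `<=` im k.
  elim: k => [|k IH]; first exact: fX0.
  by move=> _ [x /IH xk <-]; exists x.
have im0 k : mu.-negligible (D `\` im k).
  elim: k => [|k IH]; first by apply/negligibleP => //; exact: measurableD.
  have mDk : measurable (D `\` im k.+1) by exact: measurableD.
  suff e : mu (D `\` im k.+1) = 0%E by apply/negligibleP.
  have -> : mu (D `\` im k.+1) = mu (D `&` (D `\` im k.+1)).
    by rewrite setIidr// => x [].
  rewrite -ff.2//; apply: measure_negligible; first exact: mf.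
  apply: negligibleS IH => x [Dx [Dfx nfx]]; split=> // xk.
  by apply: nfx; exists x.
pose K := \bigcap_k im k.
have mK : measurable K by exact: bigcapT_measurable.
have KX : K `<=` X0 by move=> x /(_ 0%N I).
have Kf x : K x -> K (f x).
  move=> Kx [|k] _; first by apply: fst; exact: KX.
  by exists x => //; exact: Kx.
have Kinv x : K x -> exists y, K y /\ f y = x.
  move=> Kx; have [y y0 yx] := Kx 1%N I; exists y; split=> // k _.
  have [z zk zx] := Kx k.+1 I.
  suff -> : y = z by [].
  by apply: fI; rewrite ?inE ?yx ?zx//; exact: imX zk.
have /choice[h hP] : forall x, exists y, (K x -> K y /\ f y = x) /\ (~ K x -> y = x).
  move=> x; have [Kx|nKx] := pselect (K x); last by exists x.
  by have [y yP] := Kinv x Kx; exists y.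
have hK x : K x -> K (h x) by move=> /(hP x).1[].
have fh x : K x -> f (h x) = x by move=> /(hP x).1[].
have hf x : K x -> h (f x) = x.
  move=> Kx; apply: fI; rewrite ?inE; [by apply/KX/hK/Kf|exact: KX|].
  by rewrite fh//; exact: Kf.
have mimK A : measurable A -> A `<=` K -> measurable (f @` A).
  by move=> mA AK; apply: fM => // x /AK/KX.
exists K, h; split=> //; split=> //; first split=> //.
- split=> //; first by move=> x /KX/X0D.
  apply: measure_negligible; first exact: measurableD.
  apply: negligibleS (negligible_bigcup im0) => x [Dx nKx].
  apply: contrapT => nU; apply: nKx => k _.
  by apply: contrapT => nk; apply: nU; exists k.
- by move=> _ [x Kx <-]; exact: Kf.
- by move=> x y; rewrite !inE => Kx Ky; apply: fI; rewrite inE; exact: KX.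
- move=> _ A mA; rewrite setTI.
  rewrite (_ : h @^-1` A = f @` (A `&` K) `|` (A `\` K)).
    apply: measurableU; last exact: measurableD.
    by apply: mimK => [|x []//]; exact: measurableI.
  apply/seteqP; split => x.
    have [Kx|nKx] := pselect (K x); rewrite /preimage/= => Ahx.
      by left; exists (h x); [split=> //; exact: hK|exact: fh].
    by right; split=> //; rewrite -((hP x).2 nKx).
  by move=> [[y [Ay Ky] <-]|[Ax nKx]]; rewrite /preimage/= ?hf// (hP x).2.
Qed.

Section inverse.
Variables (K : set X) (h : X -> X).
Hypothesis Kh : two_sided D mu f K h.

Lemma two_sided_iterK k x : K x -> K (iter k h x).
Proof. by case: Kh => _ _ hK _ _ Kx; elim: k => //= k IH; exact: hK. Qed.

Lemma two_sided_iter k j x : K x -> iter j f (iter (j + k) h x) = iter k h x.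
Proof.
case: Kh => _ _ hK fh _ Kx; elim: j => // j IH.
by rewrite iterSr addSn iterS fh//; exact: two_sided_iterK.
Qed.

Lemma two_sided_measurable : measurable K.
Proof. by case: Kh => -[[]]. Qed.

Lemma two_sided_sub : K `<=` D.
Proof. by case: Kh => -[[]]. Qed.

Lemma two_sided_negligible : mu.-negligible (D `\` K).
Proof.
apply/negligibleP; first by apply: measurableD => //; exact: two_sided_measurable.
by case: Kh => -[[]].
Qed.

Lemma two_sided_inverse_measure A : measurable A ->
  mu (K `&` h @^-1` A) = mu (K `&` A).
Proof.
move=> mA; have mK := two_sided_measurable; have [[_ fK _ _] mh hK fh hf] := Kh.
have mW : measurable (K `&` h @^-1` A).
  by apply: measurableI => //; rewrite -[X in measurable X]setTI; exact: mh.
have -> : mu (K `&` h @^-1` A) = mu (D `&` (K `&` h @^-1` A)).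
  by rewrite (setIidr (subset_trans _ two_sided_sub))// => x [].
rewrite -ff.2//; apply: eq_measure_negligible => //.
- exact: ff.1.
- exact: measurableI.
- apply: negligibleS two_sided_negligible => x [[Dx [Kfx hfx]] nKA]; split => // Kx.
  by apply: nKA; split => //; move: hfx; rewrite /preimage/= hf.
- apply: (negligibleS _ (negligible_set0 mu)) => x [[Kx Ax] h0]; case: h0; split.
    exact: two_sided_sub.
  by split; [apply: fK; exists x|rewrite /preimage/= hf].
Qed.

Lemma two_sided_iter_measure k A : measurable A ->
  mu (K `&` iter k h @^-1` A) = mu (K `&` A).
Proof.
have [_ mh hK _ _] := Kh.
elim: k A => // k IH A mA.
have mhA : measurable (h @^-1` A) by rewrite -[X in measurable X]setTI; exact: mh.
by rewrite -[RHS]two_sided_inverse_measure// -[RHS]IH.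
Qed.

End inverse.
End two_sided_core.

(** * The law of the past *)

Section past.
Context d (Y : measurableType d).

Definition cylinder k (B : nat -> set Y) : set (nat -> Y) :=
  [set s | forall i, (i < k)%N -> B i (s i)].

Definition cylinders : set (set (nat -> Y)) :=
  [set C | exists k B, (forall i, measurable (B i)) /\ C = cylinder k B].

Definition pasts := g_sigma_algebraType cylinders.
HB.instance Definition _ := Measurable.on pasts.

Lemma measurable_cylinder k B : (forall i, measurable (B i)) ->
  measurable (cylinder k B : set pasts).
Proof. by move=> mB; apply: sub_sigma_algebra; exists k, B. Qed.

Lemma measurable_pasts d' (X : measurableType d') (q : X -> pasts) :
  (forall i, measurable_fun setT (q ^~ i)) -> measurable_fun setT q.
Proof.
move=> mq; apply: (@measurability _ _ _ pasts setT q cylinders) => // _ [_ [k [B [mB ->]]] <-].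
rewrite setTI (_ : _ @^-1` _ = \bigcap_i [set x | (i < k)%N -> B i (q x i)]); last first.
  by apply/seteqP; split => x h i; [move=> _; exact: h|exact: h].
apply: bigcapT_measurable => i; case: (i < k)%N; last first.
  by rewrite (_ : mkset _ = setT) ?measurableT//; apply/seteqP; split.
rewrite (_ : mkset _ = q ^~ i @^-1` B i).
  by rewrite -[X in measurable X]setTI; exact: mq.
by apply/seteqP; split => x /=; [move=> /(_ isT)|move=> + _].
Qed.

Lemma measurable_coord i : measurable_fun setT (fun s : pasts => s i : Y).
Proof.
move=> _ B mB; rewrite setTI.
rewrite (_ : _ @^-1` _ = cylinder i.+1 (fun j => if j == i then B else setT)).
  by apply: measurable_cylinder => j; case: ifP.
apply/seteqP; split => s.
  by move=> Bs j; case: eqP => [->|].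
by move/(_ i (ltnSn i)); rewrite eqxx.
Qed.

(** The past of f x in terms of the past of x. *)
Definition shift_past (S : Y -> Y) (s : pasts) : pasts :=
  fun k => if k is j.+1 then s j else S (s 0%N).

Lemma measurable_shift_past (S : Y -> Y) : measurable_fun setT S ->
  measurable_fun setT (shift_past S).
Proof.
move=> mS; apply: measurable_pasts => -[|i].
  exact: measurableT_comp mS (measurable_coord 0).
exact: measurable_coord.
Qed.

Definition past d' (X : measurableType d') (psi : X -> Y) (h : X -> X) (x : X) : pasts :=
  fun k => psi (iter k h x).

Lemma measurable_past d' (X : measurableType d') (psi : X -> Y) (h : X -> X) :
  measurable_fun setT psi -> measurable_fun setT h -> measurable_fun setT (past psi h).
Proof.
move=> mpsi mh; apply: measurable_pasts => i; apply: measurableT_comp => //.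
elim: i => [|i IH]; first exact: measurable_id.
exact: measurableT_comp.
Qed.

End past.

Section past_law.
Context {R : realType} d' (Y : measurableType d').
Variables (E : set Y) (nu : {measure set Y -> \bar R}) (S : Y -> Y).
Hypothesis mE : measurable E.
Hypothesis mS : measurable_fun setT S.

(** A covering in which, after removal of null sets, no exceptional points are
    left. *)
Definition strict_covering d (X : measurableType d) (D : set X)
    (mu : {measure set X -> \bar R}) (f : X -> X) (psi : X -> Y)
    (K : set X) (h : X -> X) :=
  [/\ two_sided D mu f K h, measurable_fun setT psi,
      forall x, K x -> psi (f x) = S (psi x) &
      forall Q, measurable Q -> mu (K `&` psi @^-1` Q) = nu (E `&` Q)].

Lemma covers_strict d (X : measurableType d) (D : set X)
    (mu : {measure set X -> \bar R}) (f : X -> X) (psi : X -> Y) :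
  measurable D -> one_to_one D mu f -> covers D mu f E nu S psi ->
  exists K h psi', strict_covering D mu f psi' K h /\ forall x, K x -> psi' x = psi x.
Proof.
move=> mD [X0 X0P] [ff fpsi _ eqpsi].
have [X1 X1P X1X] := one_to_one_on_avoid mD ff X0P eqpsi.
have [K [h [Kh KX1]]] := one_to_one_two_sided mD ff X1P.
have mK := two_sided_measurable Kh.
have KD := two_sided_sub Kh.
pose psi' x := if x \in K then psi x else point.
have psiE x : K x -> psi' x = psi x by move=> Kx; rewrite /psi' mem_set.
have Kf x : K x -> K (f x).
  by case: Kh => -[_ fK _ _] _ _ _ _ Kx; apply: fK; exists x.
exists K, h, psi'; split=> //; split=> //.
- move=> _ B mB; rewrite setTI.
  rewrite (_ : psi' @^-1` B = (K `&` (D `&` psi @^-1` B)) `|`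
                              (~` K `&` [set x | B point])).
    apply: measurableU; first by apply: measurableI => //; exact: fpsi.1.
    apply: measurableI; first exact: measurableC.
    have [Bp|nBp] := pselect (B point).
      by rewrite (_ : mkset _ = setT) ?measurableT//; apply/seteqP; split.
    by rewrite (_ : mkset _ = set0) ?measurable0//; apply/seteqP; split.
  apply/seteqP; split => x; rewrite /preimage/=.
    have [Kx|nKx] := pselect (K x); first by rewrite psiE// => Bx; left; split => //; split => //; exact: KD.
    by rewrite /psi' memNset// => Bp; right.
  by case=> [[Kx [_ Bx]]|[nKx Bp]]; [rewrite psiE|rewrite /psi' memNset].
- move=> x Kx; rewrite !psiE//; last exact: Kf.
  have [_ h0] := X1X x (KX1 x Kx); apply: contrapT => h1; apply: h0 => h2.
  by apply: h1; apply: h2; exact: KD.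
- move=> Q mQ.
  have mDQ : measurable (D `&` psi @^-1` Q) by exact: fpsi.1.
  rewrite -fpsi.2//; apply: eq_measure_negligible => //.
  + rewrite (_ : K `&` psi' @^-1` Q = K `&` (D `&` psi @^-1` Q)); first exact: measurableI.
    apply/seteqP; split => x [Kx]; rewrite /preimage/= psiE//; last by case.
    by move=> Qx; split => //; split=> //; exact: KD.
  + apply: (negligibleS _ (negligible_set0 mu)) => x [[Kx]].
    by rewrite /preimage/= psiE// => Qx; case; split=> //; exact: KD.
  + apply: negligibleS (two_sided_negligible mD Kh) => x [[Dx Qx] nK]; split=> // Kx.
    by apply: nK; split=> //; rewrite /preimage/= psiE.
Qed.

Section cylinder_law.
Context d (X : measurableType d) (D : set X) (mu : {measure set X -> \bar R})
  (f : X -> X) (psi : X -> Y) (K : set X) (h : X -> X).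
Hypothesis mD : measurable D.
Hypothesis ff : measure_preserving D mu D mu f.
Hypothesis cov : strict_covering D mu f psi K h.

(** Going back by k steps, which preserves the measure, turns the condition on
    the last k terms of the past into a condition on a single point of Y. *)
Lemma past_cylinder k B : (forall i, measurable (B i)) ->
  mu (K `&` past psi h @^-1` cylinder k B) =
  nu (E `&` [set y | forall i, (i < k)%N -> B i (iter (k - i) S y)]).
Proof.
move=> mB; have [Kh mpsi eqpsi law] := cov.
set Q := [set y | _].
have miter j : measurable_fun setT (iter j S).
  elim: j => [|j IH]; first exact: measurable_id.
  exact: measurableT_comp.
have mQ : measurable Q.
  rewrite (_ : Q = \bigcap_i (if (i < k)%N then iter (k - i) S @^-1` B i else setT)).
    apply: bigcapT_measurable => i; case: ifP => // _.
    by rewrite -[X in measurable X]setTI; exact: miter.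
  apply/seteqP; split => y Qy i; first by move=> _; case: ifPn => // ik; exact: Qy.
  by move=> ik; have := Qy i I; rewrite ik.
have mpQ : measurable (psi @^-1` Q).
  by rewrite -[X in measurable X]setTI; exact: mpsi.
rewrite -law// -(two_sided_iter_measure mD ff Kh k mpQ).
have Kf x : K x -> K (f x).
  by case: Kh => -[_ fK _ _] _ _ _ _ Kx; apply: fK; exists x.
have psij j z : K z -> psi (iter j f z) = iter j S (psi z).
  move=> Kz; elim: j => //= j <-; apply: eqpsi.
  by elim: j => //= j; exact: Kf.
have e x i : K x -> (i < k)%N ->
    iter (k - i) S (psi (iter k h x)) = psi (iter i h x).
  move=> Kx ik; rewrite -psij; last exact: two_sided_iterK Kh _ _ _.
  by rewrite -{2}(subnK (ltnW ik)) (two_sided_iter Kh).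
congr (mu _); apply/seteqP; split => x [Kx hx]; split=> // i ik.
  by rewrite e//; exact: hx.
by rewrite /past -e//; exact: hx.
Qed.

Lemma measurable_strict : measurable K.
Proof. by case: cov => Kh _ _ _; exact: two_sided_measurable Kh. Qed.

Lemma measurable_strict_past : measurable_fun setT (past psi h).
Proof. by case: cov => -[_ mh _ _ _] mpsi _ _; exact: measurable_past. Qed.

End cylinder_law.

(** The law of the past only depends on the factor: it does on cylinders, which
    generate, and it is sigma-finite because nu is. *)
Lemma past_law_unique d1 (X1 : measurableType d1) (D1 : set X1)
    (mu1 : {measure set X1 -> \bar R}) f1 psi1 K1 h1
    d2 (X2 : measurableType d2) (D2 : set X2)
    (mu2 : {measure set X2 -> \bar R}) f2 psi2 K2 h2 (F : (set Y)^nat) :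
  measurable D1 -> measurable D2 ->
  measure_preserving D1 mu1 D1 mu1 f1 -> measure_preserving D2 mu2 D2 mu2 f2 ->
  strict_covering D1 mu1 f1 psi1 K1 h1 -> strict_covering D2 mu2 f2 psi2 K2 h2 ->
  \bigcup_k F k = setT -> (forall k, measurable (F k)) ->
  (forall k, nu (E `&` F k) < +oo)%E ->
  forall C : set (pasts Y), measurable C ->
  mu1 (K1 `&` past psi1 h1 @^-1` C) = mu2 (K2 `&` past psi2 h2 @^-1` C).
Proof.
move=> mD1 mD2 ff1 ff2 cov1 cov2 FT mF Foo C mC.
pose m1 := image_measure (mrestr mu1 (measurable_strict cov1)) (measurable_strict_past cov1).
pose m2 := image_measure (mrestr mu2 (measurable_strict cov2)) (measurable_strict_past cov2).
have e1 A : m1 A = mu1 (K1 `&` past psi1 h1 @^-1` A) by rewrite setIC.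
have e2 A : m2 A = mu2 (K2 `&` past psi2 h2 @^-1` A) by rewrite setIC.
rewrite -e1 -e2.
apply: (@measure_unique _ R (pasts Y) (@cylinders _ Y) (fun k => cylinder 1 (fun=> F k))) => //.
- move=> _ _ [k [B [mB ->]]] [k' [B' [mB' ->]]].
  exists (maxn k k'), (fun i => (if (i < k)%N then B i else setT) `&`
                                (if (i < k')%N then B' i else setT)); split.
    by move=> i; apply: measurableI; case: ifP.
  apply/seteqP; split => s.
    by move=> [Bs B's] i _; split; case: ifPn => // ik; [exact: Bs|exact: B's].
  move=> h; split => i ik; have := h i; rewrite leq_max ik ?orbT => /(_ isT)[].
    by [].
  by [].
- by move=> k; exists 1%N, (fun=> F k).
- apply/seteqP; split => // s _; have : [set: Y] (s 0%N) by [].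
  by rewrite -FT => -[k _ Fk]; exists k => // -[].
- move=> _ [k [B [mB ->]]].
  by rewrite e1 e2 (past_cylinder mD1 ff1 cov1)// (past_cylinder mD2 ff2 cov2).
- move=> k; rewrite e1; have [_ _ _ law] := cov1.
  rewrite (_ : _ `&` _ = K1 `&` psi1 @^-1` F k) ?law//.
  apply/seteqP; split => x [Kx hx]; split => //; first exact: (hx 0%N).
  by case.
Qed.

End past_law.

(** * A criterion for natural extensions *)

(** Phi recovers a point from its past, that is from the values of psi along the
    backward orbit. *)
Section criterion.
Context {R : realType} d (X : measurableType d) d' (Y : measurableType d').
Variables (D : set X) (mu : {measure set X -> \bar R}) (f : X -> X).
Variables (E : set Y) (nu : {measure set Y -> \bar R}) (S : Y -> Y) (psi : X -> Y).
Variables (K : set X) (h : X -> X) (Phi : pasts Y -> X) (F : (set Y)^nat).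
Hypotheses (mD : measurable D) (mE : measurable E).
Hypotheses (mf : measurable_fun setT f) (mS : measurable_fun setT S).
Hypothesis SS : measure_preserving E nu E nu S.
Hypothesis cov : covers D mu f E nu S psi.
Hypothesis scov : strict_covering E nu S D mu f psi K h.
Hypothesis mdiag : measurable [set p : X * X | p.1 = p.2].
Hypothesis mPhi : measurable_fun setT Phi.
Hypothesis PhiK : \forall x \ae mu, K x -> Phi (past psi h x) = x.
Hypothesis psiPhi : forall s, psi (Phi s) = s 0%N.
Hypotheses (FT : \bigcup_k F k = setT) (mF : forall k, measurable (F k)).
Hypothesis Foo : forall k, (nu (E `&` F k) < +oo)%E.

Let ff : measure_preserving D mu D mu f. Proof. by case: cov. Qed.
Let Kh : two_sided D mu f K h. Proof. by case: scov. Qed.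
Let mpsi : measurable_fun setT psi. Proof. by case: scov. Qed.
Let mK : measurable K. Proof. exact: two_sided_measurable Kh. Qed.
Let KD : K `<=` D. Proof. exact: two_sided_sub Kh. Qed.
Let Kf x : K x -> K (f x).
Proof. by case: Kh => -[_ fK _ _] _ _ _ _ Kx; apply: fK; exists x. Qed.
Let mpast : measurable_fun setT (past psi h).
Proof. exact: measurable_strict_past scov. Qed.
Let mpast_pre C : measurable C -> measurable (past psi h @^-1` C).
Proof. by move=> mC; rewrite -[X in measurable X]setTI; exact: mpast. Qed.

Let bad := [set x | ~ (K x -> Phi (past psi h x) = x)].

Let bad_negligible : mu.-negligible bad. Proof. exact: PhiK. Qed.

Let past_map x : K x -> past psi h (f x) = shift_past S (past psi h x).
Proof.
case: scov => -[_ _ hK fh hf] _ eqpsi _ Kx.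
apply/funext => -[|k]; first by rewrite /past/= eqpsi.
by rewrite /past iterSr hf.
Qed.

(* A condition on the i-th term of the past defines the image under the i-th
   iterate of f of a set psi^-1 B. *)
Let sigma_past_past (C : set (pasts Y)) : measurable C ->
  sigma_past K f psi (K `&` past psi h @^-1` C).
Proof.
have [s0 sD sU] : sigma_algebra K (sigma_past K f psi) by exact: smallest_sigma_algebra.
pose G := [set C : set (pasts Y) | sigma_past K f psi (K `&` past psi h @^-1` C)].
suff : <<s @cylinders _ Y >> `<=` G by move=> + mC; exact.
apply: smallest_sub.
  split.
  - by rewrite /G/= preimage_set0 setI0.
  - move=> A GA; rewrite /G/= (_ : _ `&` _ = K `\` (K `&` past psi h @^-1` A)); first exact: sD.
    apply/seteqP; split => x [Kx].
      by move=> [_ nA]; split => // -[].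
    by move=> nA; split => //; split => // Ax; apply: nA.
  - move=> A GA; rewrite /G/= preimage_bigcup setI_bigcupr; exact: sU.
move=> _ [k [B [mB ->]]]; rewrite /G/=.
rewrite (_ : _ `&` _ = K `\` \bigcup_i
    (if (i < k)%N then K `\` (iter i f @` (K `&` psi @^-1` B i)) else set0)).
  apply: (sD); apply: sU => i; case: ifP => _; last exact: s0.
  apply: (sD).
  by apply: sub_sigma_algebra; exists i, (B i).
have [_ _ hK fh hf] := Kh.
have e x i : K x -> (iter i f @` (K `&` psi @^-1` B i)) x <-> B i (past psi h x i).
  move=> Kx; split=> [[y [Ky By] <-]|Bx].
    rewrite /past (_ : iter i h _ = y)//.
    elim: i {By} => [//|i IH]; rewrite iterSr iterS hf//.
    by elim: i {IH} => //= i; exact: Kf.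
  exists (iter i h x); first by split => //; exact: two_sided_iterK Kh _ _ _.
  by have := two_sided_iter Kh 0 i Kx; rewrite addn0.
apply/seteqP; split => x [Kx h1]; split=> //.
  by move=> [i _]; case: ifPn => // ik [_]; apply; apply/e => //; exact: h1.
move=> i ik; apply/e => //; apply: contrapT => h2; apply: h1.
by exists i => //; rewrite ik; split.
Qed.

(** For the universal property, apply Phi to the past in the other system. As
    the laws of the pasts agree, whatever holds for almost every past in X, such
    as the compatibility with f, also holds for almost every past in X'. *)
Theorem natural_extension_criterion : natural_extension D mu f E nu S psi.
Proof.
have [oneK mh hK fh hf] := Kh.
split=> //.
  exists K; first exact: oneK.
  move=> A mA AD.
  exists (K `&` past psi h @^-1` (Phi @^-1` A)).
    by apply: sigma_past_past; rewrite -[X in measurable X]setTI; exact: mPhi.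
  apply: negligibleS (negligibleU (two_sided_negligible mD Kh) bad_negligible).
  move=> x; rewrite /setY/= => -[[Ax nB]|[[Kx Bx] nA]].
    have [Kx|nKx] := pselect (K x); last by left; split=> //; exact: AD.
    right => /(_ Kx) e; apply: nB; split=> //.
    by rewrite /preimage/= e.
  by right => /(_ Kx) e; apply: nA; rewrite -e.
move=> d1 X' D' mu' f' psi' mD' one' cov'.
have [K' [h' [psi2 [scov' psi2E]]]] := covers_strict mD' one' cov'.
have ff' : measure_preserving D' mu' D' mu' f' by case: cov'.
have [Kh' mpsi' eqpsi' law'] := scov'.
have [_ mh' hK' fh' hf'] := Kh'.
have K'f x : K' x -> K' (f' x).
  by case: Kh' => -[_ fK _ _] _ _ _ _ Kx; apply: fK; exists x.
have transfer (C : set (pasts Y)) : measurable C ->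
    mu' (K' `&` past psi2 h' @^-1` C) = mu (K `&` past psi h @^-1` C).
  exact: (past_law_unique mS mD' mD ff' ff scov' scov FT mF Foo).
have mpast' : measurable_fun setT (past psi2 h') by exact: measurable_strict_past scov'.
have mK' : measurable K' by exact: two_sided_measurable Kh'.
have nK' := two_sided_negligible mD' Kh'.
have mpre C : measurable C -> measurable (past psi2 h' @^-1` C).
  by move=> mC; rewrite -[X in measurable X]setTI; exact: mpast'.
exists (Phi \o past psi2 h'); split.
- split; first by apply: measurable_funTS; exact: measurableT_comp mPhi mpast'.
  move=> A mA.
  have mC : measurable (Phi @^-1` A) by rewrite -[X in measurable X]setTI; exact: mPhi.
  transitivity (mu' (K' `&` past psi2 h' @^-1` (Phi @^-1` A))).
    apply: eq_measure_negligible.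
    + by apply: measurableI => //; rewrite comp_preimage; exact: mpre.
    + by apply: measurableI => //; exact: mpre.
    + apply: negligibleS nK' => x [[Dx Ax] nK]; split=> // Kx.
      by apply: nK.
    + apply: (negligibleS _ (negligible_set0 mu')) => x [[Kx Ax] nK].
      by apply: nK; split=> //; exact: two_sided_sub Kh' _ _.
  rewrite transfer//; apply: eq_measure_negligible.
  + by apply: measurableI => //; exact: mpast_pre.
  + exact: measurableI.
  + apply: negligibleS bad_negligible => x [[Kx Ax] nA] /(_ Kx) e.
    by apply: nA; split; [exact: KD|rewrite -e].
  + apply: negligibleS (negligibleU (two_sided_negligible mD Kh) bad_negligible).
    move=> x [[Dx Ax] nA]; have [Kx|nKx] := pselect (K x); last by left.
    by right => /(_ Kx) e; apply: nA; split => //; rewrite /preimage/= e.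
- pose C := [set s | Phi (shift_past S s) <> f (Phi s)].
  have mC : measurable C.
    rewrite (_ : C = ~` ((fun s => (Phi (shift_past S s), f (Phi s))) @^-1`
        [set p : X * X | p.1 = p.2])); last by [].
    apply: measurableC; rewrite -[X in measurable X]setTI.
    apply: measurable_fun_pair => //.
      by apply: measurableT_comp => //; exact: measurable_shift_past.
    exact: measurableT_comp.
  have C0 : mu' (K' `&` past psi2 h' @^-1` C) = 0%E.
    rewrite transfer//; apply: measure_negligible.
      by apply: measurableI => //; exact: mpast_pre.
    apply: negligibleS (negligibleU bad_negligible
      (negligible_preimage mD ff bad_negligible)).
    move=> x [Kx]; rewrite /preimage/= /C/= -past_map// => ne.
    have [Phix|nPhix] := pselect (Phi (past psi h x) = x); last by left => /(_ Kx).
    right; split; first exact: KD.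
    by rewrite /preimage/= => /(_ (Kf Kx)) e; apply: ne; rewrite e Phix.
  apply: (@negligibleS _ _ _ _ ((D' `\` K') `|` (K' `&` past psi2 h' @^-1` C))).
    move=> x /= h0.
    have [Dx|nDx] := pselect (D' x); last by case: h0.
    have [Kx|nKx] := pselect (K' x); last by left.
    right; split => //; rewrite /preimage/= /C/= => e; apply: h0 => _; rewrite -e.
    congr Phi; apply/funext => -[|k]; first by rewrite /past/= eqpsi'.
    by rewrite /past iterSr hf'.
  apply: negligibleU => //; apply/negligibleP => //.
  by apply: measurableI => //; exact: mpre.
- apply: negligibleS nK' => x /= h0.
  have [Dx|nDx] := pselect (D' x); last by case: h0.
  split=> // Kx; apply: h0 => _.
  by rewrite psiPhi /past/= psi2E.
Qed.

End criterion.

(** * Contraction along runs *)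

(** After m steps the head of the vector is the sum of all its initial entries.
    It never decreases afterwards, and m further steps fill all the other entries
    with former heads. *)
Section positive_matrix.
Context {R : realType}.
Variable m : nat.
Hypothesis m_gt0 : (0 < m)%N.
Implicit Types (z : nat -> R).

(** The matrix of the first branch in dual homogeneous coordinates. *)
Definition branch_op z (i : nat) : R :=
  if i == 0%N then z 0%N + z 1%N else if (i < m)%N then z i.+1 else z 0%N.

Definition total z : R := \sum_(i < m.+1) z i.

Lemma branch_opD a c z z' k i :
  iter k branch_op (fun j => a * z j + c * z' j) i =
  a * iter k branch_op z i + c * iter k branch_op z' i.
Proof.
elim: k i => // k IH i; rewrite !iterS /branch_op !IH.
by case: ifP => _; [ring|case: ifP].
Qed.

Lemma branch_op_ge0 z k i : (forall j, (j <= m)%N -> 0 <= z j) -> (i <= m)%N ->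
  0 <= iter k branch_op z i.
Proof.
move=> z0; elim: k i => [|k IH] i im; first exact: z0.
rewrite iterS /branch_op; case: ifP => _; first by rewrite addr_ge0// IH.
by case: ifPn => im'; rewrite IH.
Qed.

Lemma total_ge0 z : (forall j, (j <= m)%N -> 0 <= z j) -> 0 <= total z.
Proof. by move=> z0; apply: sumr_ge0 => i _; apply: z0; rewrite -ltnS. Qed.

Lemma le_total z i : (forall j, (j <= m)%N -> 0 <= z j) -> (i <= m)%N -> z i <= total z.
Proof.
move=> z0 im; rewrite /total (bigD1 (Ordinal (im : (i < m.+1)%N)))//= lerDl.
by apply: sumr_ge0 => j _; apply: z0; rewrite -ltnS.
Qed.

Lemma branch_op_upper z k i : (forall j, (j <= m)%N -> 0 <= z j) -> (i <= m)%N ->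
  iter k branch_op z i <= 2 ^+ k * total z.
Proof.
move=> z0; elim: k i => [|k IH] i im; first by rewrite mul1r le_total.
have t0 := total_ge0 z0.
rewrite iterS exprS -mulrA mulr2n mulrDl mul1r {1}/branch_op.
have e0 : 0 <= 2 ^+ k * total z by rewrite mulr_ge0// exprn_ge0.
case: ifP => _; first by apply: lerD; apply: IH.
by case: ifPn => im'; rewrite (le_trans (IH _ _))// lerDl.
Qed.

Let shiftE z k i : (0 < i)%N -> (i + k <= m)%N -> iter k branch_op z i = z (i + k)%N.
Proof.
move=> i0; elim: k i i0 => [|k IH] i i0 ik; first by rewrite addn0.
rewrite iterS /branch_op gtn_eqF// ifT; last by rewrite (leq_trans _ ik)// addnS ltnS leq_addr.
by rewrite IH// ?addSnnS.
Qed.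

Let head_partial z k : (k <= m)%N ->
  iter k branch_op z 0%N = \sum_(i < k.+1) z i.
Proof.
elim: k => [|k IH] km; first by rewrite big_ord1.
rewrite iterS {1}/branch_op eqxx IH; last exact: ltnW.
by rewrite [in RHS]big_ord_recr /= shiftE.
Qed.

Let head_ge z k : (forall j, (j <= m)%N -> 0 <= z j) ->
  total z <= iter (m + k) branch_op z 0%N.
Proof.
move=> z0; elim: k => [|k IH]; first by rewrite addn0 head_partial.
rewrite addnS iterS /branch_op eqxx (le_trans IH)// lerDl.
exact: branch_op_ge0.
Qed.

Lemma branch_op_lower z i : (forall j, (j <= m)%N -> 0 <= z j) -> (i <= m)%N ->
  total z <= iter (m + m) branch_op z i.
Proof.
move=> z0; case: i => [|i] im; first exact: head_ge.
have H k j : (k <= m)%N -> (0 < j <= m)%N -> (m - k < j)%N ->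
    total z <= iter (m + k) branch_op z j.
  elim: k j => [|k IH] j km /andP[j0 jm]; first by rewrite subn0 ltnNge jm.
  move=> kj; rewrite addnS iterS /branch_op gtn_eqF//; case: ifPn => jm'.
    apply: IH => //; first exact: ltnW.
    by rewrite -subnSK// ltnS.
  exact: head_ge.
by apply: H => //; rewrite subnn.
Qed.

End positive_matrix.

Section contraction.
Context {R : realType} {n : nat}.
Local Notation m := n.+1.
Variable N : R.
Hypothesis N_gt0 : 0 < N.
Local Notation f := (@ext_triangle_map R m N).
Local Notation g := (@ext_inverse R n N).
Local Notation D := (@ext_triangle_domain R m N).
Local Notation Y p := (hcoord N p).
Local Notation L := (m + m)%N.
Local Notation A := (branch_op m).
Implicit Types p q : m.-tuple R * m.-tuple R.

Let b : R := 2 ^+ L.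

Let b_gt1 : 1 < b.
Proof. by rewrite /b exprn_egt1// ltr1n. Qed.

(** The number w bounds the oscillation of the ratios of homogeneous coordinates,
    a projective distance of p and q within their common fibre. *)
Definition close (w : R) p q := p.1 = q.1 /\ exists l, forall i, (i <= m)%N ->
  l * Y q i <= Y p i <= (l + w) * Y q i.

Lemma hcoord_gt0 p i : D p -> (i <= m)%N -> 0 < Y p i.
Proof. by move=> /domain_simplex/ext_simplexP[_]; exact. Qed.

Lemma domain_iter k p : D p -> D (iter k f p).
Proof. by move=> Dp; elim: k => //= k; exact: domain_map. Qed.

Lemma iter_fst k p q : p.1 = q.1 -> (iter k f p).1 = (iter k f q).1.
Proof. by move=> pq; elim: k => //= k ->. Qed.

Lemma close_map w p q : D p -> D q -> close w p q -> close w (f p) (f q).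
Proof.
move=> Dp Dq [pq [l hl]]; split; first by rewrite /= pq.
have [sp _ _] := domain_simplex Dp; have [sq _ _] := domain_simplex Dq.
exists l => i im.
have comb c x y x' y' : 0 < c -> l * y <= x <= (l + w) * y -> l * y' <= x' <= (l + w) * y' ->
    l * (c * (y + y')) <= c * (x + x') <= (l + w) * (c * (y + y')).
  move=> c0 /andP[h1 h2] /andP[h3 h4].
  rewrite !(mulrCA _ c) !ler_pM2l// !mulrDr; apply/andP; split; exact: lerD.
have comb0 c x y : 0 < c -> l * y <= x <= (l + w) * y ->
    l * (c * y) <= c * x <= (l + w) * (c * y).
  by move=> c0 h; rewrite !(mulrCA _ c) !ler_pM2l.
have [d|d] := ltP 1 (p.1`_0 + p.1`_n).
  have d' : 1 < q.1`_0 + q.1`_n by rewrite -pq.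
  have c0 : 0 < p.1`_0 by exact: simplex_gt0.
  rewrite !hcoord_ext_triangle_map_A// -pq.
  case: ifP => _; first by apply: comb => //; exact: hl.
  by case: ifPn => im'; apply: comb0 => //; exact: hl.
have d' : q.1`_0 + q.1`_n <= 1 by rewrite -pq.
have c0 : 0 < 1 - p.1`_n by rewrite subr_gt0; exact: simplex_lt1.
rewrite !hcoord_ext_triangle_map_B// -pq.
case: ifPn => im'; first by apply: comb0 => //; exact: hl.
by apply: comb => //; exact: hl.
Qed.

Lemma close_iter w k p q : D p -> D q -> close w p q -> close w (iter k f p) (iter k f q).
Proof.
move=> Dp Dq pq; elim: k => //= k IH.
by apply: close_map => //; exact: domain_iter.
Qed.

Lemma normalization p : Y p 0 + \sum_(i < m) p.1`_i * Y p i.+1 = N.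
Proof. by rewrite /= /slack subrK. Qed.

(** The normalization weights the coordinates by the same positive numbers
    1, t_1, ..., t_m for p and q. *)
Lemma multiplier_le1 l p q : D p -> D q -> p.1 = q.1 ->
  (forall i, (i <= m)%N -> l * Y q i <= Y p i) -> l <= 1.
Proof.
move=> Dp Dq pq h; have [sp _ _] := domain_simplex Dp.
suff : l * (Y q 0 + \sum_(i < m) q.1`_i * Y q i.+1) <=
    Y p 0 + \sum_(i < m) p.1`_i * Y p i.+1.
  by rewrite !normalization -[leRHS]mul1r ler_pM2r.
rewrite mulrDr.
apply: lerD; first exact: h.
rewrite mulr_sumr; apply: ler_sum => i _; rewrite -pq [leLHS]mulrCA ler_pM2l; last exact: simplex_gt0.
exact: h.
Qed.

Lemma multiplier_ge1 l p q : D p -> D q -> p.1 = q.1 ->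
  (forall i, (i <= m)%N -> Y p i <= l * Y q i) -> 1 <= l.
Proof.
move=> Dp Dq pq h; have [sp _ _] := domain_simplex Dp.
suff : Y p 0 + \sum_(i < m) p.1`_i * Y p i.+1 <=
    l * (Y q 0 + \sum_(i < m) q.1`_i * Y q i.+1).
  by rewrite !normalization -[leLHS]mul1r ler_pM2r.
rewrite mulrDr.
apply: lerD; first exact: h.
rewrite mulr_sumr; apply: ler_sum => i _; rewrite -pq [leRHS]mulrCA ler_pM2l; last exact: simplex_gt0.
exact: h.
Qed.

Lemma close_dist w p q i : D p -> D q -> close w p q -> (i <= m)%N ->
  `|Y p i - Y q i| <= w * Y q i.
Proof.
move=> Dp Dq [pq [l hl]] im.
have l1 : l <= 1 by apply: (multiplier_le1 Dp Dq) => // j jm; case/andP: (hl j jm).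
have l2 : 1 <= l + w by apply: (multiplier_ge1 Dp Dq) => // j jm; case/andP: (hl j jm).
have y0 := hcoord_gt0 Dq im; have /andP[h1 h2] := hl i im.
rewrite ler_norml; apply/andP; split.
  rewrite lerNl opprB lerBlDl; apply: le_trans (_ : l * Y q i + w * Y q i <= _).
    by rewrite -mulrDl -[leLHS]mul1r ler_pM2r.
  by rewrite lerD2r.
rewrite lerBlDl (le_trans h2)// mulrDl lerD2r -[leRHS]mul1r ler_pM2r//.
Qed.

(* The scaling factor of each step depends on the common base point only. *)
Let run_scale k p q : D p -> D q -> p.1 = q.1 ->
  (forall i, (i < k)%N -> 1 < (iter i f p).1`_0 + (iter i f p).1`_n) ->
  exists2 c, 0 < c & forall i, (i <= m)%N ->
    Y (iter k f p) i = c * iter k A (hcoord N p) i /\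
    Y (iter k f q) i = c * iter k A (hcoord N q) i.
Proof.
move=> Dp Dq pq; elim: k => [|k IH] hk.
  by exists 1 => // i _; rewrite !mul1r.
have [i ik|c c0 hc] := IH _; first by apply: hk; exact: ltnW.
have [sp _ _] := domain_simplex (domain_iter k Dp).
have [sq _ _] := domain_simplex (domain_iter k Dq).
have e := iter_fst k pq.
have d := hk k (ltnSn k).
have d' : 1 < (iter k f q).1`_0 + (iter k f q).1`_n by rewrite -e.
exists ((iter k f p).1`_0 * c); first by rewrite mulr_gt0//; exact: simplex_gt0.
move=> i im; rewrite !iterS !hcoord_ext_triangle_map_A// -e -!mulrA.
have AE z : A z i = if i == 0%N then z 0%N + z 1%N else if (i < m)%N then z i.+1 else z 0%N.
  by [].
rewrite !AE.
have [h0 h0'] := hc 0%N isT; have [h1 h1'] := hc 1%N isT.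
case: ifP => _; first by rewrite h0 h0' h1 h1' !mulrDr.
case: ifPn => im'; last by rewrite h0 h0'.
by have [-> ->] := hc i.+1 im'.
Qed.

Let Yge0 p j : D p -> (j <= m)%N -> 0 <= Y p j.
Proof. by move=> Dp jm; apply/ltW/hcoord_gt0. Qed.

Let total_gt0 p : D p -> 0 < total m (hcoord N p).
Proof.
move=> Dp; apply: lt_le_trans (hcoord_gt0 Dp (leqnn m)) _.
by apply: le_total => // j; exact: Yge0.
Qed.

(** The image of the whole positive cone under a positive matrix has finite
    projective diameter. *)
Lemma close_run_init p q : D p -> D q -> p.1 = q.1 ->
  (forall i, (i < L)%N -> 1 < (iter i f p).1`_0 + (iter i f p).1`_n) ->
  close (b ^+ 2) (iter L f p) (iter L f q).
Proof.
move=> Dp Dq pq hL; have [c c0 hc] := run_scale Dp Dq pq hL.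
have DLp := domain_iter L Dp; have DLq := domain_iter L Dq.
have e := iter_fst L pq.
split; first exact: e.
have tp := total_gt0 Dp; have tq := total_gt0 Dq.
have b0 : 0 < b by exact: lt_trans b_gt1.
have lo r : D r -> forall i, (i <= m)%N -> total m (hcoord N r) <= iter L A (hcoord N r) i.
  by move=> Dr i im; apply: branch_op_lower => // j; exact: Yge0.
have up r : D r -> forall i, (i <= m)%N -> iter L A (hcoord N r) i <= b * total m (hcoord N r).
  by move=> Dr i im; apply: branch_op_upper => // j; exact: Yge0.
pose l := total m (hcoord N p) / (b * total m (hcoord N q)).
have hl i : (i <= m)%N -> l * Y (iter L f q) i <= Y (iter L f p) i.
  move=> im; have [-> ->] := hc i im; rewrite mulrCA ler_pM2l//.
  apply: le_trans (lo p Dp i im); rewrite /l mulrAC ler_pdivrMr ?mulr_gt0//.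
  by rewrite ler_pM2l//; exact: up.
have l1 : l <= 1 by apply: multiplier_le1 hl.
exists 0 => i im; rewrite mul0r add0r ltW ?hcoord_gt0//=.
have [-> ->] := hc i im; rewrite mulrCA ler_pM2l//.
apply: le_trans (up p Dp i im) _.
apply: (@le_trans _ _ (b ^+ 2 * total m (hcoord N q))); last first.
  by rewrite ler_pM2l ?exprn_gt0//; exact: lo.
rewrite expr2 -mulrA ler_pM2l//.
by move: l1; rewrite /l ler_pdivrMr ?mulr_gt0// mul1r.
Qed.

(** Birkhoff's contraction, in additive form: with l and l + w the extreme
    multipliers, the vectors r = Y p - l Y q and s = (l + w) Y q - Y p are
    nonnegative with sum w Y q. A positive matrix sends them to vectors that
    dominate multiples of the image of Y q, and moving the two bounds by these
    multiples gains w / b altogether. *)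
Lemma close_run w p q : D p -> D q -> close w p q ->
  (forall i, (i < L)%N -> 1 < (iter i f p).1`_0 + (iter i f p).1`_n) ->
  close ((1 - b^-1) * w) (iter L f p) (iter L f q).
Proof.
move=> Dp Dq [pq [l hl]] hL; have [c c0 hc] := run_scale Dp Dq pq hL.
split; first exact: iter_fst.
have tq := total_gt0 Dq.
have b0 : 0 < b by exact: lt_trans b_gt1.
have up i : (i <= m)%N -> iter L A (hcoord N q) i <= b * total m (hcoord N q).
  by move=> im; apply: branch_op_upper => // j; exact: Yge0.
pose r j := 1 * Y p j + (- l) * Y q j.
pose s j := (l + w) * Y q j + (- 1) * Y p j.
have r0 j : (j <= m)%N -> 0 <= r j.
  by move=> jm; have /andP[h _] := hl j jm; rewrite /r mul1r mulNr subr_ge0.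
have s0 j : (j <= m)%N -> 0 <= s j.
  by move=> jm; have /andP[_ h] := hl j jm; rewrite /s mulN1r subr_ge0.
have rs : total m r + total m s = w * total m (hcoord N q).
  rewrite /total -big_split mulr_sumr; apply: eq_bigr => i _ /=.
  by rewrite /r /s; ring.
exists (l + total m r / (b * total m (hcoord N q))) => i im.
have [-> ->] := hc i im; rewrite !(mulrCA _ c) !ler_pM2l//.
have bt : 0 < b * total m (hcoord N q) by rewrite mulr_gt0.
have key (z : nat -> R) : (forall j, (j <= m)%N -> 0 <= z j) ->
    total m z / (b * total m (hcoord N q)) * iter L A (hcoord N q) i <= iter L A z i.
  move=> z0; have := branch_op_lower (ltn0Sn n) z0 im; apply: le_trans.
  rewrite mulrAC ler_pdivrMr// ler_wpM2l ?up//.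
  exact: total_ge0.
apply/andP; split.
  have := key r r0.
  rewrite (branch_opD m 1 (- l) (hcoord N p) (hcoord N q) L i : iter L A r i = _).
  lra.
have := key s s0.
rewrite (branch_opD m (l + w) (- 1) (hcoord N q) (hcoord N p) L i : iter L A s i = _).
have -> : l + total m r / (b * total m (hcoord N q)) + (1 - b^-1) * w =
    l + w - total m s / (b * total m (hcoord N q)).
  have -> : total m s = w * total m (hcoord N q) - total m r by rewrite -rs; ring.
  by field; rewrite !gt_eqF.
lra.
Qed.

(** In the backward orbit of p, runs occur arbitrarily far back. *)
Definition recurrent p := D p /\ forall i, D (iter i g p) /\ exists k, run N L (iter k g (iter i g p)).

Lemma recurrent_iter k p : recurrent p -> recurrent (iter k g p).
Proof.
move=> [Dp hp]; split; first exact: (hp k).1.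
by move=> i; rewrite -iterD; exact: hp.
Qed.

Lemma recurrent_iterK j k p : recurrent p -> iter j f (iter (j + k) g p) = iter k g p.
Proof.
move=> [Dp hp]; elim: j => // j IH; rewrite iterSr addSn iterS domain_inverseK//.
by have [] := hp (j + k)%N.
Qed.

Lemma run_digits p : recurrent p -> run N L p -> forall i, (i < L)%N ->
  1 < (iter i f (iter L g p)).1`_0 + (iter i f (iter L g p)).1`_n.
Proof.
move=> gp /allP rp i iL.
have e : iter i f (iter L g p) = g (iter (L - i.+1) g p).
  transitivity (iter (L - i) g p); last by rewrite -subnSK.
  by have := recurrent_iterK i (L - i) gp; rewrite subnKC// ltnW.
rewrite e; have [sp _ _] := domain_simplex ((gp.2 (L - i.+1)%N).1).
have [_ ->] := ext_inverse_digit N sp.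
by apply: rp; rewrite mem_iota add0n ltn_subrL.
Qed.

(** The past of p determines its fibre coordinates: any q over the base point k
    steps back is brought close to p, since the runs met on the way contract. *)
Lemma recurrent_contraction j p : recurrent p -> exists k0, forall k q, (k0 <= k)%N -> D q ->
  q.1 = (iter k g p).1 -> close (b ^+ 2 * (1 - b^-1) ^+ j) (iter k f q) p.
Proof.
have split_iter d k (q : m.-tuple R * m.-tuple R) :
    iter (d + (L + k)) f q = iter k f (iter L f (iter d f q)).
  by rewrite -!iterD addnC (addnC L k) addnA.
elim: j p => [|j IH] p gp; have [k hk] := (gp.2 0%N).2;
  have gy := recurrent_iter k gp; have gz := recurrent_iter L gy;
  have Dz : D (iter L g (iter k g p)) by exact: gz.1.
- exists (L + k)%N => k' q kk' Dq.
  rewrite -(subnK kk'); move: (k' - (L + k))%N => d qE.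
  have -> : p = iter k f (iter L f (iter L g (iter k g p))).
    have := recurrent_iterK L 0 gy; rewrite addn0 => ->.
    by have := recurrent_iterK k 0 gp; rewrite addn0.
  have q'E : (iter d f q).1 = (iter L g (iter k g p)).1.
    by rewrite (iter_fst _ qE) recurrent_iterK// iterD.
  rewrite mulr1 split_iter; apply: close_iter; try by do ?exact: domain_iter.
  + by apply: domain_iter; exact: domain_iter.
  + apply: close_run_init => //; first exact: domain_iter.
    by move=> i iL; rewrite (iter_fst i q'E); exact: run_digits.
- have [k1 hk1] := IH _ gz.
  exists (k1 + (L + k))%N => k' q kk' Dq.
  have kk2 : (L + k <= k')%N by apply: leq_trans kk'; exact: leq_addl.
  have kd : (k1 <= k' - (L + k))%N by rewrite leq_subRL// addnC.
  rewrite -(subnK kk2); move: (k' - (L + k))%N kd => d kd qE.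
  have -> : p = iter k f (iter L f (iter L g (iter k g p))).
    have := recurrent_iterK L 0 gy; rewrite addn0 => ->.
    by have := recurrent_iterK k 0 gp; rewrite addn0.
  have c1 : close (b ^+ 2 * (1 - b^-1) ^+ j) (iter d f q) (iter L g (iter k g p)).
    by apply: hk1 => //; rewrite qE !iterD.
  rewrite split_iter; apply: close_iter.
  + by apply: domain_iter; exact: domain_iter.
  + exact: domain_iter.
  + rewrite (exprS _ j) mulrCA; apply: close_run => //; first exact: domain_iter.
    by move=> i iL; rewrite (iter_fst i c1.1); exact: run_digits.
Qed.

End contraction.

(** * The natural extension *)

Section assembly.
Context {R : realType} {n : nat}.
Local Notation m := n.+1.
Variable N : R.
Hypothesis N_gt0 : 0 < N.
Local Notation X := (m.-tuple R * m.-tuple R)%type.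
Local Notation f := (@ext_triangle_map R m N).
Local Notation g := (@ext_inverse R n N).
Local Notation T := (@triangle_map R m).
Local Notation D := (@ext_triangle_domain R m N).
Local Notation E := (triangle_domain R m).
Local Notation mu := (ext_triangle_measure R m).
Local Notation nu := (triangle_measure m N).
Local Notation lam := (lebesgue_tuple R m).
Local Notation L := (m + m)%N.
Implicit Types (p q : X) (t : m.-tuple R).

Let mD : measurable D. Proof. exact: measurable_ext_triangle_domain. Qed.

Let mE : measurable E. Proof. exact: measurable_triangle_domain. Qed.

Let mfst_pre (A : set (m.-tuple R)) : measurable A ->
  measurable (fst @^-1` A : set X).
Proof. by move=> mA; rewrite -[X in measurable X]setTI; exact: measurable_fst. Qed.

Lemma one_to_one_domain : one_to_one_on D mu f D.
Proof.
split.
- by split=> //; rewrite setDv measure0.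
- by move=> _ [p Dp <-]; exact: domain_map.
- move=> p q; rewrite !inE => Dp Dq e.
  by rewrite -(domain_mapK Dp) e domain_mapK.
- move=> A mA AD.
  rewrite (_ : f @` A = D `&` [set p : X | slack N p != p.2`_n] `&` g @^-1` A).
    apply: measurableI; last by rewrite -[X in measurable X]setTI; exact: measurable_ext_inverse.
    apply: measurableI => //; apply: measurable_boolset; apply: measurable_neg.
    apply: measurable_fun_eqr; [exact: measurable_slack|exact: measurable_snd_nth].
  apply/seteqP; split => p.
    move=> [q Aq <-]; have Dq := AD q Aq; split; first split.
    + exact: domain_map.
    + by have [] := back_digit_triangle_map (domain_simplex Dq).
    + by rewrite /preimage/= domain_mapK.
  by move=> [[Dp _] Ap]; exists (g p) => //; exact: domain_inverseK.
Qed.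

Lemma iter_ext_fst k p : (iter k f p).1 = iter k T p.1.
Proof. by elim: k => //= k ->. Qed.

Lemma domainP p : D p <-> ext_simplex N p /\ E p.1.
Proof.
split=> [[sp wp]|[sp [_ wp]]].
  by split=> //; split; [case: sp|move=> k; rewrite -iter_ext_fst; exact: wp].
by split=> // k; rewrite iter_ext_fst; exact: wp.
Qed.

Definition fiber_center t : m.-tuple R := [tuple N / (m.+1%:R * t`_i) | i < m].

Lemma ext_simplex_center t : simplex t -> ext_simplex N (t, fiber_center t).
Proof.
move=> st; split=> // [i im|] /=.
  rewrite (nth_tuple _ im) divr_gt0// mulr_gt0//; exact: simplex_gt0.
rewrite /slack (eq_bigr (fun=> N / m.+1%:R)); last first.
  move=> i _; rewrite (nth_tuple _ (ltn_ord i)) /=.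
  have ti : t`_i != 0 by rewrite gt_eqF//; exact: simplex_gt0.
  by field; rewrite ti gt_eqF.
rewrite sumr_const card_ord -(mulr_natr (N / _) m) subr_gt0 mulrAC ltr_pdivrMr//.
by rewrite ltr_pM2l// ltr_nat.
Qed.

Lemma domain_center t : E t -> D (t, fiber_center t).
Proof. by move=> Et; apply/domainP; split => //; apply: ext_simplex_center; case: Et. Qed.

Lemma triangle_measureE (A : set (m.-tuple R)) : nu A = mu (D `&` fst @^-1` A).
Proof. by rewrite setIC. Qed.

Lemma triangle_measure_fst (A : set (m.-tuple R)) :
  mu (D `&` fst @^-1` A) = nu (E `&` A).
Proof.
rewrite triangle_measureE; congr (mu _); apply/seteqP; split => p [Dp Ap].
  by split=> //; split=> //; have /domainP[] := Dp.
by case: Ap.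
Qed.

Lemma triangle_measure_preserving : measure_preserving E nu E nu T.
Proof.
split; first by apply: measurable_funTS; exact: measurable_triangle_map.
move=> A mA; apply: etrans (esym (triangle_measure_fst _)) _.
apply: etrans _ (triangle_measure_fst A).
exact: ((ext_triangle_measure_preserving N).2 _ (mfst_pre mA)).
Qed.

Lemma fst_covers : covers D mu f E nu T fst.
Proof.
split.
- exact: ext_triangle_measure_preserving.
- split; first by apply: measurable_funTS; exact: measurable_fst.
  by move=> A mA; exact: triangle_measure_fst.
- rewrite /onto (_ : _ `\` _ = set0); first exact: negligible_set0.
  apply/seteqP; split => // t [Et]; apply.
  by exists (t, fiber_center t) => //; exact: domain_center.
- by apply: aeW.
Qed.

Lemma strict_covering_fst K h : two_sided D mu f K h -> strict_covering E nu T D mu f fst K h.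
Proof.
move=> Kh; split; [exact: Kh|exact: measurable_fst|by move=> p _|].
- move=> Q mQ; apply: etrans _ (triangle_measure_fst Q); apply: eq_measure_negligible.
  + by apply: measurableI; [exact: (two_sided_measurable Kh)|exact: mfst_pre].
  + by apply: measurableI => //; exact: mfst_pre.
  + apply: (negligibleS _ (negligible_set0 mu)) => p [[Kp Qp]]; apply.
    by split => //; exact: two_sided_sub Kh _ _.
  + apply: negligibleS (two_sided_negligible mD Kh) => p [[Dp Qp] nK]; split=> // Kp.
    exact: nK.
Qed.

(* Off the simplex, F k contains everything, so that the sets F k cover. *)
Let F k : set (m.-tuple R) := [set t | simplex t -> k.+1%:R^-1 <= t`_n].

Let mF k : measurable (F k).
Proof.
rewrite (_ : F k = ~` @simplex R m `|` [set t : m.-tuple R | k.+1%:R^-1 <= t`_n]).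
  apply: measurableU; first by apply: measurableC; exact: measurable_simplex.
  by apply: measurable_boolset; apply: measurable_fun_ler => //; exact: measurable_nth.
apply/seteqP; split => t.
  by move=> h; have [st|] := pselect (simplex t); [right; exact: h|left].
by move=> [nst /nst|h _].
Qed.

Let FT : \bigcup_k F k = setT.
Proof.
apply/seteqP; split=> // t _; have [st|nst] := pselect (simplex t); last by exists 0%N.
have tn : 0 < t`_n by exact: simplex_gt0.
exists (Num.truncn (t`_n)^-1) => // _.
rewrite -[leRHS]invrK lef_pV2 ?posrE ?invr_gt0//.
exact/ltW/truncnS_gt.
Qed.

Let Foo k : (nu (E `&` F k) < +oo)%E.
Proof.
rewrite -triangle_measure_fst.
pose b1 := @box R m (fun=> 1); pose b2 := @box R m (fun=> N * k.+1%:R).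
apply: (@le_lt_trans _ _ (mu (b1 `*` b2))).
  apply: le_measure; rewrite ?inE.
  - by apply: measurableI => //; exact: mfst_pre.
  - by apply: measurableX; exact: measurable_box.
  move=> p [Dp Fp]; have [sp up s0] := domain_simplex Dp.
  split=> i im; first by rewrite !ltW//; [exact: simplex_lt1|exact: simplex_gt0].
  have ui : 0 < p.2`_i by exact: up.
  rewrite ltW//=.
  have h : k.+1%:R^-1 <= p.1`_i.
    by apply: le_trans (Fp sp) _; exact: simplex_ge_last.
  rewrite -ler_pdivrMr// mulrC.
  apply: (@le_trans _ _ (p.1`_i * p.2`_i)); first by rewrite ler_pM2r.
  move: s0; rewrite /slack subr_gt0 => /ltW; apply: le_trans.
  rewrite (bigD1 (Ordinal im))//= lerDl sumr_ge0// => j _.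
  by rewrite mulr_ge0// ltW//; [exact: simplex_gt0|exact: up].
rewrite /ext_triangle_measure/= product_measure1E; try exact: measurable_box.
apply: lte_mul_pinfty.
- exact: measure_ge0.
- rewrite ge0_fin_numE ?measure_ge0//.
  by apply: le_lt_trans (lebesgue_box_le _ _) _ => //; rewrite ltry.
- apply: le_lt_trans (lebesgue_box_le _ _) _; last by rewrite ltry.
  by move=> i; rewrite mulr_ge0// ltW.
Qed.

Let mdiag : measurable [set p : X * X | p.1 = p.2].
Proof.
pose c (i : nat) (p : X * X) := (p.1.1`_i == p.2.1`_i) && (p.1.2`_i == p.2.2`_i).
rewrite (_ : mkset _ = \bigcap_i [set p : X * X | c i p]).
  apply: bigcapT_measurable => i; apply: measurable_boolset; apply: measurable_and.
    apply: measurable_fun_eqr.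
      exact: (measurableT_comp (measurable_fst_nth i) measurable_fst).
    exact: (measurableT_comp (measurable_fst_nth i) measurable_snd).
  apply: measurable_fun_eqr.
    exact: (measurableT_comp (measurable_snd_nth i) measurable_fst).
  exact: (measurableT_comp (measurable_snd_nth i) measurable_snd).
apply/seteqP; split => -[p q] /=; first by move=> -> i _; rewrite /= /c /= !eqxx.
move=> h; rewrite [LHS]surjective_pairing [RHS]surjective_pairing.
by congr pair; apply: eq_tuple => i _; have /andP[/eqP ? /eqP ?] := h i I.
Qed.

(** Any point of the fibre over the k-th term of the past would serve as
    starting point. *)
Definition approx (k : nat) (s : pasts (m.-tuple R)) : m.-tuple R :=
  (iter k f (s k, fiber_center (s k))).2.

(** The upper limit, unlike the limit, is measurable without any convergence
    assumption. *)
Definition reconstruct (s : pasts (m.-tuple R)) : X :=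
  (s 0%N, [tuple fine (limn_esup (fun k => ((approx k s)`_i)%:E)) | i < m]).

Lemma measurable_fiber_center : measurable_fun setT fiber_center.
Proof.
apply/measurable_fun_tnthP => i.
rewrite (_ : _ \o _ = fun t : m.-tuple R => N / (m.+1%:R * t`_i)); last first.
  by apply/funext => t; rewrite /= tnth_mktuple.
apply: measurable_funM => //; apply: measurable_inv_fun; apply: measurable_funM => //.
exact: measurable_nth.
Qed.

Lemma measurable_approx k : measurable_fun setT (approx k).
Proof.
have mc : measurable_fun setT (fun s : pasts (m.-tuple R) => (s k, fiber_center (s k))).
  apply: measurable_fun_pair; first exact: measurable_coord.
  exact: measurableT_comp measurable_fiber_center (measurable_coord k).
apply: (measurableT_comp measurable_snd).
apply: (measurableT_comp _ mc); apply: measurable_iterT.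
exact: measurable_ext_triangle_map.
Qed.

Lemma measurable_reconstruct : measurable_fun setT reconstruct.
Proof.
apply: measurable_fun_pair; first exact: measurable_coord.
apply/measurable_fun_tnthP => i.
rewrite (_ : _ \o _ = fun s : pasts (m.-tuple R) =>
   fine (limn_esup (fun k => ((approx k s)`_i)%:E))); last first.
  by apply/funext => t; rewrite /= tnth_mktuple.
apply: (@measurableT_comp _ _ _ _ _ _ (@fine R)) => //.
apply: measurable_fun_limn_esup => k.
apply/measurable_EFinP; apply: (measurableT_comp (@measurable_nth R m i)).
exact: measurable_approx.
Qed.

Lemma approx_cvg p (s : pasts (m.-tuple R)) i : recurrent N p ->
  (forall k, s k = (iter k g p).1) -> (i < m)%N ->
  (approx k s)`_i @[k --> \oo] --> p.2`_i.
Proof.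
move=> gp sE im; have Dp := gp.1.
pose b : R := 2 ^+ L.
have b1 : 1 < b by rewrite /b exprn_egt1// ltr1n.
have b0 : 0 < b by exact: lt_trans b1.
pose a : R := 1 - b^-1.
have a0 : 0 <= a by rewrite subr_ge0 invf_le1// ltW.
have a1 : a < 1 by rewrite /a ltrBlDr ltrDl invr_gt0.
have cg : geometric (b ^+ 2 * p.2`_i) a @ \oo --> (0 : R).
  by apply: cvg_geometric; rewrite ger0_norm.
apply/cvgrPdist_le => e e0.
have [j hj] : exists j, b ^+ 2 * a ^+ j * p.2`_i <= e.
  move/cvgrPdist_le : cg => /(_ e e0)[j _ /(_ j (leqnn j))].
  rewrite sub0r normrN => hj; exists j; apply: le_trans hj.
  by rewrite /geometric/= mulrAC ler_norm.
have [k0 hk0] := recurrent_contraction N_gt0 j gp.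
exists k0 => // k /= kk0.
have DD : D (s k, fiber_center (s k)).
  apply: domain_center; rewrite sE.
  by have /domainP[] := (gp.2 k).1.
have cl := hk0 k _ kk0 DD (sE k).
rewrite distrC; apply: le_trans hj.
apply: (close_dist N_gt0 _ Dp cl (im : (i.+1 <= m)%N)).
exact: domain_iter.
Qed.

Lemma reconstruct_recurrent p (s : pasts (m.-tuple R)) : recurrent N p ->
  (forall k, s k = (iter k g p).1) -> reconstruct s = p.
Proof.
move=> gp sE; rewrite [RHS]surjective_pairing /reconstruct sE; congr pair.
apply: eq_tuple => i im; rewrite (nth_tuple _ im) /=.
have h : ((approx k s)`_i)%:E @[k --> \oo] --> (p.2`_i)%:E.
  by apply: cvg_EFin; [exact: nearW|exact: approx_cvg].
rewrite is_cvg_limn_esupE; last by apply/cvg_ex; eexists; exact: h.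
by rewrite (cvg_lim _ h).
Qed.

Lemma two_sided_ext_inverse K h p : two_sided D mu f K h -> K p -> forall k,
  iter k h p = iter k g p.
Proof.
move=> Kh Kp; have [_ _ hK fh _] := Kh.
elim=> // k IH; rewrite !iterS -IH.
have Kk := two_sided_iterK Kh k Kp.
by rewrite -[in RHS](fh _ Kk) domain_mapK//; apply: two_sided_sub Kh _ _; exact: hK.
Qed.

(** Each point of the backward orbit avoids the null set of points without a run
    because the inverse preserves the measure. *)
Lemma recurrent_ae K h : two_sided D mu f K h -> \forall p \ae mu, K p -> recurrent N p.
Proof.
move=> Kh; have ff : measure_preserving D mu D mu f := ext_triangle_measure_preserving N.
have mZ : measurable (@no_run R n N L 0) by exact: measurable_no_run.
pose B i := K `&` iter i h @^-1` (no_run N L 0).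
have B0 i : mu.-negligible (B i).
  have [_ mh _ _ _] := Kh.
  apply/negligibleP.
    apply: measurableI; first exact: two_sided_measurable Kh.
    by rewrite -[X in measurable X]setTI; exact: measurable_iterT.
  apply: etrans (two_sided_iter_measure mD ff Kh i mZ) _.
  apply: measure_negligible.
    by apply: measurableI => //; exact: two_sided_measurable Kh.
  apply: negligibleS (_ : mu.-negligible (no_run N L 0)); first by move=> ? [].
  by apply/negligibleP => //; exact: no_run_null.
apply: negligibleS (negligible_bigcup B0) => p /= np.
apply: contrapT => nB; apply: np => Kp.
have KD := two_sided_sub Kh.
split; first exact: KD.
move=> i; have e := two_sided_ext_inverse Kh Kp i.
have Di : D (iter i g p) by rewrite -e; apply/KD/(two_sided_iterK Kh).
split=> //; apply: contrapT => nk; apply: nB; exists i => //; split=> //.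
rewrite /preimage/= e.
have nr k : ~~ run N L (iter k g (iter i g p)).
  by apply/negP => h'; apply: nk; exists k.
by split=> //; [exact: domain_simplex|rewrite subn0; exact: (nr 0%N)].
Qed.

Theorem natural_extension_triangle : natural_extension D mu f E nu T fst.
Proof.
have [K [h [Kh _]]] :=
  one_to_one_two_sided mD (ext_triangle_measure_preserving N) one_to_one_domain.
have PhiK : \forall p \ae mu, K p -> reconstruct (past fst h p) = p.
  apply: filterS (recurrent_ae Kh) => p gp Kp.
  apply: reconstruct_recurrent; first exact: gp.
  by move=> k; rewrite /past (two_sided_ext_inverse Kh).
exact: (natural_extension_criterion mD mE (measurable_ext_triangle_map N)
  (@measurable_triangle_map R m) triangle_measure_preserving fst_covers
  (strict_covering_fst Kh) mdiag measurable_reconstruct PhiK (fun=> erefl)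
  FT mF Foo).
Qed.

End assembly.

Theorem theorem6p5 (R : realType) (m : nat) (N : R) (m_gt1 : (1 < m)%N)
    (N_gt0 : 0 < N) :
  natural_extension
    (ext_triangle_domain m N) (ext_triangle_measure R m) (ext_triangle_map N)
    (triangle_domain R m) (triangle_measure m N) triangle_map
    fst.
Proof. by case: m m_gt1 => [//|n] _; exact: natural_extension_triangle. Qed.
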